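(* Let $B\subset W$ be a good lattice, $n\in\mathbb{N}$ (so $n\ge 0$), and let $\psi$ be a primitive character of the ring $O_n=\mathcal{O}/\varpi^{n+1}\mathcal{O}$. (i) Assume $\varpi B^*\subsetneq B$. Let $S$ be a Weil representation of type $\psi$ of $Sp(\mathrm{b}_n)$, where $\mathrm b_n=B/\varpi^{n+1}B^*$. Then there is a unique Weil representation $\sigma$ of type $\psi$ of $Sp(\mathrm{b}_n)$ relative to the natural morphism from $Sp(\mathrm{b}_n)$ to $Sp(\overline{\mathrm u^\perp})$ (which is $Sp(\mathrm{b})$ if $n$ is even, $Sp(\mathrm{b}^* )$ if $n$ is odd) such that $S=S^{\mathrm{u},\sigma}$. In all cases the representations appearing in the decomposition (D) of $S^{\mathrm u,\sigma}$ described in the context are irreducible and pairwise inequivalent. When $B\subsetneq B^*$ there are $2n+2$ of them; when $B=B^*$ there are $n+2$ of them. They are monomial if $B=B^*$ and $n$ is odd. (ii) Assume $B\subsetneq B^*$. Let $S$ be a Weil representation of type $\psi$ of $Sp(\mathrm{b}^*_n)$, where $\mathrm b^*_n=B^*/\varpi^nB$. Then there is a unique Weil representation $\sigma$ of type $\psi$ of $Sp(\mathrm{b}^*_n)$ relative to the natural morphism from $Sp(\mathrm{b}^*_n)$ to $Sp(\overline{\mathrm u^{*\perp}})$ (which is $Sp(\mathrm{b}^* )$ if $n$ is even, $Sp(\mathrm{b})$ if $n$ is odd) such that $S=S^{\mathrm{u}^*,\sigma}$. In all cases the representations appearing in the decomposition (D) of $S^{\mathrm u^*,\sigma}$ are irreducible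 and pairwise inequivalent. When $\varpi B^*\subsetneq B$ there are $2n+2$ of them; when $\varpi B^*=B$ there are $n+2$ of them. They are monomial if $\varpi B^*=B$ and $n$ is odd.
   Context: **Lattices.** $k$ is a non-archimedean local field of characteristic $0$ with ring of integers $\mathcal{O}$, uniformizer $\varpi$, residue field $\mathbb{F}_q$ of characteristic $p\ne 2$. $\lambda_\psi$ is a fixed integer (the conductor of a fixed non-trivial additive character of $k$). $(W,\beta)$ is a symplectic $k$-vector space of dimension $2r$. A lattice is a compact open $\mathcal{O}$-submodule $B$ of $W$; its dual is $B^*=\{v\in W:\beta(v,b)\in\varpi^{\lambda_\psi}\mathcal{O}\ \forall b\in B\}$. $B$ is *good* if $\varpi B^*\subset B\subset B^*$. $\mathrm{b}_n=B/\varpi^{n+1}B^*$ and $\mathrm{b}^*_n=B^*/\varpi^nB$ are finite $O_n$-modules with non-degenerate alternating forms $\beta_{\mathrm{b}_n}(\bar v,\bar w)=\varpi^{-\lambda_\psi}\beta(v,w)\bmod\varpi^{n+1}$ ($v,w\in B$) and $\beta_{\mathrm{b}^*_n}(\bar v,\bar w)=\varpi^{1-\lambda_\psi}\beta(v,w)\bmod \varpi^{n+1}$ ($v,w\in B^*$). $Sp(\cdot)$ denotes the group of $O_n$-linear automorphisms preserving the form. Put $\mathrm{b}=\mathrm{b}_0$, $\mathrm{b}^*=\mathrm{b}^*_0$. **Weil representations over a finite local ring $F$** (here $F=O_n$). A character $\psi$ of $(F,+)$ is primitive if its kernel contains no ideal other than $\{0\}$. For a finite symplectic $F$-module $(V,\beta)$,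 $H(V)=V\times F$ with $(w,t)(w',t')=(w+w',t+t'+\frac12\beta(w,w'))$, and $\rho_\psi$ is its unique irreducible unitary representation with central character $\psi$ (Schrödinger representation). $Sp(V)$ acts on $H(V)$ by $g.(w,t)=(gw,t)$. If $\gamma:G\to Sp(V)$ is a morphism from a finite group, a *Weil representation of type $\psi$ of $G$ relative to $\gamma$* is a representation $S$ of $G$ on the space of $\rho_\psi$ with $S(g)\rho_\psi(h)S(g)^{-1}=\rho_\psi(\gamma(g).h)$; for $G=Sp(V)$, $\gamma=\mathrm{Id}$, one says Weil representation of $Sp(V)$. Equality and uniqueness of Weil representations are understood up to isomorphisms intertwining both the Heisenberg representations and the representations of $G$. **The representation $S^{U,\sigma}$.** Let $U\subset V$ be an $Sp(V)$-invariant isotropic submodule, $U^\perp$ its orthogonal, $\overline{U^\perp}=U^\perp/U$ with the induced symplectic form, $r_U:Sp(V)\to Sp(\overline{U^\perp})$ the natural morphism, $\sigma$ a Weil representation of type $\psi$ of $Sp(V)$ relative to $r_U$, on a space $\mathcal{H}_\sigma$ that also carries the Schrödinger representation of $H(\overline{U^\perp})$; let $\rho_{U^\perp,\psi}$ be its inflation to $H(U^\perp)=U^\perp\times F$. Let $\mathcal{H}^U$ be the space of functions $\varphi:V\to\mathcal{H}_\sigma$ with $\varphi(x+w)=\psi(\frac12\beta(x,w))\rho_{U^\perp,\psi}(w,0)\varphi(x)$ for $x\in V$, $w\in U^\perp$. $H(V)$ acts on $\mathcal{H}^U$ by $((v,t)\varphi)(x)=\psi(t+\frac12\beta(x,v))\varphi(x+v)$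 (a model of $\rho_\psi$) and $S^{U,\sigma}(g)\varphi(x)=\sigma(g)[\varphi(g^{-1}x)]$, which is a Weil representation of $Sp(V)$. **Decomposition (D).** For $x\in V\setminus U^\perp$ let $G(\hat x)$ be the stabilizer of $x+U^\perp$ in $Sp(V)$ and $\sigma_{\dot x}(g)=\sigma(g)\rho_{U^\perp,\psi}(g^{-1}x-x,\frac12\beta(x,g^{-1}x))$, a representation of $G(\hat x)$ on $\mathcal{H}_\sigma$. One has $-\mathrm{Id}\notin G(\hat x)$; let $\sigma^{\pm}_{\dot x}$ be its extension to $\{\pm \mathrm{Id}\}G(\hat x)$ with $\sigma_{\dot x}^\pm(-\mathrm{Id})=\pm\mathrm{Id}$, and $S^\pm_{\dot x}=\mathrm{Ind}_{\{\pm\mathrm{Id}\}G(\hat x)}^{Sp(V)}\sigma^\pm_{\dot x}$. Let $\sigma^\pm$ be the subrepresentation of $\sigma$ on the $\pm1$-eigenspace of $\sigma(-\mathrm{Id})$. If $X\subset V$ is a set of representatives of the $Sp(V)$-orbits in $(V/U^\perp)\setminus\{0\}$, then $$(D)\quad S^{U,\sigma}=\begin{cases}\sigma\oplus\bigoplus_{x\in X}(S^+_{\dot x}\oplus S^-_{\dot x})&\text{if }\overline{U^\perp}=\{0\},\\ (\sigma^+\oplus\sigma^-)\oplus\bigoplus_{x\in X}(S^+_{\dot x}\oplus S^-_{\dot x})&\text{if }\overline{U^\perp}\neq\{0\}.\end{cases}$$ The ''representations appearing in (D)'' are these listed summands. **The submodules $\mathrm u$, $\mathrm u^*$** (the maximal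 isotropic invariant submodules). For $V=\mathrm{b}_n$: if $n=2m$, $\mathrm{u}=\varpi^{m+1}B^*/\varpi^{n+1}B^*$, $\mathrm{u}^\perp=\varpi^mB/\varpi^{n+1}B^*$, $\overline{\mathrm{u}^\perp}\cong\mathrm{b}$; if $n=2m+1$, $\mathrm{u}=\varpi^{m+1}B/\varpi^{n+1}B^*$, $\mathrm{u}^\perp=\varpi^{m+1}B^*/\varpi^{n+1}B^*$, $\overline{\mathrm{u}^\perp}\cong\mathrm{b}^*$. For $V=\mathrm{b}^*_n$: if $n=2m$, $\mathrm{u}^*=\varpi^mB/\varpi^nB$, $\mathrm{u}^{*\perp}=\varpi^mB^*/\varpi^nB$, $\overline{\mathrm{u}^{*\perp}}\cong\mathrm{b}^*$; if $n=2m+1$, $\mathrm{u}^*=\varpi^{m+1}B^*/\varpi^nB$, $\mathrm{u}^{*\perp}=\varpi^mB/\varpi^nB$, $\overline{\mathrm{u}^{*\perp}}\cong\mathrm{b}$. The isomorphisms are division by the power of $\varpi$, and identify the symplectic groups. Monomial means induced from a one-dimensional character of a subgroup. *)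

(* Defs.v *)
From HB Require Import structures.
From mathcomp Require Import all_boot all_order all_algebra all_fingroup.
From mathcomp Require Import ring_quotient generic_quotient.
From mathcomp Require Import finmap boolp classical_sets functions cardinality.
From mathcomp Require Import topology ring.

Set Implicit Arguments.
Unset Strict Implicit.
Unset Printing Implicit Defensive.

Import Order.TTheory GRing.Theory Num.Theory.
Local Open Scope ring_scope.
Local Open Scope quotient_scope.

(* The value of lf_val at 0 is irrelevant; v(0) = +oo is built into ppow. *)
Record localField := LocalField {
  lf_field :> fieldType;
  lf_val : lf_field -> int;
  lf_valM : forall x y, x != 0 -> y != 0 ->
    lf_val (x * y) = lf_val x + lf_val y;
  lf_valD : forall x y, x != 0 -> y != 0 -> x + y != 0 ->
    Num.min (lf_val x) (lf_val y) <= lf_val (x + y);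
  lf_unif : lf_field;
  lf_unif_neq0 : lf_unif != 0;
  lf_val_unif : lf_val lf_unif = 1;
  lf_complete : forall u : nat -> lf_field,
    (forall N : int, exists M : nat, forall i j, (M <= i)%N -> (M <= j)%N ->
       (u i == u j) || (N <= lf_val (u i - u j))) ->
    exists l, forall N : int, exists M : nat, forall i, (M <= i)%N ->
       (u i == l) || (N <= lf_val (u i - l));
  lf_residue_finite : exists s : seq lf_field,
    forall x, (x == 0) || (0 <= lf_val x) ->
    exists2 y, y \in s & (x == y) || (1 <= lf_val (x - y));
  lf_char0 : [pchar lf_field] =i pred0
}.

(* ppow k i is the fractional ideal ϖ^i O. *)
Definition ppow (k : localField) (i : int) : {pred k} :=
  [pred x | (x == 0) || (i <= lf_val x)].
Arguments ppow : clear implicits.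

Section Valuation.
Variable k : localField.
Implicit Types (x y : k) (i j : int).

Lemma ppow0 i : 0 \in ppow k i. Proof. by rewrite inE eqxx. Qed.

Lemma ppowW i j x : j <= i -> x \in ppow k i -> x \in ppow k j.
Proof.
by move=> ji; rewrite !inE => /orP[->//|h]; rewrite (le_trans ji h) orbT.
Qed.

Lemma val1 : lf_val (1 : k) = 0.
Proof.
have := lf_valM (oner_neq0 k) (oner_neq0 k); rewrite mulr1 => /eqP.
by rewrite -subr_eq0 opprD addrA subrr add0r oppr_eq0 => /eqP.
Qed.

Lemma ppowM i j x y :
  x \in ppow k i -> y \in ppow k j -> x * y \in ppow k (i + j).
Proof.
rewrite !inE; have [->|x0] := eqVneq x 0; first by rewrite mul0r eqxx.
have [->|y0] := eqVneq y 0; first by rewrite mulr0 eqxx.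
by move=> /= hx hy; rewrite lf_valM// lerD ?orbT.
Qed.

Lemma ppowD i x y : x \in ppow k i -> y \in ppow k i -> x + y \in ppow k i.
Proof.
rewrite !inE; have [->|x0] := eqVneq x 0; first by rewrite add0r.
have [->|y0] := eqVneq y 0; first by rewrite addr0 (negPf x0).
move=> /= hx hy; have [//|xy0] := eqVneq (x + y) 0.
by rewrite (le_trans _ (lf_valD x0 y0 xy0))// le_min hx hy.
Qed.

Lemma ppow1 : 1 \in ppow k 0.
Proof. by rewrite inE val1 lexx orbT. Qed.

Lemma ppowN1 : -1 \in ppow k 0.
Proof.
have N10 : -1 != 0 :> k by rewrite oppr_eq0 oner_neq0.
have := lf_valM N10 N10; rewrite mulrNN mulr1 val1 => h.
by rewrite inE; apply/orP; right; rewrite -(pmulrn_lge0 _ (isT : 0 < 2)%N) mulr2n -h.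
Qed.

Lemma ppowN i x : x \in ppow k i -> - x \in ppow k i.
Proof. by move=> h; rewrite -mulN1r -[i]add0r ppowM// ppowN1. Qed.

Lemma ppowB i x y : x \in ppow k i -> y \in ppow k i -> x - y \in ppow k i.
Proof. by move=> hx hy; rewrite ppowD// ppowN. Qed.

Lemma val_unifX i : lf_val (lf_unif k ^ i) = i.
Proof.
have u0 := lf_unif_neq0 k.
have hn (n : nat) : lf_val (lf_unif k ^+ n) = n.
  elim: n => [|n IH]; first by rewrite expr0 val1.
  by rewrite exprS lf_valM ?expf_neq0// IH lf_val_unif.
case: i => n; first exact: hn.
change (lf_val (lf_unif k ^- n.+1) = Negz n).
rewrite NegzE; apply/eqP; rewrite -subr_eq0 opprK addrC.
have := lf_valM (expf_neq0 n.+1 u0) (invr_neq0 (expf_neq0 n.+1 u0)).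
by rewrite divff ?expf_neq0// val1 hn => <-; rewrite eqxx.
Qed.

Lemma unifX_neq0 i : lf_unif k ^ i != 0.
Proof. by rewrite expfz_neq0 ?lf_unif_neq0. Qed.

Lemma ppow_unif i : lf_unif k ^ i \in ppow k i.
Proof. by rewrite inE val_unifX lexx orbT. Qed.

Lemma ppow_shift i j x : (lf_unif k ^ i * x \in ppow k j) = (x \in ppow k (j - i)).
Proof.
apply/idP/idP => h; last by have := ppowM (ppow_unif i) h; rewrite subrKC.
have := ppowM (ppow_unif (- i)) h.
by rewrite mulrA -expfzDr ?lf_unif_neq0// addNr expr0z mul1r addrC.
Qed.

Lemma ppow_subring : subring_closed (ppow k 0).
Proof.
split; [exact: ppow1|by move=> x y; exact: ppowB|].
by move=> x y hx hy; have := ppowM hx hy; rewrite addr0.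
Qed.

Definition oring_pred : {pred k} := ppow k 0.
HB.instance Definition _ := GRing.isSubringClosed.Build k oring_pred ppow_subring.

(* O *)
Record oring := ORing { oval :> k; ovalP : oval \in oring_pred }.
HB.instance Definition _ := [isSub for oval].
HB.instance Definition _ := [Choice of oring by <:].
HB.instance Definition _ := [SubChoice_isSubComNzRing of oring by <:].

(* ϖ^(n+1) O as an ideal of O *)
Definition oideal (n : nat) : {pred oring} := [pred a | oval a \in ppow k n.+1].

Lemma oideal_closed n : idealr_closed (oideal n).
Proof.
split.
- by rewrite inE ppow0.
- by rewrite !inE /= oner_eq0 val1.
- move=> a u v hu hv; rewrite inE /=; apply: ppowD; last exact: hv.
  by rewrite -[X in ppow _ X]add0r; apply: ppowM => //; exact: ovalP.
Qed.
HB.instance Definition _ n := isIdealr.Build oring (oideal n) (oideal_closed n).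

(* O_n = O / ϖ^(n+1) O *)
Definition On (n : nat) : Type := {ideal_quot (oideal n : idealr oring)}.
HB.instance Definition _ n := GRing.ComNzRing.on (On n).

Lemma On_cover N : exists s : seq k, forall x, x \in oring_pred ->
  exists2 y, y \in s & x - y \in ppow k N%:Z.
Proof.
elim: N => [|N [s hs]].
  by exists [:: 0] => x hx; exists 0; rewrite ?mem_head// subr0.
have [t ht] := lf_residue_finite k.
exists [seq y + lf_unif k ^ N%:Z * z | y <- s, z <- t] => x hx.
have [y ys hy] := hs _ hx.
have : lf_unif k ^ (- N%:Z) * (x - y) \in ppow k 0.
  by rewrite ppow_shift sub0r opprK.
move=> /ht[z zt hz]; exists (y + lf_unif k ^ N%:Z * z).
  by apply/allpairsP; exists (y, z).
have -> : x - (y + lf_unif k ^ N%:Z * z)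
    = lf_unif k ^ N%:Z * (lf_unif k ^ (- N%:Z) * (x - y) - z).
  by rewrite mulrBr mulrA -expfzDr ?lf_unif_neq0// subrr expr0z mul1r opprD addrA.
by rewrite ppow_shift intS addrK inE subr_eq0.
Qed.

Lemma oring_predE x : (x \in oring_pred) = (x \in ppow k 0). Proof. by []. Qed.

Definition oring_of x : oring := insubd 0 x.
Lemma oring_ofK x : x \in oring_pred -> oval (oring_of x) = x.
Proof. by move=> h; rewrite /oring_of insubdK. Qed.

Definition redn n x : On n := \pi_(On n) (oring_of x).

End Valuation.

Section FiniteOfSeq.
Variables (T : choiceType) (s : seq T) (hs : forall x, x \in s).

Lemma index_onthK : pcancel (fun x => index x s) (onth s).
Proof.
by move=> x; rewrite onthE (nth_map x) ?index_mem ?hs// nth_index ?hs.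
Qed.

Lemma undup_enumP : Finite.axiom (undup s).
Proof. by move=> x; rewrite count_uniq_mem ?undup_uniq// mem_undup hs. Qed.
End FiniteOfSeq.

Section OnFinite.
Variables (k : localField) (n : nat).

Lemma On_finite : exists s : seq (On k n), forall a, a \in s.
Proof.
have [s hs] := On_cover k n.+1.
exists [seq redn n y | y <- s] => a.
have [y ys hy] := hs _ (ovalP (repr a)).
apply/mapP; exists y => //; rewrite /redn -[LHS]reprK.
apply/eqP; rewrite -Quotient.idealrBE inE /= oring_ofK//.
rewrite -[y]opprK -[- y](addKr (oval (repr a))) opprD opprK.
apply: ppowB; first exact: ovalP.
by apply: ppowW hy.
Qed.

Definition On_enum := proj1_sig (cid On_finite).
Definition On_enumP := proj2_sig (cid On_finite).

HB.instance Definition _ : isCountable (On k n) :=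
  PCanIsCountable (index_onthK On_enumP).
HB.instance Definition _ := isFinite.Build (On k n) (undup_enumP On_enumP).

Definition On_unit : {pred On k n} := [pred a | [exists b : On k n, b * a == 1]].
Definition On_inv (a : On k n) := odflt a [pick b | b * a == 1].

Lemma On_mulVr : {in On_unit, left_inverse 1 On_inv *%R}.
Proof.
by move=> a /existsP[b h]; rewrite /On_inv; case: pickP => [c /eqP//|/(_ b)]; rewrite h.
Qed.
Lemma On_unitP (a b : On k n) : b * a = 1 -> a \in On_unit.
Proof. by move=> /eqP h; apply/existsP; exists b. Qed.
Lemma On_inv_out : {in [predC On_unit], On_inv =1 id}.
Proof.
move=> a; rewrite !inE negb_exists => /forallP h; rewrite /On_inv.
by case: pickP => // c; rewrite (negPf (h c)).
Qed.
HB.instance Definition _ :=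
  GRing.ComNzRing_hasMulInverse.Build (On k n) On_mulVr On_unitP On_inv_out.

End OnFinite.

(* P / (P :&: Q) for subgroups P and Q of an abelian group. *)
Section Subquotient.
Variables (M : zmodType) (P Q : zmodClosed M).

Record sub_of := SubOf { sub_val : M; sub_valP : sub_val \in P }.
HB.instance Definition _ := [isSub for sub_val].
HB.instance Definition _ := [Choice of sub_of by <:].
HB.instance Definition _ := [SubChoice_isSubZmodule of sub_of by <:].

Definition sub_mem : {pred sub_of} := [pred x | sub_val x \in Q].
Lemma sub_mem_closed : zmod_closed sub_mem.
Proof. by split=> [|x y]; rewrite !inE ?rpred0//= => *; rewrite rpredB. Qed.
HB.instance Definition _ := GRing.isZmodClosed.Build sub_of sub_mem sub_mem_closed.

Definition subquot : Type := Quotient.quot (sub_mem : zmodClosed sub_of).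
HB.instance Definition _ := GRing.Zmodule.on subquot.

(* the class of x, for x in P (0 otherwise), and a representative of a class *)
Definition sq_pi (x : M) : subquot := \pi_(subquot) (insubd (0 : sub_of) x).
Definition sq_repr (c : subquot) : M := sub_val (repr c).

Lemma sq_reprP c : sq_repr c \in P. Proof. exact: sub_valP. Qed.

Lemma sq_reprK : cancel sq_repr sq_pi.
Proof.
by move=> c; rewrite /sq_pi /sq_repr -[RHS]reprK; congr \pi; exact: valKd.
Qed.

Lemma sq_eqE x y : x \in P -> y \in P -> (sq_pi x == sq_pi y) = (x - y \in Q).
Proof.
move=> xP yP; rewrite /sq_pi -Quotient.idealrBE inE.
by rewrite -[sub_val _]/(val _) raddfB /= !insubdK.
Qed.

Lemma sq_eqP x y : x \in P -> y \in P -> x - y \in Q -> sq_pi x = sq_pi y.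
Proof. by move=> xP yP h; apply/eqP; rewrite sq_eqE. Qed.

Lemma sq_repr_pi x : x \in P -> sq_repr (sq_pi x) - x \in Q.
Proof. by move=> xP; rewrite -sq_eqE ?sq_reprP// sq_reprK. Qed.

Lemma sq_piD x y : x \in P -> y \in P -> sq_pi (x + y) = sq_pi x + sq_pi y.
Proof.
move=> xP yP; rewrite /sq_pi -[RHS]raddfD; congr \pi.
by apply: val_inj; rewrite raddfD /= !insubdK ?rpredD.
Qed.

Lemma sq_pi0 : sq_pi 0 = 0.
Proof. by apply: (addrI (sq_pi 0)); rewrite -sq_piD ?rpred0// !addr0. Qed.

Lemma sq_reprD c d : sq_repr (c + d) - (sq_repr c + sq_repr d) \in Q.
Proof. by rewrite -sq_eqE ?rpredD ?sq_reprP// sq_reprK sq_piD ?sq_reprP// !sq_reprK. Qed.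

End Subquotient.

(* (V, β) with β alternating and F-bilinear.  Nondegeneracy of β is not needed
   to state the definitions below; it holds for the modules b_n and b*_n. *)
Record altMod (F : finComUnitRingType) := AltMod {
  am_mod :> finLmodType F;
  am_form : am_mod -> am_mod -> F;
  am_linl : forall y, scalar (fun x => am_form x y);
  am_linr : forall x, scalar (am_form x);
  am_alt : forall x, am_form x x = 0
}.

Section FormTheory.
Variables (F : finComUnitRingType) (V : altMod F).
Implicit Types x y z : V.
Local Notation b := (@am_form F V).

Lemma formDl x y z : b (x + y) z = b x z + b y z.
Proof. by have := am_linl z 1 x y; rewrite scale1r mul1r. Qed.
Lemma formDr x y z : b x (y + z) = b x y + b x z.
Proof. by have := am_linr x 1 y z; rewrite scale1r mul1r. Qed.
Lemma form0l x : b 0 x = 0.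
Proof. by apply: (addrI (b 0 x)); rewrite -formDl !addr0. Qed.
Lemma form0r x : b x 0 = 0.
Proof. by apply: (addrI (b x 0)); rewrite -formDr !addr0. Qed.
Lemma formZl a x y : b (a *: x) y = a * b x y.
Proof. by have := am_linl y a x 0; rewrite form0l !addr0. Qed.
Lemma formZr a x y : b x (a *: y) = a * b x y.
Proof. by have := am_linr x a y 0; rewrite form0r !addr0. Qed.
Lemma formNl x y : b (- x) y = - b x y.
Proof. by rewrite -scaleN1r formZl mulN1r. Qed.
Lemma formNr x y : b x (- y) = - b x y.
Proof. by rewrite -scaleN1r formZr mulN1r. Qed.
Lemma formC x y : b x y = - b y x.
Proof.
have := am_alt (x + y); rewrite formDl !formDr !am_alt addr0 add0r.
by move/eqP; rewrite addr_eq0 => /eqP.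
Qed.
End FormTheory.

Section Sp.
Variables (F : finComUnitRingType) (V : altMod F).

Definition is_sp (g : {perm V}) : bool :=
  [forall a, forall x, forall y, g (a *: x + y) == a *: g x + g y] &&
  [forall x, forall y, am_form (g x) (g y) == am_form x y].

Lemma is_spP (g : {perm V}) :
  reflect ((forall a x y, g (a *: x + y) = a *: g x + g y) /\
           (forall x y, am_form (g x) (g y) = am_form x y)) (is_sp g).
Proof.
apply: (iffP andP) => -[h1 h2]; split.
- by move=> a x y; move: h1 => /forallP/(_ a)/forallP/(_ x)/forallP/(_ y)/eqP.
- by move=> x y; move: h2 => /forallP/(_ x)/forallP/(_ y)/eqP.
- by apply/forallP => a; apply/forallP => x; apply/forallP => y; rewrite h1.
- by apply/forallP => x; apply/forallP => y; rewrite h2.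
Qed.

Record Sp := MkSp { sp_perm :> {perm V}; sp_permP : is_sp sp_perm }.
HB.instance Definition _ := [isSub for sp_perm].
HB.instance Definition _ := [Finite of Sp by <:].

Lemma sp_lin (g : Sp) a x y : g (a *: x + y) = a *: g x + g y.
Proof. by case: g => g /= /is_spP[]. Qed.
Lemma sp_form (g : Sp) x y : am_form (g x) (g y) = am_form x y.
Proof. by case: g => g /= /is_spP[]. Qed.

Lemma sp_one_subproof : is_sp 1%g.
Proof. by apply/is_spP; split=> *; rewrite !perm1. Qed.
Definition sp_one := MkSp sp_one_subproof.

(* The product of {perm V} is the reversed composition; Sp V is the group of
   maps under composition, (g * h) x = g (h x). *)
Lemma sp_mul_subproof (g h : Sp) : is_sp (sp_perm h * sp_perm g)%g.
Proof. by apply/is_spP; split=> *; rewrite !permM ?sp_form// !sp_lin. Qed.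
Definition sp_mul (g h : Sp) := MkSp (sp_mul_subproof g h).

Lemma sp_inv_subproof (g : Sp) : is_sp (sp_perm g)^-1%g.
Proof.
apply/is_spP; split=> [a x y|x y]; last by rewrite -(sp_form g) !permKV.
by apply: (@perm_inj _ (sp_perm g)); rewrite sp_lin !permKV.
Qed.
Definition sp_inv (g : Sp) := MkSp (sp_inv_subproof g).

Lemma sp_mulA : associative sp_mul.
Proof. by move=> f g h; apply: val_inj => /=; rewrite mulgA. Qed.
Lemma sp_mul1 : left_id sp_one sp_mul.
Proof. by move=> g; apply: val_inj => /=; rewrite mulg1. Qed.
Lemma sp_mulV : left_inverse sp_one sp_inv sp_mul.
Proof. by move=> g; apply: val_inj => /=; rewrite mulgV. Qed.
HB.instance Definition _ := Finite_isGroup.Build Sp sp_mulA sp_mul1 sp_mulV.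

Lemma sp_opp_subproof : is_sp (perm (@oppr_inj V)).
Proof.
apply/is_spP; split=> [a x y|x y]; rewrite !permE ?formNl ?formNr ?opprK//.
by rewrite opprD scalerN.
Qed.
(* - Id *)
Definition sp_opp := MkSp sp_opp_subproof.

End Sp.

Section Heisenberg.
Variables (F : finComUnitRingType) (V : altMod F).

Definition heis : Type := (V * F)%type.
HB.instance Definition _ := Finite.on heis.

Definition heis_mul (h h' : heis) : heis :=
  (h.1 + h'.1, h.2 + h'.2 + 2%:R^-1 * am_form h.1 h'.1).
Definition heis_one : heis := (0, 0).
Definition heis_inv (h : heis) : heis := (- h.1, - h.2).

Lemma heis_mulA : associative heis_mul.
Proof.
move=> [u r] [v s] [w t]; rewrite /heis_mul /=; congr pair; first exact: addrA.
by rewrite formDl formDr; ring.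
Qed.
Lemma heis_mul1 : left_id heis_one heis_mul.
Proof. by move=> [v t]; rewrite /heis_mul /= form0l mulr0 !add0r addr0. Qed.
Lemma heis_mulV : left_inverse heis_one heis_inv heis_mul.
Proof.
by move=> [v t]; rewrite /heis_mul /= formNl am_alt oppr0 mulr0 !addNr addr0.
Qed.
HB.instance Definition _ :=
  Finite_isGroup.Build heis heis_mulA heis_mul1 heis_mulV.

Definition sp_heis (g : Sp V) (h : heis) : heis := (g h.1, h.2).

End Heisenberg.

(* Sp(V)-invariant isotropic submodules U *)
Record invIso (F : finComUnitRingType) (V : altMod F) := InvIso {
  ii_set :> {set V};
  ii_submod : submod_closed ii_set;
  ii_isotropic : {in ii_set &, forall x y, am_form x y = 0};
  ii_inv : forall g : Sp V, {in ii_set, forall x, g x \in ii_set}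
}.

Section UBar.
Variables (F : finComUnitRingType) (V : altMod F) (U : invIso V).

Definition perp : {pred V} := [pred x | [forall y in ii_set U, am_form x y == 0]].
Definition ii_pred : {pred V} := [pred x | x \in ii_set U].

Lemma perpP x : reflect {in ii_set U, forall y, am_form x y = 0} (x \in perp).
Proof. by apply: (iffP forall_inP) => h y yU; apply/eqP; exact/h. Qed.

Lemma perp_submod : submod_closed perp.
Proof.
split=> [|a x y /perpP hx /perpP hy]; apply/perpP => z zU; first by rewrite form0l.
by rewrite formDl formZl hx// hy// mulr0 addr0.
Qed.
HB.instance Definition _ := GRing.isZmodClosed.Build V perp
  (GRing.submod_closedB perp_submod).
Lemma ii_pred_submod : submod_closed ii_pred.
Proof. exact: ii_submod. Qed.
HB.instance Definition _ := GRing.isZmodClosed.Build V ii_pred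
  (GRing.submod_closedB ii_pred_submod).

Lemma perpZ a x : x \in perp -> a *: x \in perp.
Proof.
by move=> h; rewrite -[_ *: _]addr0; apply: perp_submod.2 => //; exact: rpred0.
Qed.
Lemma ii_predZ a x : x \in ii_pred -> a *: x \in ii_pred.
Proof.
by move=> h; rewrite -[_ *: _]addr0; apply: ii_pred_submod.2 => //; exact: rpred0.
Qed.
Lemma sp_perp (g : Sp V) x : x \in perp -> g x \in perp.
Proof.
move=> /perpP h; apply/perpP => y yU.
by rewrite -(sp_form g^-1%g) permK h// ii_inv.
Qed.

(* U^⊥ / U *)
Definition ubar_sort : Type := subquot (perp : zmodClosed V) (ii_pred : zmodClosed V).
HB.instance Definition _ := GRing.Zmodule.on ubar_sort.

Definition ubar_pi (x : V) : ubar_sort := sq_pi _ _ x.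
Definition ubar_repr (c : ubar_sort) : V := sq_repr c.

Lemma ubar_enumP (c : ubar_sort) : c \in [seq ubar_pi x | x : V].
Proof.
by rewrite -[c]sq_reprK; apply/mapP; exists (sq_repr c) => //; rewrite mem_enum.
Qed.
HB.instance Definition _ : isCountable ubar_sort :=
  PCanIsCountable (index_onthK ubar_enumP).
HB.instance Definition _ := isFinite.Build ubar_sort (undup_enumP ubar_enumP).

Definition ubar_scale (a : F) (c : ubar_sort) : ubar_sort :=
  ubar_pi (a *: ubar_repr c).

Lemma ubar_scale_pi a x : x \in perp -> ubar_scale a (ubar_pi x) = ubar_pi (a *: x).
Proof.
move=> xP; apply: sq_eqP; rewrite ?perpZ ?sq_reprP//.
by rewrite -scalerBr; apply: ii_predZ; exact: sq_repr_pi.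
Qed.

Lemma ubar_ind (K : ubar_sort -> Prop) :
  (forall x, x \in perp -> K (ubar_pi x)) -> forall c, K c.
Proof. by move=> h c; rewrite -[c]sq_reprK; apply: h; exact: sq_reprP. Qed.

Lemma ubar_piD x y : x \in perp -> y \in perp ->
  ubar_pi (x + y) = ubar_pi x + ubar_pi y.
Proof. exact: sq_piD. Qed.

Lemma ubar_scaleA a b c : ubar_scale a (ubar_scale b c) = ubar_scale (a * b) c.
Proof.
by elim/ubar_ind: c => x xP; rewrite !ubar_scale_pi ?perpZ// scalerA.
Qed.
Lemma ubar_scale1 : left_id 1 ubar_scale.
Proof. by elim/ubar_ind => x xP; rewrite ubar_scale_pi ?scale1r. Qed.
Lemma ubar_scaleDr : right_distributive ubar_scale +%R.
Proof.
move=> a; elim/ubar_ind => x xP; elim/ubar_ind => y yP.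
by rewrite -ubar_piD// !ubar_scale_pi ?rpredD// scalerDr ubar_piD ?perpZ.
Qed.
Lemma ubar_scaleDl c : {morph ubar_scale^~ c : a b / a + b}.
Proof.
move=> a b; elim/ubar_ind: c => x xP.
by rewrite !ubar_scale_pi// scalerDl ubar_piD ?perpZ.
Qed.
HB.instance Definition _ := GRing.Zmodule_isLmodule.Build F ubar_sort
  ubar_scaleA ubar_scale1 ubar_scaleDr ubar_scaleDl.

Definition ubar_form (c d : ubar_sort) : F := am_form (ubar_repr c) (ubar_repr d).

Lemma ubar_form_pi x y : x \in perp -> y \in perp ->
  ubar_form (ubar_pi x) (ubar_pi y) = am_form x y.
Proof.
move=> xP yP; rewrite /ubar_form /ubar_repr /ubar_pi.
set x' := sq_repr _; set y' := sq_repr _.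
have hx : x' - x \in ii_set U by exact: sq_repr_pi.
have hy : y' - y \in ii_set U by exact: sq_repr_pi.
rewrite -[x'](subrK x) -[y'](subrK y) formDl [in X in X + _]formC.
have -> : y' - y + y = y' by rewrite subrK.
have /perpP -> // : y' \in perp by exact: sq_reprP.
by rewrite oppr0 add0r -[y'](subrK y) formDr; move/perpP: xP => ->//; rewrite add0r.
Qed.

Lemma ubar_linl d : scalar (fun c => ubar_form c d).
Proof.
move=> a; elim/ubar_ind => x xP; elim/ubar_ind => y yP.
elim/ubar_ind: d => z zP.
rewrite [a *: _]ubar_scale_pi// -ubar_piD ?perpZ// !ubar_form_pi ?rpredD ?perpZ//.
exact: am_linl.
Qed.
Lemma ubar_linr c : scalar (ubar_form c).
Proof.
move=> a; elim/ubar_ind => x xP; elim/ubar_ind => y yP.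
elim/ubar_ind: c => z zP.
rewrite [a *: _]ubar_scale_pi// -ubar_piD ?perpZ// !ubar_form_pi ?rpredD ?perpZ//.
exact: am_linr.
Qed.
Lemma ubar_alt c : ubar_form c c = 0. Proof. exact: am_alt. Qed.

Definition ubar : altMod F := @AltMod F ubar_sort ubar_form ubar_linl ubar_linr ubar_alt.

Definition rU_fun (g : Sp V) (c : ubar) : ubar := ubar_pi (g (ubar_repr c)).

Lemma rU_pi g x : x \in perp -> rU_fun g (ubar_pi x) = ubar_pi (g x).
Proof.
move=> xP; apply: sq_eqP; rewrite ?sp_perp ?sq_reprP//.
have := sp_lin g (-1) x (ubar_repr (ubar_pi x)).
rewrite !scaleN1r ![- _ + _]addrC => <-; apply: ii_inv; exact: sq_repr_pi.
Qed.

Lemma rU_inj g : injective (rU_fun g).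
Proof.
apply: (@can_inj _ _ _ (rU_fun g^-1%g)); elim/ubar_ind => x xP.
by rewrite !rU_pi ?sp_perp// permK.
Qed.

Lemma rU_subproof g : is_sp (perm (@rU_inj g) : {perm ubar}).
Proof.
apply/is_spP; split=> [a|]; elim/ubar_ind => x xP; elim/ubar_ind => y yP.
  rewrite !permE [a *: ubar_pi x]ubar_scale_pi// -ubar_piD ?perpZ//.
  rewrite !rU_pi ?rpredD ?perpZ// sp_lin ubar_piD ?perpZ ?sp_perp//.
  by congr (_ + _); rewrite [RHS]ubar_scale_pi ?sp_perp.
by rewrite !permE !rU_pi// /= !ubar_form_pi ?sp_perp// sp_form.
Qed.

(* the natural morphism Sp(V) -> Sp(U^⊥ / U) *)
Definition rU (g : Sp V) : Sp ubar := MkSp (rU_subproof g).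

End UBar.

Local Open Scope classical_set_scope.

Definition subspace (C : fieldType) (E : lmodType C) (A : set E) : Prop :=
  A 0 /\ forall (a : C) u v, A u -> A v -> A (a *: u + v).

(* Candidate representations: operators on an ambient finite-dimensional space,
   of which only the action on the subspace rp_space is meaningful. *)
Record repn (C : fieldType) (gT : Type) := Repn {
  rp_sort : vectType C;
  rp_space : set rp_sort;
  rp_op : gT -> rp_sort -> rp_sort
}.
Arguments rp_space {C gT} r _.
Arguments rp_op {C gT} r g _.

Section Representations.
Variables (C : numClosedFieldType) (gT : finGroupType).
Implicit Types r : repn C gT.

Definition is_repn r : Prop :=
  [/\ subspace (rp_space r),
      forall g v, rp_space r v -> rp_space r (rp_op r g v),
      forall g (a : C) u v, rp_space r u -> rp_space r v ->
        rp_op r g (a *: u + v) = a *: rp_op r g u + rp_op r g v,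
      forall v, rp_space r v -> rp_op r 1%g v = v
    & forall g h v, rp_space r v ->
        rp_op r (g * h)%g v = rp_op r g (rp_op r h v)].

Definition irreducible r : Prop :=
  [/\ is_repn r, rp_space r <> [set 0]
    & forall A : set (rp_sort r), subspace A -> A `<=` rp_space r ->
        (forall g v, A v -> A (rp_op r g v)) -> A = [set 0] \/ A = rp_space r].

Definition unitary r : Prop :=
  exists f : rp_sort r -> rp_sort r -> C,
  [/\ forall (a : C) u v w, rp_space r u -> rp_space r v -> rp_space r w ->
        f (a *: u + v) w = a * f u w + f v w,
      forall u v, rp_space r u -> rp_space r v -> f v u = Num.conj (f u v),
      forall u, rp_space r u -> u != 0 -> 0 < f u u
    & forall g u v, rp_space r u -> rp_space r v ->
        f (rp_op r g u) (rp_op r g v) = f u v].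

Definition repn_iso r1 r2 : Prop :=
  exists f : 'Hom(rp_sort r1, rp_sort r2),
  [/\ f @` rp_space r1 = rp_space r2,
      {in rp_space r1 &, injective f}
    & forall g v, rp_space r1 v -> f (rp_op r1 g v) = rp_op r2 g (f v)].

(* Ind_H^G t, realized on {f : G -> E | f (h g) = t(h) f(g) for h in H} with
   G acting by right translations *)
Definition induced (H : {set gT}) (t : repn C gT) : repn C gT :=
  @Repn C gT {ffun gT -> rp_sort t}
    [set f : {ffun gT -> rp_sort t} | (forall g, rp_space t (f g)) /\
             (forall h g, h \in H -> f (h * g)%g = rp_op t h (f g))]
    (fun g f => [ffun x => f (x * g)%g]).

Definition char_repn (chi : gT -> C) : repn C gT :=
  @Repn C gT C^o setT (fun g v => chi g * v).

Definition monomial r : Prop :=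
  exists (H : {group gT}) (chi : gT -> C),
  [/\ chi 1%g = 1,
      {in H &, forall g h, chi (g * h)%g = chi g * chi h}
    & repn_iso r (induced H (char_repn chi))].

End Representations.

Definition primitive_char (C : fieldType) (F : finComUnitRingType) (psi : F -> C)
    : Prop :=
  [/\ psi 0 = 1,
      forall s t, psi (s + t) = psi s * psi t
    & forall I : {set F},
        0 \in I -> {in I &, forall s t, s + t \in I} ->
        (forall a, {in I, forall s, a * s \in I}) ->
        {in I, forall s, psi s = 1} -> I = [set 0]%SET].

(* A space carrying operators indexed by H(V) and by G *)
Record weilRep (C : fieldType) (F : finComUnitRingType) (V : altMod F)
    (gT : Type) := WeilRep {
  wr_sort : vectType C;
  wr_space : set wr_sort;
  wr_heis : heis V -> wr_sort -> wr_sort;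
  wr_grp : gT -> wr_sort -> wr_sort
}.
Arguments wr_space {C F V gT} w _.
Arguments wr_heis {C F V gT} w h _.
Arguments wr_grp {C F V gT} w g _.

Section Weil.
Variables (C : numClosedFieldType) (F : finComUnitRingType) (psi : F -> C).

Section Relative.
Variables (V : altMod F) (gT : finGroupType).
Implicit Types S : weilRep C V gT.

Definition heis_repn S : repn C (heis V) := Repn (wr_space S) (wr_heis S).
Definition grp_repn S : repn C gT := Repn (wr_space S) (wr_grp S).

(* S is a Weil representation of type psi of G relative to gamma *)
Definition is_weil (gamma : gT -> Sp V) S : Prop :=
  [/\ irreducible (heis_repn S) /\ unitary (heis_repn S),
      forall t v, wr_space S v -> wr_heis S (0, t) v = psi t *: v,
      is_repn (grp_repn S)
    & forall g h v, wr_space S v ->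
        wr_grp S g (wr_heis S h (wr_grp S g^-1%g v)) =
        wr_heis S (sp_heis (gamma g) h) v].

(* equality of Weil representations *)
Definition weil_iso S1 S2 : Prop :=
  exists f : 'Hom(wr_sort S1, wr_sort S2),
  [/\ f @` wr_space S1 = wr_space S2,
      {in wr_space S1 &, injective f},
      forall h v, wr_space S1 v -> f (wr_heis S1 h v) = wr_heis S2 h (f v)
    & forall g v, wr_space S1 v -> f (wr_grp S1 g v) = wr_grp S2 g (f v)].

End Relative.

Section Model.
Variables (V : altMod F) (U : invIso V) (sigma : weilRep C (ubar U) (Sp V)).

(* rho_{U^⊥,psi}(w, t), for w in U^⊥ *)
Definition rho_perp (w : V) (t : F) : wr_sort sigma -> wr_sort sigma :=
  wr_heis sigma (ubar_pi U w, t).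

(* S^{U,sigma} *)
Definition weil_model : weilRep C V (Sp V) :=
  @WeilRep C F V (Sp V) {ffun V -> wr_sort sigma}
    [set phi : {ffun V -> wr_sort sigma} | (forall x, wr_space sigma (phi x)) /\
       (forall x w, w \in perp U ->
          phi (x + w) = psi (2%:R^-1 * am_form x w) *: rho_perp w 0 (phi x))]
    (fun h phi => [ffun x => psi (h.2 + 2%:R^-1 * am_form x h.1) *: phi (x + h.1)])
    (fun g phi => [ffun x => wr_grp sigma g (phi (g^-1%g x))]).

(* G(x^) *)
Definition stab (x : V) : {set Sp V} := [set g : Sp V | g x - x \in perp U]%SET.

(* {± Id} G(x^) *)
Definition pm_stab (x : V) : {set Sp V} :=
  [set g : Sp V | (g \in stab x) || ((sp_opp V * g)%g \in stab x)]%SET.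

Definition sigma_dot (x : V) (g : Sp V) (v : wr_sort sigma) : wr_sort sigma :=
  wr_grp sigma g (rho_perp (g^-1%g x - x) (2%:R^-1 * am_form x (g^-1%g x)) v).

(* In what follows e = false stands for the sign + and e = true for the sign -. *)
Definition sigma_dot_sgn (e : bool) (x : V) (g : Sp V) (v : wr_sort sigma) :=
  if g \in stab x then sigma_dot x g v
  else (-1) ^+ e *: sigma_dot x (sp_opp V * g)%g v.

Definition S_dot (e : bool) (x : V) : repn C (Sp V) :=
  induced (pm_stab x) (Repn (wr_space sigma) (sigma_dot_sgn e x)).

Definition sigma_sgn (e : bool) : repn C (Sp V) :=
  Repn [set v | wr_space sigma v /\ wr_grp sigma (sp_opp V) v = (-1) ^+ e *: v]
       (wr_grp sigma).

(* representatives of the Sp(V)-orbits in (V / U^⊥) \ {0} *)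
Definition orbit_reps (X : {set V}) : Prop :=
  [/\ {in X, forall x, x \notin perp U},
      forall y, y \notin perp U ->
        exists2 x, x \in X & exists g : Sp V, g x - y \in perp U
    & {in X &, forall x x', (exists g : Sp V, g x - x' \in perp U) -> x = x'}].

Definition ubar_trivial : bool := [forall c : ubar U, c == 0].

(* The representations appearing in the decomposition of S^{U,sigma} are the
   summand i for i in summand_index X: inl false stands for sigma itself if
   U^⊥/U = 0, the inl e stand for sigma^± otherwise, and inr (x, e) stands
   for S^±_{x.}. *)
Definition summand_index (X : {set V}) : {set bool + V * bool} :=
  [set i : bool + V * bool | match i with
           | inl e => ~~ (e && ubar_trivial)
           | inr (x, _) => x \in X
           end]%SET.

Definition summand (i : bool + V * bool) : repn C (Sp V) :=
  match i with
  | inl e => if ubar_trivial then grp_repn sigma else sigma_sgn e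
  | inr (x, e) => S_dot e x
  end.

End Model.
End Weil.

Section VectorTopology.
Variables (k : localField) (W : vectType k).

(* W with the product topology of k^(dim W), for the coordinates in vbasis *)
Definition vtop : Type := W.
HB.instance Definition _ := Choice.on vtop.

Definition vball (i : int) : set vtop :=
  [set w | forall j, coord (vbasis {:W}%VS) j (w : W) \in ppow k i].
Definition vopen : set_system vtop :=
  [set A | forall w, A w ->
     exists i, forall w' : vtop, vball i ((w' : W) - (w : W)) -> A w'].

Lemma vopenT : vopen setT. Proof. by move=> w _; exists 0. Qed.
Lemma vopenI : setI_closed vopen.
Proof.
move=> A B oA oB w [/oA[i hi] /oB[j hj]].
exists (Num.max i j) => w' hw'; split; [apply: hi|apply: hj] => l;
  by apply: ppowW (hw' l); rewrite le_max lexx ?orbT.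
Qed.
Lemma vopenU (I : Type) (f : I -> set vtop) :
  (forall i, vopen (f i)) -> vopen (\bigcup_i f i).
Proof.
move=> of_ w [i _ /of_[j hj]]; exists j => w' /hj fw'; by exists i.
Qed.
HB.instance Definition _ := isOpenTopological.Build vtop vopenT vopenI vopenU.
HB.instance Definition _ := isPointed.Build vtop (0 : W).
Lemma vopenE : (open : set_system vtop) = vopen. Proof. by []. Qed.
End VectorTopology.

Record sympSpace (k : localField) := SympSpace {
  ss_vect :> vectType k;
  ss_form : ss_vect -> ss_vect -> k;
  ss_linl : forall y, scalar (fun x => ss_form x y);
  ss_linr : forall x, scalar (ss_form x);
  ss_alt : forall x, ss_form x x = 0;
  ss_nondegenerate : forall x, (forall y, ss_form x y = 0) -> x = 0
}.

(* O-submodules of W *)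
Record osub (k : localField) (W : vectType k) := OSub {
  os_pred :> {pred W};
  os_0 : 0 \in os_pred;
  os_D : {in os_pred &, forall x y, x + y \in os_pred};
  os_Z : forall a : k, a \in ppow k 0 -> {in os_pred, forall x, a *: x \in os_pred}
}.

Definition osub_proper (k : localField) (W : vectType k) (P Q : osub W) : Prop :=
  {subset P <= Q} /\ ~ {subset Q <= P}.

Record lattice (k : localField) (W : vectType k) := Lattice {
  lat_osub :> osub W;
  lat_compact : compact ([set` os_pred lat_osub] : set (vtop W));
  lat_open : open ([set` os_pred lat_osub] : set (vtop W))
}.

Section OSub.
Variables (k : localField) (W : vectType k).
Implicit Types P Q L : osub W.
Local Notation pi := (lf_unif k).

Lemma osub_zmod P : zmod_closed (os_pred P).
Proof.
split=> [|x y xP yP]; first exact: os_0.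
by apply: os_D => //; rewrite -scaleN1r; apply: os_Z => //; exact: ppowN1.
Qed.
HB.instance Definition _ P := GRing.isZmodClosed.Build W (os_pred P) (osub_zmod P).

Definition oscale_pred (i : int) P : {pred W} := [pred x | pi ^ (- i) *: x \in P].
Lemma oscale_0 i P : 0 \in oscale_pred i P.
Proof. by rewrite inE scaler0 os_0. Qed.
Lemma oscale_D i P : {in oscale_pred i P &, forall x y, x + y \in oscale_pred i P}.
Proof. by move=> x y; rewrite !inE scalerDr; exact: os_D. Qed.
Lemma oscale_Z i P (a : k) : a \in ppow k 0 ->
  {in oscale_pred i P, forall x, a *: x \in oscale_pred i P}.
Proof.
by move=> ha x; rewrite !inE scalerA mulrC -scalerA; exact: os_Z.
Qed.
(* ϖ^i P *)
Definition oscale i P : osub W := OSub (oscale_0 i P) (@oscale_D i P) (@oscale_Z i P).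

Lemma in_oscale i P x : (x \in oscale i P) = (pi ^ (- i) *: x \in P).
Proof. by []. Qed.

Lemma unifXD i j (x : W) : pi ^ i *: (pi ^ j *: x) = pi ^ (i + j) *: x.
Proof. by rewrite scalerA expfzDr ?lf_unif_neq0. Qed.

Lemma unifXK i (x : W) : pi ^ i *: (pi ^ (- i) *: x) = x.
Proof. by rewrite unifXD subrr expr0z scale1r. Qed.

Lemma in_oscale_shift i j P x :
  (pi ^ j *: x \in oscale i P) = (x \in oscale (i - j) P).
Proof. by rewrite !in_oscale unifXD opprB addrC. Qed.

Lemma osub_unif i P x : 0 <= i -> x \in P -> pi ^ i *: x \in P.
Proof. by move=> i0; apply: os_Z; apply: ppowW i0 (ppow_unif _ _). Qed.

Lemma oscale_sub i j P : j <= i -> {subset oscale i P <= oscale j P}.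
Proof.
move=> ji x; rewrite !in_oscale => /(osub_unif (i := i - j)).
by rewrite subr_ge0 ji unifXD addrAC subrr add0r; exact.
Qed.

Lemma lattice_cover (L : lattice W) (N : int) :
  exists s : seq W, forall x, x \in L -> exists2 y, y \in s & x - y \in oscale N L.
Proof.
have := @lat_compact _ _ L; rewrite compact_cover => /(_ W setT
  (fun y => [set x : vtop W | (x : W) - y \in oscale N L])).
case=> [y _|x _|s _ hs].
- rewrite vopenE => w /= hw; have [i hi] := (@lat_open _ _ L : vopen _) _ (os_0 L).
  exists (i + N) => w' hw' /=.
  have -> : (w' : W) - y = ((w' : W) - (w : W)) + ((w : W) - y) by rewrite addrA subrK.
  apply: oscale_D; last exact: hw.
  rewrite inE; apply: hi => j; rewrite subr0 linearZ /= ppow_shift opprK.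
  exact: hw'.
- by exists x => //=; rewrite subrr; exact: oscale_0.
- by exists (enum_fset s) => x /hs[y ys hy]; exists y.
Qed.

End OSub.

Section RednTheory.
Variables (k : localField) (n : nat).
Implicit Types (a b : On k n) (x y : k).

Lemma ppowM0 x y : x \in ppow k 0 -> y \in ppow k 0 -> x * y \in ppow k 0.
Proof. by move=> hx hy; have := ppowM hx hy; rewrite addr0. Qed.

Lemma redn_repr a : redn n (oval (repr a)) = a.
Proof. by rewrite /redn -[RHS]reprK; congr \pi; exact: valKd. Qed.

Lemma redn_eqE x y : x \in ppow k 0 -> y \in ppow k 0 ->
  (redn n x == redn n y) = (x - y \in ppow k n.+1).
Proof.
by move=> hx hy; rewrite /redn -Quotient.idealrBE inE /= !oring_ofK.
Qed.

Lemma rednD x y : x \in ppow k 0 -> y \in ppow k 0 ->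
  redn n (x + y) = redn n x + redn n y.
Proof.
move=> hx hy; rewrite /redn -[RHS]raddfD; congr \pi; apply: val_inj => /=.
by rewrite !oring_ofK //; exact: ppowD.
Qed.

Lemma rednM x y : x \in ppow k 0 -> y \in ppow k 0 ->
  redn n (x * y) = redn n x * redn n y.
Proof.
move=> hx hy; rewrite /redn -[RHS]rmorphM; congr \pi; apply: val_inj => /=.
by rewrite !oring_ofK//; have := ppowM hx hy; rewrite addr0.
Qed.

Lemma redn1 : redn n 1 = 1 :> On k n.
Proof.
rewrite /redn -[RHS](rmorph1 \pi_(On k n)); congr \pi; apply: val_inj => /=.
by rewrite oring_ofK//; exact: ppow1.
Qed.

Lemma redn0 : redn n 0 = 0 :> On k n.
Proof. by apply: (addrI (redn n 0)); rewrite -rednD ?ppow0// !addr0. Qed.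

Lemma redn_eq0 x : x \in ppow k n.+1 -> redn n x = 0.
Proof.
move=> hx; apply/eqP; rewrite -redn0 redn_eqE ?ppow0 ?subr0//.
exact: ppowW hx.
Qed.

Lemma On_ind (K : On k n -> Prop) :
  (forall x, x \in ppow k 0 -> K (redn n x)) -> forall a, K a.
Proof. by move=> h a; rewrite -[a]redn_repr; apply: h; exact: ovalP. Qed.

End RednTheory.

Section WFormTheory.
Variables (k : localField) (W : sympSpace k).
Implicit Types x y z : W.
Local Notation b := (@ss_form k W).

Lemma wformDl x y z : b (x + y) z = b x z + b y z.
Proof. by have := ss_linl z 1 x y; rewrite scale1r mul1r. Qed.
Lemma wformDr x y z : b x (y + z) = b x y + b x z.
Proof. by have := ss_linr x 1 y z; rewrite scale1r mul1r. Qed.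
Lemma wform0l x : b 0 x = 0.
Proof. by apply: (addrI (b 0 x)); rewrite -wformDl !addr0. Qed.
Lemma wform0r x : b x 0 = 0.
Proof. by apply: (addrI (b x 0)); rewrite -wformDr !addr0. Qed.
Lemma wformZl a x y : b (a *: x) y = a * b x y.
Proof. by have := ss_linl y a x 0; rewrite wform0l !addr0. Qed.
Lemma wformZr a x y : b x (a *: y) = a * b x y.
Proof. by have := ss_linr x a y 0; rewrite wform0r !addr0. Qed.
Lemma wformC x y : b x y = - b y x.
Proof.
have := ss_alt (x + y); rewrite wformDl !wformDr !ss_alt addr0 add0r.
by move/eqP; rewrite addr_eq0 => /eqP.
Qed.
End WFormTheory.

(* O-submodules Q <= P of W for which P / Q is a finite O_n-module on which
   c β induces an O_n-valued form *)
Record sqData (k : localField) (W : sympSpace k) (n : nat) := SqData {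
  sqd_P : osub W;
  sqd_Q : osub W;
  sqd_c : k;
  sqd_sub : {subset sqd_Q <= sqd_P};
  sqd_fin : exists s : seq W,
    forall x, x \in sqd_P -> exists2 y, y \in s & x - y \in sqd_Q;
  sqd_ann : forall x, x \in sqd_P -> lf_unif k ^ n.+1 *: x \in sqd_Q;
  sqd_int : {in sqd_P &, forall x y, sqd_c * ss_form x y \in ppow k 0};
  sqd_rad : forall x y, x \in sqd_P -> y \in sqd_Q ->
    sqd_c * ss_form x y \in ppow k n.+1
}.

Section SqModule.
Variables (k : localField) (W : sympSpace k) (n : nat) (d : sqData W n).
Local Notation P := (sqd_P d).
Local Notation Q := (sqd_Q d).

(* P / Q *)
Definition sqm_sort : Type :=
  subquot (os_pred P : zmodClosed W) (os_pred Q : zmodClosed W).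
HB.instance Definition _ := GRing.Zmodule.on sqm_sort.

Definition sqm_pi (x : W) : sqm_sort := sq_pi _ _ x.
Definition sqm_repr (c : sqm_sort) : W := sq_repr c.

Lemma sqm_finite : exists s : seq sqm_sort, forall c, c \in s.
Proof.
have [s hs] := sqd_fin d; exists [seq sqm_pi y | y <- s] => c.
have [y ys hy] := hs _ (sq_reprP c); apply/mapP; exists y => //.
rewrite -[LHS]sq_reprK; apply: sq_eqP => //; first exact: sq_reprP.
rewrite -[y]opprK -[- y](addKr (sq_repr c)) opprD opprK.
by rewrite rpredB ?sq_reprP//; exact: sqd_sub hy.
Qed.
Definition sqm_enum := proj1_sig (cid sqm_finite).
Definition sqm_enumP := proj2_sig (cid sqm_finite).
HB.instance Definition _ : isCountable sqm_sort :=
  PCanIsCountable (index_onthK sqm_enumP).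
HB.instance Definition _ := isFinite.Build sqm_sort (undup_enumP sqm_enumP).

Lemma sqm_ind (K : sqm_sort -> Prop) :
  (forall x, x \in P -> K (sqm_pi x)) -> forall c, K c.
Proof. by move=> h c; rewrite -[c]sq_reprK; apply: h; exact: sq_reprP. Qed.

Lemma sqm_piD x y : x \in P -> y \in P -> sqm_pi (x + y) = sqm_pi x + sqm_pi y.
Proof. exact: sq_piD. Qed.

Definition sqm_scale (a : On k n) (c : sqm_sort) : sqm_sort :=
  sqm_pi (oval (repr a) *: sqm_repr c).

Lemma sqd_annZ a x : a \in ppow k n.+1 -> x \in P -> a *: x \in Q.
Proof.
move=> ha xP; have -> : a = (lf_unif k ^ (- n.+1%:Z) * a) * lf_unif k ^ n.+1%:Z.
  by rewrite mulrAC -expfzDr ?lf_unif_neq0// addNr expr0z mul1r.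
by rewrite -scalerA os_Z ?sqd_ann// ppow_shift sub0r opprK.
Qed.

Lemma sqm_scale_pi a x : a \in ppow k 0 -> x \in P ->
  sqm_scale (redn n a) (sqm_pi x) = sqm_pi (a *: x).
Proof.
move=> ha xP; apply: sq_eqP; rewrite ?os_Z ?sq_reprP//; first exact: ovalP.
set a' := oval _; set x' := sqm_repr _.
have ha' : a' \in ppow k 0 by exact: ovalP.
have -> : a' *: x' - a *: x = a' *: (x' - x) + (a' - a) *: x.
  by rewrite scalerBr scalerBl addrA subrK.
apply: rpredD; first by apply: os_Z => //; exact: sq_repr_pi.
by apply: sqd_annZ => //; rewrite -redn_eqE// redn_repr.
Qed.

Lemma sqm_scaleA a b c : sqm_scale a (sqm_scale b c) = sqm_scale (a * b) c.
Proof.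
elim/On_ind: a => a ha; elim/On_ind: b => b hb; elim/sqm_ind: c => x xP.
have hab : a * b \in ppow k 0 by have := ppowM ha hb; rewrite addr0.
by rewrite -rednM// !sqm_scale_pi ?os_Z// scalerA.
Qed.
Lemma sqm_scale1 : left_id 1 sqm_scale.
Proof.
elim/sqm_ind => x xP.
by rewrite -(redn1 k n) sqm_scale_pi ?scale1r//; exact: ppow1.
Qed.
Lemma sqm_scaleDr : right_distributive sqm_scale +%R.
Proof.
elim/On_ind => a ha; elim/sqm_ind => x xP; elim/sqm_ind => y yP.
by rewrite -sqm_piD// !sqm_scale_pi ?os_D// scalerDr sqm_piD ?os_Z.
Qed.
Lemma sqm_scaleDl c : {morph sqm_scale^~ c : a b / a + b}.
Proof.
elim/On_ind => a ha; elim/On_ind => b hb; elim/sqm_ind: c => x xP.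
by rewrite -rednD// !sqm_scale_pi ?ppowD// scalerDl sqm_piD ?os_Z.
Qed.
HB.instance Definition _ := GRing.Zmodule_isLmodule.Build (On k n) sqm_sort
  sqm_scaleA sqm_scale1 sqm_scaleDr sqm_scaleDl.

Definition sqm_form (x y : sqm_sort) : On k n :=
  redn n (sqd_c d * ss_form (sqm_repr x) (sqm_repr y)).

Lemma sqm_form_pi x y : x \in P -> y \in P ->
  sqm_form (sqm_pi x) (sqm_pi y) = redn n (sqd_c d * ss_form x y).
Proof.
move=> xP yP; apply/eqP; rewrite redn_eqE; try by apply: sqd_int => //; exact: sq_reprP.
set x' := sqm_repr _; set y' := sqm_repr _.
have hx : x' - x \in Q by exact: sq_repr_pi.
have hy : y' - y \in Q by exact: sq_repr_pi.
have y'P : y' \in P by exact: sq_reprP.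
have -> : sqd_c d * ss_form x' y' - sqd_c d * ss_form x y
   = - (sqd_c d * ss_form y' (x' - x)) + sqd_c d * ss_form x (y' - y).
  by rewrite [ss_form y' _]wformC -[- y]scaleN1r -[- x]scaleN1r !wformDl !wformDr !wformZl wformZr; ring.
by apply: ppowD; rewrite ?ppowN// sqd_rad.
Qed.

Lemma sqm_linl y : scalar (fun x => sqm_form x y).
Proof.
elim/On_ind => a ha; elim/sqm_ind => u uP; elim/sqm_ind => v vP.
elim/sqm_ind: y => w wP.
rewrite [_ *: _]sqm_scale_pi// -sqm_piD ?os_Z// !sqm_form_pi ?os_D ?os_Z//.
have huw := @sqd_int _ _ _ d u w uP wP; have hvw := @sqd_int _ _ _ d v w vP wP.
by rewrite wformDl wformZl mulrDr mulrCA (rednD n (ppowM0 ha huw) hvw) (rednM n ha huw).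
Qed.
Lemma sqm_alt x : sqm_form x x = 0.
Proof. by rewrite /sqm_form ss_alt mulr0 redn0. Qed.
Lemma sqm_formC x y : sqm_form x y = - sqm_form y x.
Proof.
elim/sqm_ind: x => x xP; elim/sqm_ind: y => y yP; rewrite !sqm_form_pi//.
apply/eqP; rewrite -addr_eq0 -rednD; try exact: sqd_int.
by rewrite -mulrDr wformC addNr mulr0 redn0.
Qed.
Lemma sqm_linr x : scalar (sqm_form x).
Proof.
by move=> a u v; rewrite sqm_formC sqm_linl opprD -mulrN -!sqm_formC.
Qed.

Definition sqm : altMod (On k n) :=
  @AltMod (On k n) sqm_sort sqm_form sqm_linl sqm_linr sqm_alt.

End SqModule.

Lemma sp_0 (F : finComUnitRingType) (V : altMod F) (g : Sp V) : g 0 = 0.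
Proof. by have := sp_lin g (-1) 0 0; rewrite !scaleN1r oppr0 addr0 addNr. Qed.
Lemma sp_scale (F : finComUnitRingType) (V : altMod F) (g : Sp V) a x :
  g (a *: x) = a *: g x.
Proof. by have := sp_lin g a x 0; rewrite sp_0 !addr0. Qed.

Section Image.
Variables (k : localField) (W : sympSpace k) (n : nat) (d : sqData W n).
Local Notation P := (sqd_P d).
Local Notation Q := (sqd_Q d).
Variables (T : osub W) (TP : {subset T <= P}).

(* the image of T in P / Q *)
Definition sqm_img : {set sqm d} :=
  [set c : sqm d | `[< exists2 x, x \in T & c = sqm_pi d x >]]%SET.

Lemma sqm_imgP (c : sqm d) :
  reflect (exists2 x, x \in T & c = sqm_pi d x) (c \in sqm_img).
Proof. by rewrite inE; exact: asboolP. Qed.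

Lemma sqm_img_submod : submod_closed sqm_img.
Proof.
split=> [|a _ _ /sqm_imgP[x xT ->] /sqm_imgP[y yT ->]]; apply/sqm_imgP.
  by exists 0; rewrite ?os_0// [RHS]sq_pi0.
elim/On_ind: a => a ha; exists (a *: x + y); first by rewrite os_D ?os_Z.
by rewrite sqm_piD ?os_Z ?TP// [X in X + _]sqm_scale_pi ?TP.
Qed.

Lemma sqm_img_isotropic :
  {in T &, forall x y, sqd_c d * ss_form x y \in ppow k n.+1} ->
  {in sqm_img &, forall x y, am_form x y = 0}.
Proof.
move=> h _ _ /sqm_imgP[x xT ->] /sqm_imgP[y yT ->].
by rewrite [LHS]sqm_form_pi ?TP// redn_eq0// h.
Qed.

Lemma sqm_pi_unif (j : nat) x : x \in P ->
  sqm_pi d (lf_unif k ^ j%:Z *: x) = redn n (lf_unif k ^ j%:Z) *: (sqm_pi d x : sqm d).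
Proof.
by move=> xP; rewrite [RHS]sqm_scale_pi//; apply: ppowW (ppow_unif _ _).
Qed.

Lemma sqm_img_inv_im (j : nat) : T =i oscale j%:Z P ->
  forall g : Sp (sqm d), {in sqm_img, forall x, g x \in sqm_img}.
Proof.
move=> hT g _ /sqm_imgP[x xT ->]; apply/sqm_imgP.
have xP : lf_unif k ^ (- j%:Z) *: x \in P by rewrite -in_oscale -hT.
rewrite -[x](unifXK j%:Z) sqm_pi_unif// sp_scale.
elim/sqm_ind: (g _) => y yP; exists (lf_unif k ^ j%:Z *: y).
  by rewrite hT in_oscale unifXD addNr expr0z scale1r.
by rewrite sqm_pi_unif.
Qed.

Lemma sqm_img_inv_ker (j : nat) :
  (forall x, x \in P -> (x \in T) = (lf_unif k ^ j%:Z *: x \in Q)) ->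
  forall g : Sp (sqm d), {in sqm_img, forall x, g x \in sqm_img}.
Proof.
move=> hT g c cT; apply/sqm_imgP.
have h0 x : x \in P ->
    (x \in T) = (redn n (lf_unif k ^ j%:Z) *: (sqm_pi d x : sqm d) == 0).
  move=> xP; rewrite hT// -sqm_pi_unif// -(sq_pi0 (os_pred P) (os_pred Q)).
  by rewrite sq_eqE ?rpred0 ?subr0// osub_unif.
have : redn n (lf_unif k ^ j%:Z) *: g c == 0.
  move/sqm_imgP: cT => [x xT ->]; rewrite -sp_scale.
  by have := xT; rewrite h0 ?TP// => /eqP ->; rewrite sp_0.
elim/sqm_ind: (g c) => y yP h; exists y => //.
by rewrite h0.
Qed.

End Image.

Section Dual.
Variables (k : localField) (W : sympSpace k) (lam : int).

Definition dual_pred (P : osub W) : {pred W} :=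
  [pred x | `[< forall b, b \in P -> ss_form x b \in ppow k lam >]].

Lemma dualP (P : osub W) x :
  reflect (forall b, b \in P -> ss_form x b \in ppow k lam) (x \in dual_pred P).
Proof. exact: asboolP. Qed.

Lemma dual_0 P : 0 \in dual_pred P.
Proof. by apply/dualP => b _; rewrite wform0l ppow0. Qed.
Lemma dual_D P : {in dual_pred P &, forall x y, x + y \in dual_pred P}.
Proof.
move=> x y /dualP hx /dualP hy; apply/dualP => b bP.
by rewrite wformDl ppowD ?hx ?hy.
Qed.
Lemma dual_Z P (a : k) : a \in ppow k 0 ->
  {in dual_pred P, forall x, a *: x \in dual_pred P}.
Proof.
move=> ha x /dualP hx; apply/dualP => b bP; rewrite wformZl -[lam]add0r.
by apply: ppowM => //; exact: hx.
Qed.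
(* P^* *)
Definition dual (P : osub W) : osub W :=
  OSub (dual_0 P) (@dual_D P) (@dual_Z P).

Record goodLattice := GoodLattice {
  gl_lattice :> lattice W;
  gl_sub1 : {subset oscale 1 (dual gl_lattice) <= gl_lattice};
  gl_sub2 : {subset gl_lattice <= dual gl_lattice}
}.

Variables (B : goodLattice) (n : nat).
Local Notation pi := (lf_unif k).
Local Notation Bd := (dual B).

Lemma gl_scale1 i x : x \in oscale (i + 1) Bd -> x \in oscale i B.
Proof.
by rewrite !in_oscale => h; apply: gl_sub1; rewrite in_oscale unifXD -opprD addrC.
Qed.
Lemma gl_scale2 i x : x \in oscale i B -> x \in oscale i Bd.
Proof. by rewrite !in_oscale; exact: gl_sub2. Qed.

Lemma oscale0 (P : osub W) x : (x \in oscale 0 P) = (x \in P).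
Proof. by rewrite in_oscale oppr0 expr0z scale1r. Qed.

(* the values of β on ϖ^i B* x ϖ^j B, ϖ^i B* x ϖ^j B* *)
Lemma form_dB i j x y : x \in oscale i Bd -> y \in oscale j B ->
  ss_form x y \in ppow k (lam + i + j).
Proof.
rewrite !in_oscale => /dualP/[apply]; rewrite wformZl wformZr !ppow_shift !opprK.
by rewrite addrAC addrC addrA [X in ppow _ X]addrC addrA.
Qed.
Lemma form_dd i j x y : x \in oscale i Bd -> y \in oscale j Bd ->
  ss_form x y \in ppow k (lam + i + j - 1).
Proof.
move=> hx hy; have : y \in oscale (j - 1) B by apply: gl_scale1; rewrite subrK.
by move/(form_dB hx); rewrite addrA.
Qed.
Lemma form_BB i j x y : x \in oscale i B -> y \in oscale j B ->
  ss_form x y \in ppow k (lam + i + j).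
Proof. by move=> /gl_scale2; exact: form_dB. Qed.

Lemma bn_sub : {subset oscale n.+1 Bd <= B}.
Proof.
move=> x hx; rewrite -oscale0; apply: gl_scale1.
by apply: oscale_sub hx; rewrite add0r.
Qed.
Lemma bn_fin : exists s : seq W, forall x, x \in B ->
  exists2 y, y \in s & x - y \in oscale n.+1 Bd.
Proof.
have [s hs] := lattice_cover B n.+1; exists s => x /hs[y ys hy].
by exists y => //; exact: gl_scale2.
Qed.
Lemma bn_ann x : x \in B -> pi ^ n.+1 *: x \in oscale n.+1 Bd.
Proof. by move=> xB; rewrite in_oscale_shift subrr oscale0; exact: gl_sub2. Qed.
Lemma bn_int : {in B &, forall x y, pi ^ (- lam) * ss_form x y \in ppow k 0}.
Proof.
move=> x y xB yB; rewrite ppow_shift sub0r opprK.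
by move/dualP: (gl_sub2 xB) => /(_ _ yB).
Qed.
Lemma bn_rad x y : x \in B -> y \in oscale n.+1 Bd ->
  pi ^ (- lam) * ss_form x y \in ppow k n.+1.
Proof.
rewrite -oscale0 => xB yQ; rewrite ppow_shift opprK wformC ppowN//.
by have := form_dB yQ xB; rewrite addr0 addrC.
Qed.

(* b_n = B / ϖ^(n+1) B*, with the form ϖ^(-λ) β mod ϖ^(n+1) *)
Definition bn_data : sqData W n := SqData bn_sub bn_fin bn_ann bn_int bn_rad.
Definition bn : altMod (On k n) := sqm bn_data.

Lemma bs_sub : {subset oscale n B <= Bd}.
Proof.
by move=> x hx; apply: gl_sub2; rewrite -oscale0; apply: oscale_sub hx.
Qed.
Lemma bs_fin : exists s : seq W, forall x, x \in Bd ->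
  exists2 y, y \in s & x - y \in oscale n B.
Proof.
have [s hs] := lattice_cover B n.+1.
exists [seq pi ^ (-1) *: y | y <- s] => x xB.
have [|y ys hy] := hs (pi ^ 1 *: x).
  by apply: gl_sub1; rewrite in_oscale unifXD addNr expr0z scale1r.
exists (pi ^ (-1) *: y); first by apply/mapP; exists y.
rewrite -[x](scale1r) -(expr0z pi) -(addNr 1) -unifXD -scalerBr.
by rewrite in_oscale_shift opprK -PoszD addn1.
Qed.
Lemma bs_ann x : x \in Bd -> pi ^ n.+1 *: x \in oscale n B.
Proof.
move=> xB; rewrite in_oscale_shift; apply: gl_scale1.
by rewrite intS opprD addrCA subrr addr0 addNr oscale0.
Qed.
Lemma bs_int : {in Bd &, forall x y, pi ^ (1 - lam) * ss_form x y \in ppow k 0}.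
Proof.
move=> x y; rewrite -(oscale0 Bd x) -(oscale0 Bd y) => xB yB.
rewrite ppow_shift sub0r opprB; by have := form_dd xB yB; rewrite !addr0.
Qed.
Lemma bs_rad x y : x \in Bd -> y \in oscale n B ->
  pi ^ (1 - lam) * ss_form x y \in ppow k n.+1.
Proof.
rewrite -oscale0 => xB yQ; rewrite ppow_shift.
have := form_dB xB yQ; congr (_ \in ppow k _); rewrite intS; ring.
Qed.

(* b*_n = B* / ϖ^n B, with the form ϖ^(1-λ) β mod ϖ^(n+1) *)
Definition bs_data : sqData W n := SqData bs_sub bs_fin bs_ann bs_int bs_rad.
Definition bs : altMod (On k n) := sqm bs_data.

(* With m = n./2: u is the image of ϖ^(m+1) B* if n = 2m and of ϖ^(m+1) B if
   n = 2m + 1; u* is that of ϖ^m B if n = 2m and of ϖ^(m+1) B* if n = 2m + 1. *)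
Definition u_osub : osub W :=
  if odd n then oscale n./2.+1 B else oscale n./2.+1 Bd.
Definition us_osub : osub W :=
  if odd n then oscale n./2.+1 Bd else oscale n./2 B.

Lemma n_odd : odd n -> n%:Z = 1 + n./2%:Z *+ 2.
Proof.
move=> on; rewrite -{1}(odd_double_half n) on PoszD -addnn PoszD mulr2n.
by [].
Qed.
Lemma n_even : odd n = false -> n%:Z = n./2%:Z *+ 2.
Proof. by move=> on; rewrite -{1}(odd_double_half n) on -addnn PoszD mulr2n. Qed.

Lemma u_sub : {subset u_osub <= B}.
Proof.
move=> x; rewrite /u_osub -(oscale0 B); case: ifP => _; first by apply: oscale_sub.
by move=> h; apply: gl_scale1; apply: oscale_sub h; rewrite add0r.
Qed.
Lemma u_iso : {in u_osub &, forall x y, pi ^ (- lam) * ss_form x y \in ppow k n.+1}.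
Proof.
move=> x y; rewrite /u_osub ppow_shift (intS n); case: ifP => [/n_odd|/n_even] -> hx hy.
  by have := form_BB hx hy; congr (_ \in ppow k _); rewrite !intS; ring.
have := form_dd hx hy; congr (_ \in ppow k _); rewrite !intS; ring.
Qed.
Lemma u_inv (g : Sp bn) : {in sqm_img bn_data u_osub, forall x, g x \in sqm_img bn_data u_osub}.
Proof.
have := @sqm_img_inv_im _ _ _ bn_data u_osub n./2.+1.
have := @sqm_img_inv_ker _ _ _ bn_data _ u_sub n./2.
move=> hker him; case on : (odd n); [apply: him|apply: hker] => x.
  by rewrite /u_osub on.
move=> xB; rewrite /u_osub on in_oscale_shift /=; congr (x \in oscale _ _).
by rewrite !intS (n_even on); ring.
Qed.
Definition u_n : invIso bn :=
  @InvIso _ bn (sqm_img bn_data u_osub) (sqm_img_submod (d := bn_data) u_sub)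
    (sqm_img_isotropic (d := bn_data) u_sub u_iso) u_inv.

Lemma us_sub : {subset us_osub <= Bd}.
Proof.
move=> x; rewrite /us_osub -(oscale0 Bd); case: ifP => _; first by apply: oscale_sub.
by move=> h; apply: gl_scale2; apply: oscale_sub h.
Qed.
Lemma us_iso :
  {in us_osub &, forall x y, pi ^ (1 - lam) * ss_form x y \in ppow k n.+1}.
Proof.
move=> x y; rewrite /us_osub ppow_shift (intS n); case: ifP => [/n_odd|/n_even] -> hx hy.
  by have := form_dd hx hy; congr (_ \in ppow k _); rewrite !intS; ring.
by have := form_BB hx hy; congr (_ \in ppow k _); ring.
Qed.
Lemma us_inv (g : Sp bs) : {in sqm_img bs_data us_osub, forall x, g x \in sqm_img bs_data us_osub}.
Proof.
have := @sqm_img_inv_im _ _ _ bs_data us_osub n./2.+1.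
have := @sqm_img_inv_ker _ _ _ bs_data _ us_sub n./2.
move=> hker him; case on : (odd n); [apply: him|apply: hker] => x.
  by rewrite /us_osub on.
move=> xB; rewrite /us_osub on in_oscale_shift /=; congr (x \in oscale _ _).
by rewrite (n_even on); ring.
Qed.
Definition us_n : invIso bs :=
  @InvIso _ bs (sqm_img bs_data us_osub) (sqm_img_submod (d := bs_data) us_sub)
    (sqm_img_isotropic (d := bs_data) us_sub us_iso) us_inv.

End Dual.

(* Main.v *)
(** The H(V)-module S is recovered from its U-fixed vectors: P being the
    projection onto them, v |-> (x |-> P rho(x,0) v) identifies S with
    S^{U,sigma} for sigma the action on the fixed vectors.  In any model
    S^{U,sigma'} the U-fixed functions are those supported on U^perp, so that
    evaluation at 0 identifies them with sigma'; hence sigma is unique.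

    An operator T on S is the combination of the rho(v), v in V, whose
    coefficient c_v is the scalar obtained by averaging T rho(-v) over H(V).  If
    T commutes with Sp(V), then v |-> c_v is constant on orbits; hence the
    commutant of Sp(V) has dimension at most the number of orbits in V.  The
    representations in (D) are nonzero direct summands of S^{U,sigma}, so they
    are irreducible and pairwise inequivalent as soon as there are at least as
    many of them as there are orbits.

    The orbits are the differences of consecutive terms of the chain
    P > pi P' > pi P > pi^2 P' > ... > pi^(n+1) P', where P = B and P' = B^* in
    case (i), P = B^* and P' = pi^(-1) B in case (ii): transvections act
    transitively on them.  The orthogonal of the j-th term is the (2n+1-j)-th
    one, U is the (n+1)-st and U^perp the n-th, so both counts can be made. *)

From Pilot Require Import Defs.
From HB Require Import structures.
From mathcomp Require Import all_boot all_order all_algebra all_fingroup.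
From mathcomp Require Import boolp classical_sets reals topology complex.
From mathcomp Require Import ring zify.

Set Implicit Arguments.
Unset Strict Implicit.
Unset Printing Implicit Defensive.

Import Order.TTheory GRing.Theory Num.Theory.
Local Open Scope ring_scope.
(* [subspace], [formDl] and other names of Defs are shadowed by the imports above. *)
Import Pilot.Defs.

(** * Subspaces and linear maps on them *)

Lemma not_forall_in (T : Type) (P : T -> Prop) (b : pred T) :
  ~ (forall x, P x -> b x) -> exists2 x, P x & ~~ b x.
Proof. by move/existsPNP => [x Px /negP bx]; exists x. Qed.

Lemma set_neq0 (E : nmodType) (A : set E) v : A v -> v != 0 -> A <> [set 0]%classic.
Proof. by move=> Av /eqP v0 A0; apply: v0; rewrite A0 in Av. Qed.

Section Scaling.
Variables (C : fieldType) (E : lmodType C).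

Lemma scaleCA (a b : C) (v : E) : a *: (b *: v) = b *: (a *: v).
Proof. by rewrite !scalerA mulrC. Qed.

Lemma scalev_inj (v : E) : v != 0 -> injective (fun a : C => a *: v).
Proof.
move=> v0 a b /eqP.
by rewrite -subr_eq0 -scalerBl scaler_eq0 (negPf v0) orbF subr_eq0 => /eqP.
Qed.

Lemma scaler_halfD (v : E) : (2%:R : C) != 0 -> 2%:R^-1 *: (v + v) = v.
Proof. by move=> two0; rewrite -mulr2n -scaler_nat scalerK. Qed.

End Scaling.

Section Averages.
Variables (C : numFieldType) (E : lmodType C) (I : finType) (A : {pred I}).
Hypothesis A_neq0 : exists i, i \in A.

Lemma cardr_neq0 : #|A|%:R != 0 :> C.
Proof. by rewrite pnatr_eq0 -lt0n; apply/card_gt0P. Qed.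

Lemma avg_const (v : E) (f : I -> E) :
  {in A, forall i, f i = v} -> #|A|%:R^-1 *: \sum_(i in A) f i = v.
Proof.
by move=> fv; rewrite (eq_bigr (fun=> v))// sumr_const -scaler_nat scalerK// cardr_neq0.
Qed.

End Averages.

Lemma linear_hom (C : fieldType) (E E' : vectType C) (f : E -> E') :
  linear f -> exists h : 'Hom(E, E'), h =1 f.
Proof.
move=> f_lin; pose mixin := GRing.isLinear.Build C E E' _ f f_lin.
pose fL : {linear E -> E'} := HB.pack f mixin.
by exists (linfun fL) => v; rewrite lfunE.
Qed.

Lemma exists_coordinate (C : fieldType) (E : vectType C) (v : E) :
  v != 0 -> exists l : 'Hom(E, C^o), l v = 1.
Proof.
move=> v0; have free_v : free [tuple v] by rewrite seq1_free.
have [|l lE] := @linear_hom C E C^o (coord [tuple v] ord0).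
  by move=> a u w; rewrite linearP.
by exists l; rewrite lE -[v in LHS]/([tuple v]`_(@ord0 0)) coord_free.
Qed.

Definition linear_on (C : fieldType) (E E' : lmodType C) (A : set E) (f : E -> E') : Prop :=
  forall (a : C) u v, A u -> A v -> f (a *: u + v) = a *: f u + f v.

Section Subspaces.
Variables (C : fieldType) (E E' : lmodType C) (A : set E) (f : E -> E').
Hypotheses (A_sub : subspace A) (f_lin : linear_on A f).

Lemma subspace0 : A 0. Proof. exact: A_sub.1. Qed.

Lemma subspaceZ a u : A u -> A (a *: u).
Proof. by move=> Au; rewrite -[_ *: _]addr0; apply: A_sub.2 => //; exact: subspace0. Qed.

Lemma subspaceD u v : A u -> A v -> A (u + v).
Proof. by move=> Au Av; rewrite -[u]scale1r; apply: A_sub.2. Qed.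

Lemma subspaceB u v : A u -> A v -> A (u - v).
Proof. by move=> Au Av; rewrite addrC -scaleN1r; apply: A_sub.2. Qed.

Lemma subspace_sum (I : Type) (r : seq I) (P : pred I) (u : I -> E) :
  (forall i, P i -> A (u i)) -> A (\sum_(i <- r | P i) u i).
Proof. by move=> Au; elim/big_ind: _ => //; [exact: subspace0 | exact: subspaceD]. Qed.

Lemma subspace_neq0P : A <> [set 0]%classic -> exists2 v, A v & v != 0.
Proof.
move=> A_neq0; apply: not_forall_in => A0; apply: A_neq0; apply/seteqP.
by split=> v => [/A0/eqP//|->]; exact: subspace0.
Qed.

Lemma linear_on0 : f 0 = 0.
Proof.
by have := f_lin (-1) subspace0 subspace0; rewrite scaler0 addr0 scaleN1r addNr.
Qed.

Lemma linear_onD u v : A u -> A v -> f (u + v) = f u + f v.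
Proof. by move=> Au Av; have := f_lin 1 Au Av; rewrite !scale1r. Qed.

Lemma linear_onZ a u : A u -> f (a *: u) = a *: f u.
Proof. by move=> Au; have := f_lin a Au subspace0; rewrite linear_on0 !addr0. Qed.

Lemma linear_on_sum (I : Type) (r : seq I) (P : pred I) (u : I -> E) :
  (forall i, P i -> A (u i)) ->
  f (\sum_(i <- r | P i) u i) = \sum_(i <- r | P i) f (u i).
Proof.
move=> Au; elim: r => [|i r IH]; first by rewrite !big_nil linear_on0.
rewrite !big_cons; case: ifP => // Pi; rewrite linear_onD ?IH//; first exact: Au.
exact: subspace_sum.
Qed.

End Subspaces.

Section FiniteDimension.
Variables (C : fieldType) (E : vectType C) (A : set E).
Hypothesis A_sub : subspace A.

Lemma subspace_vspace : exists U : {vspace E}, forall v, A v <-> v \in U.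
Proof.
pose is_dim d := `[< exists2 U : {vspace E}, \dim U = d & forall v, v \in U -> A v >].
have is_dim0 : exists d, is_dim d.
  exists 0%N; apply/asboolP; exists 0%VS; first by rewrite dimv0.
  by move=> v; rewrite memv0 => /eqP ->; exact: subspace0.
have is_dim_le d : is_dim d -> (d <= \dim {:E})%N.
  by move=> /asboolP[U <- _]; rewrite dimvS ?subvf.
case: (ex_maxnP is_dim0 is_dim_le) => d /asboolP[U dimU UA] max_d.
exists U => v; split=> [Av|/UA//]; apply: contraT => vU.
suff /max_d : is_dim (\dim (U + <[v]>)%VS).
  rewrite leqNgt -dimU ltn_neqAle dimvS ?addvSl// andbT negbK => /eqP dimUv.
  case/negP: vU; have /eqP -> : (U == U + <[v]>)%VS by rewrite eqEdim addvSl dimUv leqnn.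
  by apply: subvP (addvSr _ _) _ (memv_line v).
apply/asboolP; eexists; first by [].
move=> w /memv_addP[u uU [x /vlineP[a ->] ->]].
by rewrite addrC; apply: A_sub.2 => //; exact: UA.
Qed.

Lemma linear_on_extend (E' : vectType C) (f : E -> E') :
  linear_on A f -> exists h : 'Hom(E, E'), forall v, A v -> h v = f v.
Proof.
move=> f_lin; have [U AU] := subspace_vspace.
have [|h hE] := @linear_hom C E E' (f \o projv U).
  by move=> a u v; rewrite /= linearP f_lin// AU memv_proj.
by exists h => v /AU vU; rewrite hE /= projv_id.
Qed.

End FiniteDimension.

Section Bijections.
Variables (C : fieldType) (E E' : vectType C) (A : set E) (A' : set E') (f : E -> E').
Hypotheses (A_sub : subspace A) (f_lin : linear_on A f).
Hypothesis f_in : forall v, A v -> A' (f v).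
Hypothesis f_onto : forall w, A' w -> exists2 v, A v & f v = w.
Hypothesis f_ker : forall v, A v -> f v = 0 -> v = 0.

Lemma linear_on_bijection : exists h : 'Hom(E, E'),
  [/\ (h @` A = A')%classic, {in A &, injective h} & forall v, A v -> h v = f v].
Proof.
have [h hE] := linear_on_extend A_sub f_lin; exists h; split=> //.
  apply/seteqP; split=> [_ [v Av <-]|w /f_onto[v Av <-]]; first by rewrite hE//; exact: f_in.
  by exists v => //; exact: hE.
move=> u v; rewrite !inE => Au Av huv; apply/eqP; rewrite -subr_eq0; apply/eqP.
have Auv := subspaceB A_sub Au Av.
by apply: f_ker => //; rewrite -hE// linearB /= huv subrr.
Qed.

End Bijections.

Lemma comp_bijection (C : fieldType) (E1 E2 E3 : vectType C)
    (A1 : set E1) (A2 : set E2) (A3 : set E3) (f : 'Hom(E1, E2)) (h : 'Hom(E2, E3)) :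
  (f @` A1 = A2)%classic -> {in A1 &, injective f} ->
  (h @` A2 = A3)%classic -> {in A2 &, injective h} ->
  ((h \o f)%VF @` A1 = A3)%classic /\ {in A1 &, injective (h \o f)%VF}.
Proof.
move=> f_img f_inj h_img h_inj; split=> [|u v Au Av].
  by rewrite -h_img -f_img image_comp; apply: eq_imagel => v _; rewrite lfunE.
have f_in w : w \in A1 -> f w \in A2.
  by move=> /set_mem Aw; apply/mem_set; rewrite -f_img; exists w.
by rewrite !lfunE /= => /(h_inj _ _ (f_in _ Au) (f_in _ Av))/f_inj; exact.
Qed.

Lemma injective_on_neq0 (C : fieldType) (E E' : vectType C) (A : set E) (f : 'Hom(E, E')) v :
  subspace A -> {in A &, injective f} -> A v -> v != 0 -> f v != 0.
Proof.
move=> A_sub f_inj Av; apply: contra_neq => fv0.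
by apply: f_inj; rewrite ?inE ?linear0//; exact: subspace0.
Qed.

Section Lines.
Variables (C : fieldType) (E : vectType C).
Implicit Types A : set E.

Definition is_line A : Prop :=
  exists v0, [/\ A v0, v0 != 0 & forall v, A v -> exists a : C, v = a *: v0].

Lemma line_neq0 A : is_line A -> A <> [set 0]%classic.
Proof. by move=> [v0 [Av0 v0_neq0 _]]; exact: set_neq0 v0_neq0. Qed.

Lemma line_coordinate A : is_line A ->
  exists v0 (l : 'Hom(E, C^o)), [/\ A v0, l v0 = 1 & forall v, A v -> v = (l v : C) *: v0].
Proof.
move=> [v0 [Av0 v0_neq0 A_span]]; have [l lv0] := exists_coordinate v0_neq0.
exists v0, l; split=> // v /A_span[a ->].
by rewrite linearZ /= lv0 [a *: 1]mulr1.
Qed.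

Lemma line_scalar A (f : E -> E) : subspace A -> is_line A -> linear_on A f ->
  (forall v, A v -> A (f v)) -> exists a : C, forall v, A v -> f v = a *: v.
Proof.
move=> A_sub [v0 [Av0 _ A_span]] f_lin fA; have [a fv0] := A_span _ (fA _ Av0).
exists a => _ /A_span[b ->].
by rewrite (linear_onZ A_sub f_lin)// fv0 scaleCA.
Qed.

End Lines.

Section Eigenvectors.
Variable C : numClosedFieldType.

Lemma exists_eigenvector (E : vectType C) (f : 'End(E)) :
  (0 < \dim {:E})%N -> exists (a : C) v, v != 0 /\ f v = a *: v.
Proof.
pose e := vbasis {:E}; have e_basis : basis_of {:E} e := vbasisP _.
case/(spectral.eigenvalue_closed (passmx.mxof e e f)) => a fa; exists a.
have eigen0 : passmx.leigenspace f a != 0%VS.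
  by rewrite (passmx.leigenspaceE e_basis) passmx.vsof_eq0.
exists (vpick (passmx.leigenspace f a)); rewrite vpick0; split=> //.
have := memv_pick (passmx.leigenspace f a).
by rewrite memv_ker !lfun_simp subr_eq0 => /eqP.
Qed.

Lemma linear_on_eigenvector (E : vectType C) (A : set E) (f : E -> E) :
  subspace A -> linear_on A f -> (forall v, A v -> A (f v)) -> A <> [set 0]%classic ->
  exists (a : C) v, [/\ A v, v != 0 & f v = a *: v].
Proof.
move=> A_sub f_lin fA /(subspace_neq0P A_sub)[v0 Av0 v0_neq0].
have [U AU] := subspace_vspace A_sub.
have U_A (u : subvs_of U) : A (vsval u) by apply/AU; exact: subvsP.
have [|g gE] := @linear_hom C _ _ (fun u : subvs_of U => vsproj U (f (vsval u))).
  by move=> a u v; rewrite /= f_lin// linearP.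
have [|a [u [u0 gu]]] := exists_eigenvector g.
  rewrite dimvf lt0n [_ == _]dimv_eq0; apply: contra v0_neq0 => /eqP U0.
  by move/AU: Av0; rewrite U0 memv0.
exists a, (vsval u); split; first exact: U_A.
  by apply: contra_neq u0 => u0; apply: subvs_inj; rewrite u0 linear0.
by rewrite -linearZ -gu gE /= vsprojK//; apply/AU/fA/U_A.
Qed.

End Eigenvectors.

(** * Representations and their commutants *)

Lemma linear_relation (C : fieldType) (I J : finType) (P : {pred I}) (M : I -> J -> C) :
  (#|J| < #|P|)%N ->
  exists c : I -> C, (exists2 i, i \in P & c i != 0) /\
    forall j, \sum_(i in P) c i * M i j = 0.
Proof.
move=> ltJP; pose A : 'M[C]_(#|P|, #|J|) := \matrix_(i, j) M (enum_val i) (enum_val j).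
have : kermx A != 0.
  by rewrite kermx_eq0 /row_free neq_ltn (leq_ltn_trans (rank_leq_col _)).
case/rowV0Pn => x /sub_kermxP xA /rV0Pn[i xi].
pose c y := x 0 (enum_rank_in (enum_valP i) y); exists c.
split; first by exists (enum_val i); rewrite ?enum_valP// /c enum_valK_in.
move=> j; have := congr1 (fun B : 'rV_#|J| => B 0 (enum_rank j)) xA; rewrite !mxE => {2}<-.
rewrite big_enum_val /=; apply: eq_bigr => l _.
by rewrite /c enum_valK_in mxE enum_rankK.
Qed.

Section Representations.
Variables (C : numClosedFieldType) (gT : finGroupType).
Implicit Types r : repn C gT.

Section Basics.
Variable r : repn C gT.
Hypothesis r_repn : is_repn r.

Lemma repn_subspace : subspace (rp_space r). Proof. by case: r_repn. Qed.
Lemma repn_in g v : rp_space r v -> rp_space r (rp_op r g v).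
Proof. by case: r_repn => _ h _ _ _; exact: h. Qed.
Lemma repn_linear g : linear_on (rp_space r) (rp_op r g).
Proof. by case: r_repn => _ _ h _ _; exact: h. Qed.
Lemma repn1 v : rp_space r v -> rp_op r 1%g v = v.
Proof. by case: r_repn => _ _ _ h _; exact: h. Qed.
Lemma repnM g h v : rp_space r v -> rp_op r (g * h)%g v = rp_op r g (rp_op r h v).
Proof. by case: r_repn => _ _ _ _ hM; exact: hM. Qed.
Lemma repnKV g v : rp_space r v -> rp_op r g (rp_op r g^-1%g v) = v.
Proof. by move=> rv; rewrite -repnM// mulgV repn1. Qed.

End Basics.

#[local] Hint Extern 0 (rp_space _ (rp_op _ _ _)) =>
  (eapply repn_in; [eassumption | trivial]) : core.

Definition intertwiner r1 r2 (f : rp_sort r1 -> rp_sort r2) : Prop :=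
  [/\ linear_on (rp_space r1) f, forall v, rp_space r1 v -> rp_space r2 (f v)
    & forall g v, rp_space r1 v -> f (rp_op r1 g v) = rp_op r2 g (f v)].

Lemma intertwiner_comp r1 r2 r3 (f : rp_sort r1 -> rp_sort r2)
    (h : rp_sort r2 -> rp_sort r3) :
  intertwiner f -> intertwiner h -> @intertwiner r1 r3 (h \o f).
Proof.
move=> [f_lin f_in fG] [h_lin h_in hG]; split=> [a u v ru rv|v /f_in/h_in//|g v rv] /=.
  by rewrite f_lin// h_lin//; apply: f_in.
by rewrite fG ?hG//; exact: f_in.
Qed.

Lemma intertwiner_bij_iso r1 r2 (f : rp_sort r1 -> rp_sort r2) :
  subspace (rp_space r1) -> intertwiner f ->
  (forall w, rp_space r2 w -> exists2 v, rp_space r1 v & f v = w) ->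
  (forall v, rp_space r1 v -> f v = 0 -> v = 0) ->
  (forall g v, rp_space r1 v -> rp_space r1 (rp_op r1 g v)) -> repn_iso r1 r2.
Proof.
move=> r1_sub [f_lin f_in fG] f_onto f_ker r1_in.
have [h [h_img h_inj hE]] := linear_on_bijection r1_sub f_lin f_in f_onto f_ker.
by exists h; split=> // g v rv; rewrite !hE ?fG//; exact: r1_in.
Qed.

Lemma repn_iso_intertwiner r1 r2 (f : 'Hom(rp_sort r1, rp_sort r2)) :
  (f @` rp_space r1 = rp_space r2)%classic ->
  (forall g v, rp_space r1 v -> f (rp_op r1 g v) = rp_op r2 g (f v)) ->
  @intertwiner r1 r2 f.
Proof. by move=> f_img fG; split=> // [a u v _ _|v rv]; rewrite ?linearP// -f_img; exists v. Qed.

Lemma repn_iso_trans r1 r2 r3 : repn_iso r1 r2 -> repn_iso r2 r3 -> repn_iso r1 r3.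
Proof.
move=> [f [f_img f_inj fG]] [h [h_img h_inj hG]].
have f_in v : rp_space r1 v -> rp_space r2 (f v) by move=> rv; rewrite -f_img; exists v.
have [hf_img hf_inj] := comp_bijection f_img f_inj h_img h_inj.
exists (h \o f)%VF; split=> // g v rv; rewrite !lfunE /= fG// hG//; exact: f_in.
Qed.

Section IsoTransport.
Variables r1 r2 : repn C gT.
Hypotheses (r1_repn : is_repn r1) (r12 : repn_iso r1 r2).

Lemma iso_is_repn : is_repn r2.
Proof.
have [f [f_img _ fG]] := r12; have [r_sub r_in r_lin r_1 r_M] := r1_repn.
have f_in v : rp_space r1 v -> rp_space r2 (f v) by move=> rv; rewrite -f_img; exists v.
split.
- split=> [|a u v]; first by have := f_in _ (subspace0 r_sub); rewrite linear0.
  rewrite -f_img => -[u' ru' <-] [v' rv' <-].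
  by exists (a *: u' + v'); [exact: r_sub.2|rewrite linearP].
- by move=> g v; rewrite -{1}f_img => -[v' rv' <-]; rewrite -fG//; exact/f_in/r_in.
- move=> g a u v; rewrite -f_img => -[u' ru' <-] [v' rv' <-].
  by rewrite -linearP -!fG ?r_lin ?linearP//; exact: r_sub.2.
- by move=> v; rewrite -f_img => -[v' rv' <-]; rewrite -fG// r_1.
- by move=> g h v; rewrite -f_img => -[v' rv' <-]; rewrite -!fG ?r_M//; exact: r_in.
Qed.

Lemma iso_neq0 : rp_space r1 <> [set 0]%classic -> rp_space r2 <> [set 0]%classic.
Proof.
have [f [f_img f_inj _]] := r12; have r_sub := repn_subspace r1_repn.
move=> /(subspace_neq0P r_sub)[v rv v0].
apply: (set_neq0 (v := f v)); first by rewrite -f_img; exists v.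
exact: injective_on_neq0 r_sub f_inj rv v0.
Qed.

Lemma iso_irreducible : irreducible r1 -> irreducible r2.
Proof.
have [f [f_img f_inj fG]] := r12; have r_sub := repn_subspace r1_repn.
move=> [_ r_neq0 r_irr]; split; [exact: iso_is_repn|exact: iso_neq0|].
move=> A A_sub Ar AG; pose B := [set v | rp_space r1 v /\ A (f v)]%classic.
have A_img : A = (f @` B)%classic.
  apply/seteqP; split=> [w Aw|_ [v [_ Afv] <-]//].
  by have := Ar _ Aw; rewrite -f_img => -[v rv fv]; exists v; rewrite /B /= ?fv.
have [|||B0|BE] := r_irr B.
- split=> [|a u v [ru Au] [rv Av]]; split; rewrite ?linear0 ?linearP; try exact: subspace0.
    exact: r_sub.2.
  exact: A_sub.2.
- by move=> v [].
- by move=> g v [rv Av]; split; [exact: repn_in|rewrite fG//; exact: AG].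
- by left; rewrite A_img B0 image_set1 linear0.
- by right; rewrite A_img BE f_img.
Qed.

End IsoTransport.

Section Averaging.
Variables r1 r2 : repn C gT.
Hypotheses (r1_repn : is_repn r1) (r2_repn : is_repn r2).

Definition conj_sum (f : rp_sort r1 -> rp_sort r2) (v : rp_sort r1) : rp_sort r2 :=
  \sum_g rp_op r2 g (f (rp_op r1 g^-1%g v)).

Variable f : rp_sort r1 -> rp_sort r2.
Hypothesis f_lin : linear_on (rp_space r1) f.
Hypothesis f_in : forall v, rp_space r1 v -> rp_space r2 (f v).

Lemma conj_sum_intertwiner : intertwiner (conj_sum f).
Proof.
have r2_sub := repn_subspace r2_repn.
have term_in g h v : rp_space r1 v -> rp_space r2 (rp_op r2 g (f (rp_op r1 h v))).
  by move=> rv; apply: (repn_in r2_repn); exact: f_in.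
split=> [a u v ru rv|v rv|g v rv].
- rewrite /conj_sum scaler_sumr -big_split; apply: eq_bigr => g _ /=.
  rewrite (repn_linear r1_repn)// f_lin//.
  by rewrite (repn_linear r2_repn)//; exact: f_in.
- by apply: subspace_sum => // g _; exact: term_in.
- rewrite (linear_on_sum r2_sub (repn_linear r2_repn g)) => [|h _]; last exact: term_in.
  rewrite /conj_sum (reindex_inj (mulgI g)); apply: eq_bigr => h _ /=.
  rewrite (repnM r2_repn); last exact: f_in.
  by rewrite -(repnM r1_repn)// invMg -mulgA mulVg mulg1.
Qed.

End Averaging.

Lemma schur r (f : rp_sort r -> rp_sort r) : irreducible r -> @intertwiner r r f ->
  exists a, forall v, rp_space r v -> f v = a *: v.
Proof.
move=> [r_repn r_neq0 r_irr] [f_lin f_in fG]; have r_sub := repn_subspace r_repn.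
have [a [v [rv v0 fv]]] := linear_on_eigenvector r_sub f_lin f_in r_neq0.
exists a; pose A := [set w | rp_space r w /\ f w = a *: w]%classic.
have [|||A0|AE] := r_irr A.
- split=> [|b u w [ru fu] [rw fw]].
    by split; [exact: subspace0|rewrite (linear_on0 r_sub f_lin) scaler0].
  by split; [exact: r_sub.2|rewrite f_lin// fu fw scalerDr scaleCA].
- by move=> w [].
- move=> g w [rw fw]; split; first exact: repn_in.
  by rewrite fG// fw (linear_onZ r_sub (repn_linear r_repn g)).
- by have : A v by []; rewrite A0 => /= v_eq0; rewrite v_eq0 eqxx in v0.
- by move=> w; rewrite -AE => -[].
Qed.

Lemma maschke r (A : set (rp_sort r)) : is_repn r -> subspace A ->
  (forall v, A v -> rp_space r v) -> (forall g v, A v -> A (rp_op r g v)) ->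
  exists p : rp_sort r -> rp_sort r,
  [/\ @intertwiner r r p, forall v, rp_space r v -> A (p v) & forall v, A v -> p v = v].
Proof.
move=> r_repn A_sub Ar AG; have [U AU] := subspace_vspace A_sub.
have r_sub := repn_subspace r_repn; have projA v : A (projv U v) by apply/AU/memv_proj.
have G_neq0 : exists g : gT, g \in gT by exists 1%g.
have [sum_lin sum_in sumG] : intertwiner (@conj_sum r r (projv U)).
  apply: conj_sum_intertwiner => // [a u v _ _|v _]; [exact: linearP|exact/Ar/projA].
exists (fun v => #|gT|%:R^-1 *: conj_sum (projv U) v); split.
- split=> [a u v ru rv|v rv|g v rv].
  + by rewrite sum_lin// scalerDr scaleCA.
  + by apply: subspaceZ => //; exact: sum_in.
  + by rewrite sumG// (linear_onZ r_sub (repn_linear r_repn g))//; exact: sum_in.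
- by move=> v rv; apply: subspaceZ => //; apply: subspace_sum => // g _; exact: AG.
- move=> v Av; apply: avg_const => // g _.
  by rewrite projv_id ?(repnKV r_repn)//; [exact: Ar|apply/AU/AG].
Qed.

Lemma scalar_endomorphisms_irreducible r : is_repn r -> rp_space r <> [set 0]%classic ->
  (forall f, @intertwiner r r f -> exists a, forall v, rp_space r v -> f v = a *: v) ->
  irreducible r.
Proof.
move=> r_repn r_neq0 r_end; split=> // A A_sub Ar AG.
have [p [p_int p_in p_id]] := maschke r_repn A_sub Ar AG; have [a pE] := r_end p p_int.
have [A0|A_neq0] := pselect (A = [set 0]%classic); [by left|right].
have [v Av v0] := subspace_neq0P A_sub A_neq0.
have a1 : a = 1 by apply: (scalev_inj v0); rewrite -pE ?p_id ?scale1r//; exact: Ar.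
by apply/seteqP; split=> // w rw; rewrite -[w]scale1r -a1 -pE//; exact: p_in.
Qed.

Definition commutant_dim_le (M : repn C gT) (m : nat) : Prop :=
  exists (J : finType) (s : J -> rp_sort M -> rp_sort M), (#|J| <= m)%N /\
    forall T, @intertwiner M M T ->
    exists c : J -> C, forall v, rp_space M v -> T v = \sum_j c j *: s j v.

Lemma commutant_dim_leW (M : repn C gT) (m m' : nat) :
  (m <= m')%N -> commutant_dim_le M m -> commutant_dim_le M m'.
Proof.
by move=> lemm [J [s [leJm spanM]]]; exists J, s; split=> //; exact: leq_trans lemm.
Qed.

Lemma commutant_dependent (M : repn C gT) (m : nat) (I : finType) (P : {pred I})
    (T : I -> rp_sort M -> rp_sort M) :
  commutant_dim_le M m -> (m < #|P|)%N -> {in P, forall i, @intertwiner M M (T i)} ->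
  exists c : I -> C, (exists2 i, i \in P & c i != 0) /\
    forall v, rp_space M v -> \sum_(i in P) c i *: T i v = 0.
Proof.
move=> [J [s [leJm spanM]]] ltmP T_int.
have /choice[a aE] i : exists a : J -> C, i \in P ->
    forall v, rp_space M v -> T i v = \sum_j a j *: s j v.
  have [/T_int/spanM[a aE]|] := boolP (i \in P); first by exists a.
  by exists (fun=> 0).
have [c [c_neq0 cE]] := linear_relation a (leq_ltn_trans leJm ltmP).
exists c; split=> // v Mv; rewrite (eq_bigr (fun i => \sum_j (c i * a i j) *: s j v)).
  by rewrite exchange_big big1 // => j _; rewrite -scaler_suml cE scale0r.
by move=> i iP; rewrite aE// scaler_sumr; apply: eq_bigr => j _; rewrite scalerA.
Qed.

End Representations.

Section DirectSummands.
Variables (C : numClosedFieldType) (gT : finGroupType) (M : repn C gT).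
Variables (K : finType) (D : {set K}) (r : K -> repn C gT).
Variables (proj : forall i, rp_sort M -> rp_sort (r i)).
Variables (incl : forall i, rp_sort (r i) -> rp_sort M).

Record direct_summands : Prop := DirectSummands {
  summand_repn : {in D, forall i, is_repn (r i)};
  summand_neq0 : {in D, forall i, rp_space (r i) <> [set 0]%classic};
  proj_intertwiner : {in D, forall i, intertwiner (proj i)};
  incl_intertwiner : {in D, forall i, @intertwiner _ _ (r i) M (@incl i)};
  inclK : {in D, forall i v, rp_space (r i) v -> proj i (incl v) = v};
  proj_incl0 : {in D &, forall i j, i != j ->
    forall v : rp_sort (r i), rp_space (r i) v -> proj j (incl v) = 0}
}.

Hypotheses (M_repn : is_repn M) (summandsM : direct_summands).
Let M_sub := repn_subspace M_repn.

Lemma sum_proj_incl (c : K -> C) i (v : rp_sort (r i)) : i \in D -> rp_space (r i) v ->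
  \sum_(j in D) c j *: incl (proj j (incl v)) = c i *: incl v.
Proof.
move=> iD rv; rewrite (bigD1 i)//= (inclK summandsM)// big1 ?addr0// => j /andP[jD ji].
rewrite (proj_incl0 summandsM)// 1?eq_sym//.
have [incl_lin _ _] := incl_intertwiner summandsM jD.
by rewrite (linear_on0 (repn_subspace (summand_repn summandsM jD)) incl_lin) scaler0.
Qed.

Lemma proj_inclZ i a (v : rp_sort (r i)) : i \in D -> rp_space (r i) v ->
  proj i (a *: incl v) = a *: v.
Proof.
move=> iD rv; have [proj_lin _ _] := proj_intertwiner summandsM iD.
have [_ incl_in _] := incl_intertwiner summandsM iD.
by rewrite (linear_onZ M_sub proj_lin) ?(inclK summandsM)//; exact: incl_in.
Qed.

Lemma incl_proj_free (c : K -> C) :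
  (forall v, rp_space M v -> \sum_(i in D) c i *: incl (proj i v) = 0) ->
  {in D, forall i, c i = 0}.
Proof.
move=> relation i iD; have r_sub := repn_subspace (summand_repn summandsM iD).
have [v rv v0] := subspace_neq0P r_sub (summand_neq0 summandsM iD).
have [_ incl_in _] := incl_intertwiner summandsM iD.
have := relation _ (incl_in _ rv); rewrite sum_proj_incl// -(scale0r (incl v)).
by move/(congr1 (proj i)); rewrite !proj_inclZ// => /(scalev_inj v0).
Qed.

Hypothesis small_commutant : commutant_dim_le M #|D|.

(* The operator T and the #|D| projections incl \o proj are too many operators to be
   independent, and the projections alone are independent. *)
Lemma commutant_diagonal (T : rp_sort M -> rp_sort M) : @intertwiner _ _ M M T ->
  exists c : K -> C, forall v, rp_space M v ->
    T v = \sum_(i in D) c i *: incl (proj i v).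
Proof.
move=> T_int; pose P := None |: [set Some i | i in D]%SET.
pose X (o : option K) := if o is Some i then @incl i \o proj i else T.
have ltDP : (#|D| < #|P|)%N.
  by rewrite cardsU1 (card_imset _ Some_inj); case: imsetP => [[]//|_]; rewrite add1n.
have X_int : {in P, forall o, @intertwiner _ _ M M (X o)}.
  move=> _ /setU1P[->//|/imsetP[i iD ->]].
  exact: intertwiner_comp (proj_intertwiner summandsM iD) (incl_intertwiner summandsM iD).
have [c [[o oP co] cE]] := commutant_dependent small_commutant ltDP X_int.
have relation v : rp_space M v ->
    c None *: T v + \sum_(i in D) c (Some i) *: incl (proj i v) = 0.
  move=> /cE; rewrite big_setU1 /=; last by apply/imsetP => -[].
  by rewrite big_imset //= => i j _ _ [].
have cNone : c None != 0.
  apply: contra_neq co => cN; case/setU1P: oP => [->//|/imsetP[i iD ->]].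
  apply: (@incl_proj_free (fun i => c (Some i))) iD => v /relation.
  by rewrite cN scale0r add0r.
exists (fun i => - (c None)^-1 * c (Some i)) => v /relation/eqP.
rewrite addr_eq0 => /eqP/(congr1 (fun x => (c None)^-1 *: x)).
rewrite scalerK// scalerN -scaleNr scaler_sumr => ->.
by apply: eq_bigr => i _; rewrite scalerA.
Qed.

Lemma intertwiner_incl i j (f : rp_sort (r i) -> rp_sort (r j)) : i \in D -> j \in D ->
  intertwiner f ->
  exists a, forall v, rp_space (r i) v -> incl (f v) = a *: incl v.
Proof.
move=> iD jD f_int.
have [c cE] := commutant_diagonal (intertwiner_comp (intertwiner_comp
  (proj_intertwiner summandsM iD) f_int) (incl_intertwiner summandsM jD)).
exists (c i) => v rv; have [_ incl_in _] := incl_intertwiner summandsM iD.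
by have := cE _ (incl_in _ rv); rewrite /= (inclK summandsM)// sum_proj_incl.
Qed.

Lemma summands_irreducible : {in D, forall i, irreducible (r i)}.
Proof.
move=> i iD; apply: scalar_endomorphisms_irreducible => [||f f_int].
- exact: summand_repn summandsM i iD.
- exact: summand_neq0 summandsM i iD.
have [a aE] := intertwiner_incl iD iD f_int; exists a => v rv.
have [_ f_in _] := f_int.
by have := congr1 (proj i) (aE v rv); rewrite (inclK summandsM) ?proj_inclZ//; exact: f_in.
Qed.

Lemma summands_not_iso : {in D &, forall i j, i != j -> ~ repn_iso (r i) (r j)}.
Proof.
move=> i j iD jD ij [f [f_img f_inj fG]].
have r_sub := repn_subspace (summand_repn summandsM iD).
have [v rv v0] := subspace_neq0P r_sub (summand_neq0 summandsM iD).
have f_int := repn_iso_intertwiner f_img fG; have [_ f_in _] := f_int.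
have [a aE] := intertwiner_incl iD jD f_int.
have := congr1 (proj j) (aE v rv); rewrite (inclK summandsM)//; last exact: f_in.
have [proj_lin _ _] := proj_intertwiner summandsM jD.
have [_ incl_in _] := incl_intertwiner summandsM iD.
rewrite (linear_onZ M_sub proj_lin); last exact: incl_in.
rewrite (proj_incl0 summandsM)// scaler0 => fv0.
by have := injective_on_neq0 r_sub f_inj rv v0; rewrite fv0 eqxx.
Qed.

End DirectSummands.

Section Induction.
Variables (C : numClosedFieldType) (gT : finGroupType) (t : repn C gT).
Hypothesis t_sub : subspace (rp_space t).
Hypothesis t_lin : forall h, linear_on (rp_space t) (rp_op t h).

Lemma induced_is_repn (H : {set gT}) : is_repn (induced H t).
Proof.
split=> /=.
- split=> [|a u v [u_in uH] [v_in vH]]; split=> [g|h g hH]; rewrite !ffunE.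
  + exact: subspace0.
  + by rewrite (linear_on0 t_sub (t_lin h)).
  + exact: t_sub.2.
  + by rewrite t_lin// uH// vH.
- move=> g v [v_in vH]; split=> [x|h x hH]; rewrite !ffunE; first exact: v_in.
  by rewrite -mulgA (vH _ _ hH).
- by move=> g a u v _ _; apply/ffunP => x; rewrite !ffunE.
- by move=> v _; apply/ffunP => x; rewrite ffunE mulg1.
- by move=> g h v _; apply/ffunP => x; rewrite !ffunE mulgA.
Qed.

Lemma induced_in (H : {set gT}) g v :
  rp_space (induced H t) v -> rp_space (induced H t) (rp_op (induced H t) g v).
Proof. exact: (repn_in (induced_is_repn H)). Qed.

Lemma induced_char_iso (H : {set gT}) (chi : gT -> C) : is_line (rp_space t) ->
  (forall h v, rp_space t v -> rp_op t h v = chi h *: v) ->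
  repn_iso (induced H t) (induced H (char_repn chi)).
Proof.
move=> /line_coordinate[v0 [l [tv0 lv0 tE]]] t_chi.
pose f (F : {ffun gT -> rp_sort t}) : {ffun gT -> C^o} := [ffun g => l (F g)].
apply: (@intertwiner_bij_iso _ _ (induced H t) (induced H (char_repn chi)) f).
- exact: (repn_subspace (induced_is_repn H)).
- split=> [a u v _ _|F [F_in FH]|g F _].
  + by apply/ffunP => g; rewrite !ffunE linearP.
  + by split=> // h g hH; rewrite !ffunE FH// t_chi// linearZ.
  + by apply/ffunP => h; rewrite !ffunE.
- move=> F [_ FH]; exists [ffun g => (F g : C) *: v0]; last first.
    by apply/ffunP => g; rewrite !ffunE linearZ /= lv0 [_ *: 1]mulr1.
  split=> [g|h g hH]; rewrite !ffunE; first exact: subspaceZ.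
  by rewrite FH// t_chi ?scalerA//; exact: subspaceZ.
- move=> F [F_in _] /ffunP lF0; apply/ffunP => g; rewrite ffunE (tE _ (F_in g)).
  by have := lF0 g; rewrite !ffunE => ->; rewrite scale0r.
- exact: induced_in.
Qed.

Lemma induced_char_mult (H : {group gT}) (chi : gT -> C) :
  (forall h v, rp_space t v -> rp_op t h v = chi h *: v) ->
  rp_space (induced H t) <> [set 0]%classic ->
  chi 1%g = 1 /\ {in H &, forall g h, chi (g * h)%g = chi g * chi h}.
Proof.
move=> t_chi /(subspace_neq0P (repn_subspace (induced_is_repn H)))[F [F_in FH] F_neq0].
have /existsNP[g0 /eqP Fg0] : ~ forall g, F g = 0.
  by move=> F0; case/eqP: F_neq0; apply/ffunP => g; rewrite F0 ffunE.
split=> [|g h gH hH]; apply: (scalev_inj Fg0).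
  by rewrite -t_chi// -FH// mul1g scale1r.
have Fh_in : rp_space t (F (h * g0)%g) by [].
by rewrite -t_chi// -FH ?groupM// -mulgA FH// t_chi// FH// t_chi// scalerA.
Qed.

Lemma induced_line_monomial (H : {group gT}) : is_line (rp_space t) ->
  (forall h v, rp_space t v -> rp_space t (rp_op t h v)) ->
  rp_space (induced H t) <> [set 0]%classic -> monomial (induced H t).
Proof.
move=> t_line t_in ind_neq0.
have /choice[chi t_chi] h : exists a, forall v, rp_space t v -> rp_op t h v = a *: v.
  by apply: line_scalar => // v; exact: t_in.
have [chi1 chiM] := induced_char_mult t_chi ind_neq0.
by exists H, chi; split=> //; exact: induced_char_iso.
Qed.

End Induction.

Lemma induced_setT_iso (C : numClosedFieldType) (gT : finGroupType) (t : repn C gT) :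
  is_repn t -> repn_iso t (induced [set: gT] t).
Proof.
move=> t_repn; pose f v : {ffun gT -> rp_sort t} := [ffun g => rp_op t g v].
apply: (@intertwiner_bij_iso _ _ t (induced [set: gT] t) f).
- exact: repn_subspace.
- split=> [a u v tu tv|v tv|g v tv].
  + by apply/ffunP => g; rewrite !ffunE (repn_linear t_repn).
  + by split=> [g|h g _]; rewrite !ffunE ?(repnM t_repn)//; exact: (repn_in t_repn).
  + by apply/ffunP => h; rewrite !ffunE (repnM t_repn).
- move=> F [F_in FG]; exists (F 1%g) => //.
  by apply/ffunP => g; rewrite ffunE -FG ?inE// mulg1.
- by move=> v tv /ffunP/(_ 1%g); rewrite !ffunE (repn1 t_repn).
- by move=> g v; exact: (repn_in t_repn).
Qed.

Lemma monomial_iso (C : numClosedFieldType) (gT : finGroupType) (r1 r2 : repn C gT) :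
  repn_iso r1 r2 -> monomial r2 -> monomial r1.
Proof.
move=> r12 [H [chi [chi1 chiM r2_chi]]].
by exists H, chi; split=> //; exact: repn_iso_trans r2_chi.
Qed.

Lemma line_monomial (C : numClosedFieldType) (gT : finGroupType) (t : repn C gT) :
  is_repn t -> is_line (rp_space t) -> monomial t.
Proof.
move=> t_repn t_line; have t_sub := repn_subspace t_repn; have t_ind := induced_setT_iso t_repn.
apply: (monomial_iso t_ind).
apply: (@induced_line_monomial _ _ t _ _ [set: gT]%G) => //.
- exact: repn_linear.
- by move=> h v; exact: repn_in.
- exact: iso_neq0 t_repn t_ind (line_neq0 t_line).
Qed.

(** * Weil actions and the commutant of Sp(V) *)

Section SpTheory.
Variables (F : finComUnitRingType) (V : altMod F).
Implicit Types (g h : Sp V) (x y z : V).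

Lemma sp_invK g x : g^-1%g (g x) = x. Proof. exact: permK. Qed.
Lemma sp_invKV g x : g (g^-1%g x) = x. Proof. exact: permKV. Qed.
Lemma sp_mulE g h x : (g * h)%g x = g (h x). Proof. exact: permM. Qed.
Lemma sp_oneE x : (1%g : Sp V) x = x. Proof. exact: perm1. Qed.
Lemma sp_oppE x : sp_opp V x = - x. Proof. exact: permE. Qed.
Lemma sp_inj g : injective g. Proof. exact: perm_inj. Qed.

Lemma spD g x y : g (x + y) = g x + g y.
Proof. by have := sp_lin g 1 x y; rewrite !scale1r. Qed.
Lemma spN g x : g (- x) = - g x.
Proof. by rewrite -scaleN1r sp_scale scaleN1r. Qed.

Lemma eq_sp g h : g =1 h -> g = h.
Proof. by move=> gh; apply/val_inj/permP. Qed.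
Lemma sp_oppK : (sp_opp V * sp_opp V = 1)%g.
Proof. by apply: eq_sp => x; rewrite sp_mulE !sp_oppE opprK sp_oneE. Qed.
Lemma sp_oppC g : (sp_opp V * g = g * sp_opp V)%g.
Proof. by apply: eq_sp => x; rewrite !sp_mulE !sp_oppE spN. Qed.

Lemma formBr x y z : am_form x (y - z) = am_form x y - am_form x z.
Proof. by rewrite formDr formNr. Qed.
Lemma formBl x y z : am_form (x - y) z = am_form x z - am_form y z.
Proof. by rewrite formDl formNl. Qed.

Lemma heis_mulE (h k : heis V) :
  (h * k)%g = (h.1 + k.1, h.2 + k.2 + 2%:R^-1 * am_form h.1 k.1).
Proof. by []. Qed.
Lemma heis_invE (h : heis V) : (h^-1)%g = (- h.1, - h.2).
Proof. by []. Qed.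

Lemma sp_heis_inj g : injective (@sp_heis F V g).
Proof. by move=> [x t] [y s] [] /sp_inj -> ->. Qed.

Definition nondegenerate : Prop := forall x, (forall y, am_form y x = 0) -> x = 0.

End SpTheory.
Arguments nondegenerate {F} V.

Lemma submodB (F : finComUnitRingType) (V : altMod F) (A : {set V}) :
  submod_closed A -> {in A &, forall x y, x - y \in A}.
Proof. by move=> A_sub x y xA yA; rewrite addrC -scaleN1r; apply: A_sub.2. Qed.

Lemma submod_addl (F : finComUnitRingType) (V : altMod F) (A : {set V}) x y :
  submod_closed A -> x \in A -> (x + y \in A) = (y \in A).
Proof.
move=> A_sub xA; apply/idP/idP => [xyA|yA]; last by rewrite -[x]scale1r; apply: A_sub.2.
by rewrite -[y](addKr x) addrC; exact: submodB.
Qed.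

Lemma halfD (F : finComUnitRingType) (a : F) :
  (2%:R : F) \is a GRing.unit -> 2%:R^-1 * a + 2%:R^-1 * a = a.
Proof. by move=> two_unit; rewrite -mulrDr -mulr2n -[a *+ 2]mulr_natl mulKr. Qed.

Section CharacterSums.
Variables (C : fieldType) (F : finComUnitRingType) (psi : F -> C).
Hypothesis psi_prim : primitive_char psi.

Lemma psi0 : psi 0 = 1. Proof. by case: psi_prim. Qed.
Lemma psiD s t : psi (s + t) = psi s * psi t. Proof. by case: psi_prim. Qed.
Lemma psi_mulN s : psi s * psi (- s) = 1. Proof. by rewrite -psiD subrr psi0. Qed.

Variables (V : altMod F) (A : {set V}).
Hypothesis A_sub : submod_closed A.

Lemma psi_form_eq1 z : {in A, forall u, psi (am_form u z) = 1} ->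
  {in A, forall u, am_form u z = 0}.
Proof.
have [A0 A_lin] := A_sub; move=> psi1 u uA; pose I := [set am_form w z | w in A]%SET.
suff I0 : I = [set 0]%SET by apply/set1P; rewrite -I0; exact: imset_f.
have [_ _] := psi_prim; apply.
- by apply/imsetP; exists 0; rewrite ?form0l.
- move=> _ _ /imsetP[x xA ->] /imsetP[y yA ->]; rewrite -formDl.
  by apply: imset_f; rewrite -[x]scale1r; exact: A_lin.
- move=> a _ /imsetP[x xA ->]; rewrite -formZl; apply: imset_f.
  by rewrite -[_ *: _]addr0; exact: A_lin.
- by move=> _ /imsetP[x xA ->]; exact: psi1.
Qed.

Lemma sum_psi_form z : \sum_(u in A) psi (am_form u z) =
  if [forall u in A, am_form u z == 0] then #|A|%:R else 0.
Proof.
case: ifPn => [/forall_inP Az|Az].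
  by rewrite (eq_bigr (fun=> 1)) ?sumr_const// => u /Az/eqP ->; rewrite psi0.
have [w wA psi_w] : exists2 w, w \in A & psi (am_form w z) != 1.
  apply: not_forall_in => psi1; case/negP: Az; apply/forall_inP => u uA.
  by apply/eqP; apply: psi_form_eq1 uA => w /psi1/eqP.
set s := \sum_(_ in _) _; have : psi (am_form w z) * s = 1 * s.
  rewrite mul1r {2}/s (reindex_inj (addrI w)) mulr_sumr /=; apply: eq_big => [x|x _].
    by rewrite submod_addl.
  by rewrite formDl psiD.
by apply: contra_eq => s0; rewrite (inj_eq (mulIf s0)).
Qed.

End CharacterSums.

Lemma sum_psi_form_full (C : fieldType) (F : finComUnitRingType) (psi : F -> C)
    (V : altMod F) (y : V) :
  primitive_char psi -> nondegenerate V ->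
  \sum_(x : V) psi (am_form x y) = if y == 0 then #|V|%:R else 0.
Proof.
move=> psi_prim nondegV.
have V_sub : submod_closed [set: V]%SET by split=> [|a x z _ _]; exact: finset.in_setT.
have := sum_psi_form psi_prim V_sub y; rewrite cardsT.
rewrite (eq_bigl xpredT) => [|x]; last exact: finset.in_setT.
move=> ->; congr (if _ then _ else _); apply/forall_inP/eqP => [Vy|-> x _].
  by apply: nondegV => x; apply/eqP; exact: Vy.
by rewrite form0r.
Qed.

Section WeilActions.
Variables (C : numClosedFieldType) (F : finComUnitRingType) (psi : F -> C).
Variables (V : altMod F) (gT : finGroupType) (gamma : gT -> Sp V).
Variable S : weilRep C V gT.

(* A Weil representation, without the irreducibility and unitarity of the action of H(V). *)
Definition weil_action : Prop :=
  [/\ is_repn (heis_repn S),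
      forall t v, wr_space S v -> wr_heis S (0, t) v = psi t *: v,
      is_repn (grp_repn S)
    & forall g h v, wr_space S v ->
        wr_grp S g (wr_heis S h (wr_grp S g^-1%g v)) =
        wr_heis S (sp_heis (gamma g) h) v].

Lemma is_weil_action : is_weil psi gamma S -> weil_action.
Proof. by case=> -[[]]. Qed.

Hypothesis S_weil : weil_action.
Local Notation E := (wr_space S).
Local Notation rho := (wr_heis S).
Local Notation sg := (wr_grp S).

Lemma weil_heis_repn : is_repn (heis_repn S). Proof. by case: S_weil. Qed.
Lemma weil_grp_repn : is_repn (grp_repn S). Proof. by case: S_weil. Qed.
Lemma weil_subspace : subspace E. Proof. exact: repn_subspace weil_heis_repn. Qed.

Lemma weil_space0 : E 0. Proof. exact: (subspace0 weil_subspace). Qed.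
Lemma weil_spaceZ a v : E v -> E (a *: v). Proof. exact: (subspaceZ weil_subspace). Qed.
Lemma weil_spaceD u v : E u -> E v -> E (u + v). Proof. exact: (subspaceD weil_subspace). Qed.
Lemma weil_space_sum (I : finType) (P : pred I) (u : I -> wr_sort S) :
  (forall i, P i -> E (u i)) -> E (\sum_(i | P i) u i).
Proof. exact: (subspace_sum weil_subspace). Qed.

Lemma heis_in h v : E v -> E (rho h v). Proof. exact: (repn_in weil_heis_repn). Qed.
Lemma heis_linear h : linear_on E (rho h). Proof. exact: (repn_linear weil_heis_repn). Qed.
Lemma heisM h k v : E v -> rho h (rho k v) = rho (h * k)%g v.
Proof. by move=> Ev; rewrite [RHS](repnM weil_heis_repn). Qed.
Lemma heisZ h a v : E v -> rho h (a *: v) = a *: rho h v.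
Proof. exact: (linear_onZ weil_subspace (heis_linear h)). Qed.
Lemma heis_eq0 h : rho h 0 = 0.
Proof. exact: (linear_on0 weil_subspace (heis_linear h)). Qed.
Lemma heis_sum h (I : finType) (P : pred I) (u : I -> wr_sort S) :
  (forall i, P i -> E (u i)) -> rho h (\sum_(i | P i) u i) = \sum_(i | P i) rho h (u i).
Proof. exact: (linear_on_sum weil_subspace (heis_linear h)). Qed.

Lemma grp_in g v : E v -> E (sg g v). Proof. exact: (repn_in weil_grp_repn). Qed.
Lemma grp_linear g : linear_on E (sg g). Proof. exact: (repn_linear weil_grp_repn). Qed.
Lemma grp1 v : E v -> sg 1%g v = v. Proof. exact: (repn1 weil_grp_repn). Qed.
Lemma grpM g h v : E v -> sg g (sg h v) = sg (g * h)%g v.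
Proof. by move=> Ev; rewrite [RHS](repnM weil_grp_repn). Qed.
Lemma grpKV g v : E v -> sg g (sg g^-1%g v) = v.
Proof. by move=> Ev; rewrite grpM// mulgV grp1. Qed.
Lemma grpK g v : E v -> sg g^-1%g (sg g v) = v.
Proof. by move=> Ev; rewrite grpM// mulVg grp1. Qed.
Lemma grpZ g a v : E v -> sg g (a *: v) = a *: sg g v.
Proof. exact: (linear_onZ weil_subspace (grp_linear g)). Qed.
Lemma grp_eq0 g : sg g 0 = 0.
Proof. exact: (linear_on0 weil_subspace (grp_linear g)). Qed.
Lemma grp_sum g (I : finType) (P : pred I) (u : I -> wr_sort S) :
  (forall i, P i -> E (u i)) -> sg g (\sum_(i | P i) u i) = \sum_(i | P i) sg g (u i).
Proof. exact: (linear_on_sum weil_subspace (grp_linear g)). Qed.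

Lemma heis_center t v : E v -> rho (0, t) v = psi t *: v.
Proof. by case: S_weil => _ h _ _; exact: h. Qed.
Lemma heisE w t v : E v -> rho (w, t) v = psi t *: rho (w, 0) v.
Proof.
move=> Ev; rewrite -heis_center ?heisM//; last exact: heis_in.
by congr (rho _ v); rewrite heis_mulE /= form0l mulr0 !add0r !addr0.
Qed.
Lemma heisD x y t s v : E v ->
  rho (x, t) (rho (y, s) v) = psi (t + s + 2%:R^-1 * am_form x y) *: rho (x + y, 0) v.
Proof. by move=> Ev; rewrite heisM// heis_mulE /= heisE. Qed.

Lemma grp_heis g x t v : E v -> sg g (rho (x, t) v) = rho (gamma g x, t) (sg g v).
Proof.
case: S_weil => _ _ _ covariance Ev; rewrite -{1}[v](grpK g)//.
by rewrite covariance//; exact: grp_in.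
Qed.

Hypothesis psi_prim : primitive_char psi.

Lemma heis1 v : E v -> rho (0, 0) v = v.
Proof. by move=> Ev; rewrite heis_center// psi0// scale1r. Qed.

Lemma heis_oppK x v : E v -> rho (- x, 0) (rho (x, 0) v) = v.
Proof.
move=> Ev; rewrite heisD// addNr formNl am_alt oppr0 mulr0 !addr0.
by rewrite heis1// psi0// scale1r.
Qed.

Hypothesis two_unit : (2%:R : F) \is a GRing.unit.

Lemma heis_comm y s z t v : E v ->
  rho (y, s) (rho (z, t) v) = psi (am_form y z) *: rho (z, t) (rho (y, s) v).
Proof.
move=> Ev; rewrite !heisD// scalerA -psiD// [z + y]addrC.
congr (psi _ *: _); rewrite [am_form z y]formC.
by rewrite -[X in _ = X + _](halfD _ two_unit); ring.
Qed.

Lemma heis_conj x h v : E v ->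
  rho (- x, 0) (rho h^-1%g (rho (x, 0) v)) = psi (am_form x h.1) *: rho h^-1%g v.
Proof.
move=> Ev; rewrite heis_invE heis_comm; last exact: heis_in.
by rewrite heis_oppK// formNl formNr opprK.
Qed.

End WeilActions.

#[local] Hint Extern 0 (wr_space _ (wr_heis _ _ _)) =>
  (eapply heis_in; [eassumption | trivial]) : core.
#[local] Hint Extern 0 (wr_space _ (wr_grp _ _ _)) =>
  (eapply grp_in; [eassumption | trivial]) : core.
#[local] Hint Extern 0 (wr_space _ (@GRing.zero _)) =>
  (eapply weil_space0; eassumption) : core.
#[local] Hint Extern 0 (wr_space _ (_ *: _)) =>
  (eapply weil_spaceZ; [eassumption | trivial]) : core.
#[local] Hint Extern 0 (wr_space _ (_ + _)) =>
  (eapply weil_spaceD; [eassumption | trivial | trivial]) : core.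
#[local] Hint Extern 0 (wr_space _ (\sum_(_ <- _ | _) _)) =>
  (eapply weil_space_sum; [eassumption | trivial]) : core.

Section Commutant.
Variables (C : numClosedFieldType) (F : finComUnitRingType) (psi : F -> C).
Hypothesis psi_prim : primitive_char psi.
Variables (V : altMod F) (gT : finGroupType) (gamma : gT -> Sp V).
Hypotheses (two_unit : (2%:R : F) \is a GRing.unit) (nondegV : nondegenerate V).
Variable S : weilRep C V gT.
Hypotheses (S_weil : weil_action psi gamma S) (S_irr : irreducible (heis_repn S)).
Local Notation E := (wr_space S).
Local Notation rho := (wr_heis S).
Local Notation sg := (wr_grp S).

Section Coefficients.
Variable T : wr_sort S -> wr_sort S.
Hypothesis T_int : @intertwiner _ _ (grp_repn S) (grp_repn S) T.

Let T_in v : E v -> E (T v). Proof. by case: T_int => _ h _; exact: h. Qed.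
Local Hint Extern 0 (wr_space S (T _)) => (apply: T_in; trivial) : core.
Let T_linear : linear_on E T. Proof. by case: T_int. Qed.
Let T_sg g v : E v -> T (sg g v) = sg g (T v). Proof. by case: T_int => _ _ h; exact: h. Qed.

(* A multiple of the coefficient of rho(x) in T. *)
Definition coef_op (x : V) : wr_sort S -> wr_sort S :=
  @conj_sum _ _ (heis_repn S) (heis_repn S) (fun v => T (rho (- x, 0) v)).

Lemma coef_op_scalar x : exists a, forall v, E v -> coef_op x v = a *: v.
Proof.
have heisS := weil_heis_repn S_weil.
apply: (@schur _ _ (heis_repn S)) => //; apply: conj_sum_intertwiner => //.
  by move=> a u v Eu Ev; rewrite (heis_linear S_weil)// T_linear.
by move=> v Ev; apply/T_in.
Qed.

Lemma coef_op_equivariant g x v :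
  E v -> coef_op (gamma g x) v = sg g (coef_op x (sg g^-1%g v)).
Proof.
move=> Ev; rewrite /coef_op /conj_sum /= (grp_sum S_weil)//.
rewrite (reindex_inj (@sp_heis_inj F V (gamma g))); apply: eq_bigr => -[y t] _ /=.
rewrite (grp_heis S_weil)// -T_sg// !(grp_heis S_weil)// (grpKV S_weil)//.
by rewrite !heis_invE /= !spN.
Qed.

Definition coef_norm : C := #|V|%:R * #|[pred h : heis V | h.1 == 0]|%:R.

Lemma sum_coef_op v : E v -> \sum_x coef_op x (rho (x, 0) v) = coef_norm *: T v.
Proof.
move=> Ev; have T_Z := linear_onZ (weil_subspace S_weil) T_linear.
have sum_x h : \sum_x rho h (T (rho (- x, 0) (rho h^-1%g (rho (x, 0) v)))) =
    (if h.1 == 0 then #|V|%:R else 0) *: rho h (T (rho h^-1%g v)).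
  rewrite -(sum_psi_form_full _ psi_prim nondegV) scaler_suml; apply: eq_bigr => x _.
  by rewrite (heis_conj S_weil)// T_Z// (heisZ S_weil).
rewrite /coef_op /conj_sum exchange_big /= (eq_bigr _ (fun h _ => sum_x h)).
rewrite (bigID (fun h : heis V => h.1 == 0)) /=.
rewrite [X in _ + X]big1 ?addr0 => [|h /negPf->]; last by rewrite scale0r.
rewrite (eq_bigr (fun=> #|V|%:R *: T v)) => [|[y t] /= /eqP->].
  by rewrite sumr_const -scaler_nat scalerA mulrC.
rewrite eqxx heis_invE /= oppr0; congr (_ *: _).
by rewrite !(heis_center S_weil)// T_Z// scalerA psi_mulN// scale1r.
Qed.

End Coefficients.

Lemma commutant_dim_orbits (J : finType) (o : V -> J) :
  (forall x y, o x = o y -> exists g, gamma g x = y) ->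
  commutant_dim_le (grp_repn S) #|J|.
Proof.
move=> o_orbit; exists J, (fun j v => \sum_(x | o x == j) rho (x, 0) v).
split=> // T T_int; have /choice[a coefE] := coef_op_scalar T_int.
have [_ S_neq0 _] := S_irr.
have [w Ew w0] := subspace_neq0P (weil_subspace S_weil) S_neq0.
have aG g x : a (gamma g x) = a x.
  apply: (scalev_inj w0); rewrite -coefE// coef_op_equivariant// coefE//.
  by rewrite (grpZ S_weil)// (grpKV S_weil).
have norm0 : coef_norm != 0.
  by rewrite mulf_neq0// cardr_neq0//; [exists 0|exists 1%g; rewrite inE].
pose c j := if [pick x | o x == j] is Some x then a x else 0.
have cE x : c (o x) = a x.
  rewrite /c; case: pickP => [y /eqP/o_orbit[g <-]|/(_ x)]; last by rewrite eqxx.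
  by rewrite aG.
exists (fun j => coef_norm^-1 * c j) => v Ev.
rewrite -[LHS](scalerK norm0) -(sum_coef_op T_int)//.
under [RHS]eq_bigr do rewrite -scalerA.
rewrite -scaler_sumr; congr (_ *: _).
rewrite (partition_big o predT)//=; apply: eq_bigr => j _; rewrite scaler_sumr.
by apply: eq_bigr => x /eqP <-; rewrite coefE ?cE.
Qed.

End Commutant.

(** * The model S^{U,sigma} *)

Section WeilIso.
Variables (C : numClosedFieldType) (F : finComUnitRingType) (psi : F -> C).
Variables (V : altMod F) (gT : finGroupType) (gamma : gT -> Sp V).
Implicit Types S : weilRep C V gT.

Lemma weil_bij_iso S1 S2 (f : wr_sort S1 -> wr_sort S2) : weil_action psi gamma S1 ->
  linear_on (wr_space S1) f ->
  (forall v, wr_space S1 v -> wr_space S2 (f v)) ->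
  (forall w, wr_space S2 w -> exists2 v, wr_space S1 v & f v = w) ->
  (forall v, wr_space S1 v -> f v = 0 -> v = 0) ->
  (forall h v, wr_space S1 v -> f (wr_heis S1 h v) = wr_heis S2 h (f v)) ->
  (forall g v, wr_space S1 v -> f (wr_grp S1 g v) = wr_grp S2 g (f v)) ->
  weil_iso S1 S2.
Proof.
move=> S1_weil f_lin f_in f_onto f_ker f_heis f_grp.
have [h [h_img h_inj hE]] :=
  linear_on_bijection (weil_subspace S1_weil) f_lin f_in f_onto f_ker.
by exists h; split=> // [k v Ev|g v Ev]; rewrite !hE ?f_heis ?f_grp.
Qed.

Lemma weil_iso_trans S1 S2 S3 : weil_iso S1 S2 -> weil_iso S2 S3 -> weil_iso S1 S3.
Proof.
move=> [f [f_img f_inj f_heis f_grp]] [h [h_img h_inj h_heis h_grp]].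
have f_in v : wr_space S1 v -> wr_space S2 (f v) by move=> Ev; rewrite -f_img; exists v.
have [hf_img hf_inj] := comp_bijection f_img f_inj h_img h_inj.
exists (h \o f)%VF; split=> // k v Ev; rewrite !lfunE /=.
  by rewrite f_heis// h_heis//; exact: f_in.
by rewrite f_grp// h_grp//; exact: f_in.
Qed.

Lemma weil_iso_heis S1 S2 : weil_iso S1 S2 -> repn_iso (heis_repn S1) (heis_repn S2).
Proof. by case=> f [f_img f_inj f_heis _]; exists f. Qed.

End WeilIso.

Section InvariantIsotropic.
Variables (F : finComUnitRingType) (V : altMod F) (U : invIso V).
Implicit Types (g : Sp V) (x y u w : V) (c : ubar U).

Lemma form_ii_perp u w : u \in ii_set U -> w \in perp U -> am_form u w = 0.
Proof. by move=> uU /perpP wP; rewrite formC wP ?oppr0. Qed.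

Lemma form_perp_ii u w : u \in ii_set U -> w \in perp U -> am_form w u = 0.
Proof. by move=> uU /perpP; apply. Qed.

Lemma perpPn x : x \notin perp U -> ~~ [forall u in ii_set U, am_form u x == 0].
Proof.
apply: contra => /forall_inP xU; apply/perpP => u uU.
by rewrite formC (eqP (xU u uU)) oppr0.
Qed.

Lemma ii_sub_perp u : u \in ii_set U -> u \in perp U.
Proof. by move=> uU; apply/perpP => y yU; exact: (ii_isotropic uU yU). Qed.

Lemma ii0 : 0 \in ii_set U. Proof. by case: (ii_submod U). Qed.

Lemma mem_sp_ii g u : (g u \in ii_set U) = (u \in ii_set U).
Proof.
by apply/idP/idP => [gu|/(ii_inv g)//]; rewrite -(sp_invK g u); exact: (ii_inv g^-1%g).
Qed.

Lemma mem_sp_perp g x : (g x \in perp U) = (x \in perp U).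
Proof. by apply/idP/idP => [gx|/sp_perp//]; rewrite -(sp_invK g x); exact: sp_perp. Qed.

Lemma ubar_reprP c : ubar_repr c \in perp U. Proof. exact: sq_reprP. Qed.
Lemma ubar_reprK c : ubar_pi U (ubar_repr c) = c. Proof. exact: sq_reprK. Qed.
Lemma ubar_pi0 : ubar_pi U 0 = 0. Proof. exact: sq_pi0. Qed.
Lemma ubar_pi_eq0 x : x \in perp U -> (ubar_pi U x == 0) = (x \in ii_set U).
Proof. by move=> xP; rewrite -ubar_pi0 sq_eqE ?rpred0// subr0. Qed.
Lemma form_ubar_pi x y : x \in perp U -> y \in perp U ->
  am_form (ubar_pi U x : ubar U) (ubar_pi U y) = am_form x y.
Proof. exact: ubar_form_pi. Qed.
Lemma rU_ubar_pi g x : x \in perp U -> rU U g (ubar_pi U x) = ubar_pi U (g x).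
Proof. by move=> xP; rewrite permE; exact: rU_pi. Qed.

End InvariantIsotropic.

Section Model.
Variables (C : numClosedFieldType) (F : finComUnitRingType) (psi : F -> C).
Hypothesis psi_prim : primitive_char psi.
Variables (V : altMod F) (U : invIso V).
Hypothesis two_unit : (2%:R : F) \is a GRing.unit.
Variable sigma : weilRep C (ubar U) (Sp V).
Hypothesis sigma_weil : weil_action psi (rU U) sigma.
Local Notation E := (wr_space sigma).
Local Notation rho := (wr_heis sigma).
Local Notation sg := (wr_grp sigma).
Local Notation model := (weil_model psi sigma).
Local Notation M := (wr_space model).

Lemma model_at phi x : M phi -> E (phi x). Proof. by case. Qed.
Local Hint Extern 0 (wr_space sigma _) => (apply: model_at; assumption) : core.

Lemma model_translate phi x w : M phi -> w \in perp U ->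
  phi (x + w) = psi (2%:R^-1 * am_form x w) *: rho (ubar_pi U w, 0) (phi x).
Proof. by case=> _; exact. Qed.

Lemma model_heis_repn : is_repn (heis_repn model).
Proof.
split.
- split=> [|a phi chi phiM chiM].
    by split=> [x|x w wP]; rewrite !ffunE// /rho_perp (heis_eq0 sigma_weil) scaler0.
  split=> [x|x w wP]; rewrite !ffunE; first by apply: (weil_subspace sigma_weil).2.
  rewrite !model_translate// /rho_perp (heis_linear sigma_weil)//.
  by rewrite scalerDr scaleCA.
- move=> [y t] phi phiM; split=> [x|x w wP]; rewrite !ffunE//= addrAC.
  rewrite model_translate// /rho_perp (heisZ sigma_weil)// !scalerA -!psiD//.
  congr (psi _ *: _); rewrite !formDl [am_form w y]formC; ring.
- by move=> h a phi chi _ _; apply/ffunP => x; rewrite !ffunE scalerDr scaleCA.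
- by move=> phi _; apply/ffunP => x; rewrite ffunE /= form0r mulr0 !addr0 psi0// scale1r.
- move=> [y t] [z s] phi _; apply/ffunP => x; rewrite !ffunE /= scalerA -psiD// addrA.
  by congr (psi _ *: _); rewrite formDr formDl; ring.
Qed.

Lemma model_grp_repn : is_repn (grp_repn model).
Proof.
split.
- exact: (repn_subspace model_heis_repn).
- move=> g phi phiM; split=> [x|x w wP]; rewrite !ffunE//.
  rewrite spD model_translate ?mem_sp_perp// (grpZ sigma_weil)//.
  by rewrite (grp_heis sigma_weil)// rU_ubar_pi ?mem_sp_perp// sp_invKV sp_form.
- by move=> g a phi chi phiM chiM; apply/ffunP => x; rewrite !ffunE (grp_linear sigma_weil).
- by move=> phi phiM; apply/ffunP => x; rewrite ffunE (grp1 sigma_weil)// invg1 sp_oneE.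
- move=> g h phi phiM; apply/ffunP => x.
  by rewrite !ffunE (grpM sigma_weil)// invMg sp_mulE.
Qed.

Lemma weil_model_action : weil_action psi id model.
Proof.
split; [exact: model_heis_repn| |exact: model_grp_repn|].
  move=> t phi _; apply/ffunP => x.
  by rewrite !ffunE /= form0r mulr0 !addr0.
move=> g [y t] phi phiM; apply/ffunP => x; rewrite !ffunE /= (grpZ sigma_weil)//.
rewrite (grpKV sigma_weil)// invgK spD sp_invKV; congr (psi (_ + _ * _) *: _).
by rewrite -(sp_form g) sp_invKV.
Qed.

Definition extend0 (e : wr_sort sigma) : {ffun V -> wr_sort sigma} :=
  [ffun x => if x \in perp U then rho (ubar_pi U x, 0) e else 0].

Lemma extend0_in e : E e -> M (extend0 e).
Proof.
move=> Ee; split=> [x|x w wP]; rewrite !ffunE; first by case: ifP.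
rewrite /rho_perp rpredDr//; case: ifP => xP; last by rewrite (heis_eq0 sigma_weil) scaler0.
rewrite (heisD sigma_weil)// ubar_piD// scalerA -psiD// [ubar_pi U w + _]addrC.
rewrite form_ubar_pi// [am_form w x]formC.
by rewrite mulrN !add0r subrr psi0// scale1r.
Qed.

Lemma extend0_at0 e : E e -> extend0 e 0 = e.
Proof. by move=> Ee; rewrite ffunE rpred0 ubar_pi0 (heis1 sigma_weil). Qed.

Lemma model_at_perp phi w : M phi -> w \in perp U -> phi w = rho (ubar_pi U w, 0) (phi 0).
Proof.
by move=> phiM wP; rewrite -[w in LHS]add0r model_translate// form0l mulr0 psi0// scale1r.
Qed.

Lemma model_heis_ii u phi x : M phi -> u \in ii_set U ->
  wr_heis model (u, 0) phi x = psi (am_form x u) *: phi x.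
Proof.
move=> phiM uU; have uP := ii_sub_perp uU; rewrite ffunE /= model_translate//.
have /eqP -> : ubar_pi U u == 0 by rewrite ubar_pi_eq0.
by rewrite (heis1 sigma_weil)// scalerA -psiD// add0r halfD.
Qed.

End Model.

(** * Vectors fixed by U *)

Section FixedVectors.
Variables (C : numClosedFieldType) (F : finComUnitRingType) (psi : F -> C).
Variables (V : altMod F) (U : invIso V).

Definition fixed_rep (S : weilRep C V (Sp V)) : weilRep C (ubar U) (Sp V) :=
  @WeilRep C F (ubar U) (Sp V) (wr_sort S)
    [set v | wr_space S v /\ {in ii_set U, forall u, wr_heis S (u, 0) v = v}]%classic
    (fun h => wr_heis S (ubar_repr h.1, h.2)) (wr_grp S).

Lemma fixed_rep_iso S1 S2 : weil_action psi id S1 ->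
  weil_iso S1 S2 -> weil_iso (fixed_rep S1) (fixed_rep S2).
Proof.
move=> S1_weil [f [f_img f_inj f_heis f_grp]]; exists f; split.
- apply/seteqP; split=> [_ [v [Ev vU] <-]|w [Ew wU]].
    split=> [|u uU]; last by rewrite -f_heis// vU.
    by rewrite -f_img; exists v.
  move: Ew; rewrite -f_img => -[v Ev fv]; exists v => //; split=> // u uU.
  by apply: f_inj; rewrite ?inE//= f_heis// fv wU.
- by move=> u v; rewrite !inE => -[Eu _] [Ev _]; apply: f_inj; rewrite inE.
- by move=> h v [Ev _]; exact: f_heis.
- by move=> g v [Ev _]; exact: f_grp.
Qed.

Hypotheses (psi_prim : primitive_char psi) (two_unit : (2%:R : F) \is a GRing.unit).

Section Action.
Variable S : weilRep C V (Sp V).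
Hypothesis S_weil : weil_action psi id S.
Local Notation E := (wr_space S).
Local Notation rho := (wr_heis S).
Local Notation sg := (wr_grp S).
Local Notation Fx := (wr_space (fixed_rep S)).

Lemma fixed_sub v : Fx v -> E v. Proof. by case. Qed.
Local Hint Extern 0 (wr_space S _) => (apply: fixed_sub; assumption) : core.

Lemma fixed_ii v u : Fx v -> u \in ii_set U -> rho (u, 0) v = v.
Proof. by case=> _; exact. Qed.

Lemma fixed_subspace : subspace Fx.
Proof.
split=> [|a u v [Eu uU] [Ev vU]]; split=> //.
- by move=> u _; rewrite (heis_eq0 S_weil).
- by move=> x xU; rewrite (heis_linear S_weil)// uU// vU.
Qed.

Lemma fixed_heis w t v : w \in perp U -> Fx v -> Fx (rho (w, t) v).
Proof.
move=> wP Fv; split=> // u uU.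
by rewrite (heis_comm S_weil)// (form_ii_perp uU wP) psi0// scale1r fixed_ii.
Qed.

Lemma fixed_grp g v : Fx v -> Fx (sg g v).
Proof.
move=> Fv; split=> // u uU; rewrite -[u](sp_invKV g).
by rewrite -(grp_heis S_weil)// fixed_ii// mem_sp_ii.
Qed.

Lemma heis_repr_pi w t v : w \in perp U -> Fx v ->
  rho (ubar_repr (ubar_pi U w), t) v = rho (w, t) v.
Proof.
move=> wP Fv; set x := ubar_repr _.
have xwU : x - w \in ii_set U by exact: sq_repr_pi.
rewrite -[x in LHS](subrKC w) (heisE S_weil)// (heisE S_weil w)//; congr (_ *: _).
rewrite -[v in RHS](fixed_ii Fv xwU) (heisD S_weil)//.
by rewrite (form_perp_ii xwU wP) mulr0 !addr0 psi0// scale1r.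
Qed.

Lemma fixed_weil_action : weil_action psi (rU U) (fixed_rep S).
Proof.
split.
- split=> [||h a u v Fu Fv|v Fv|[c t] [d s] v Fv] /=.
  + exact: fixed_subspace.
  + by move=> h v Fv; apply: fixed_heis => //; exact: ubar_reprP.
  + by rewrite (heis_linear S_weil).
  + by rewrite -ubar_pi0 heis_repr_pi ?rpred0// (heis1 S_weil).
  + rewrite (heisM S_weil)// heis_mulE /= -{1}(ubar_reprK c) -{1}(ubar_reprK d).
    by rewrite -ubar_piD ?ubar_reprP// heis_repr_pi ?rpredD ?ubar_reprP.
- by move=> t v Fv; rewrite /= -ubar_pi0 heis_repr_pi ?rpred0// (heis_center S_weil).
- split=> [||g a u v Fu Fv|v Fv|g h v Fv] /=.
  + exact: fixed_subspace.
  + exact: fixed_grp.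
  + by rewrite (grp_linear S_weil).
  + by rewrite (grp1 S_weil).
  + by rewrite (grpM S_weil).
- move=> g [c t] v Fv; rewrite /= (grp_heis S_weil)// (grpKV S_weil)//.
  by rewrite permE /rU_fun heis_repr_pi// mem_sp_perp ubar_reprP.
Qed.

Definition ii_avg (v : wr_sort S) : wr_sort S :=
  #|ii_set U|%:R^-1 *: \sum_(u in ii_set U) rho (u, 0) v.

Let ii_neq0 : exists u, u \in ii_set U. Proof. by exists 0; exact: ii0. Qed.

Lemma ii_avg_linear : linear_on E ii_avg.
Proof.
move=> a u v Eu Ev; rewrite /ii_avg scaleCA -scalerDr; congr (_ *: _).
by rewrite scaler_sumr -big_split; apply: eq_bigr => x _; rewrite (heis_linear S_weil).
Qed.

Let ii_avgZ a v : E v -> ii_avg (a *: v) = a *: ii_avg v.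
Proof. exact: (linear_onZ (weil_subspace S_weil) ii_avg_linear). Qed.

Lemma ii_avg_fixed v : E v -> Fx (ii_avg v).
Proof.
move=> Ev; split=> [|x xU]; first by apply: (weil_spaceZ S_weil).
rewrite (heisZ S_weil)//; congr (_ *: _); rewrite (heis_sum S_weil)//.
rewrite [RHS](reindex_inj (addrI x)) /=; apply: eq_big => [u|u uU].
  by rewrite submod_addl//; exact: ii_submod.
by rewrite (heisD S_weil)// (ii_isotropic xU uU) mulr0 !addr0 psi0// scale1r.
Qed.

Lemma ii_avg_id v : Fx v -> ii_avg v = v.
Proof. by move=> Fv; apply: avg_const => // u; exact: fixed_ii. Qed.

Lemma ii_avg_heis z t v : Fx v ->
  ii_avg (rho (z, t) v) = if z \in perp U then rho (z, t) v else 0.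
Proof.
move=> Fv; case: ifPn => zP; first by apply/ii_avg_id/fixed_heis.
rewrite /ii_avg (eq_bigr (fun u => psi (am_form u z) *: rho (z, t) v)) => [|u uU].
  rewrite -scaler_suml (sum_psi_form psi_prim (ii_submod U)).
  by rewrite (negPf (perpPn zP)) scale0r scaler0.
by rewrite (heis_comm S_weil)// fixed_ii.
Qed.

Lemma ii_avg_perp w t v : w \in perp U -> E v ->
  ii_avg (rho (w, t) v) = rho (w, t) (ii_avg v).
Proof.
move=> wP Ev; rewrite /ii_avg (heisZ S_weil)// (heis_sum S_weil)//; congr (_ *: _).
by apply: eq_bigr => u uU; rewrite (heis_comm S_weil)// (form_ii_perp uU wP) psi0// scale1r.
Qed.

Lemma ii_avg_grp g v : E v -> ii_avg (sg g v) = sg g (ii_avg v).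
Proof.
move=> Ev; rewrite /ii_avg (grpZ S_weil)// (grp_sum S_weil)//; congr (_ *: _).
rewrite (reindex_inj (@sp_inj _ _ g)) /=; apply: eq_big => [u|u uU]; first exact: mem_sp_ii.
by rewrite (grp_heis S_weil).
Qed.

Definition to_model (v : wr_sort S) : {ffun V -> wr_sort S} :=
  [ffun x => ii_avg (rho (x, 0) v)].
Local Notation model := (weil_model psi (fixed_rep S)).

Lemma to_model_in v : E v -> wr_space model (to_model v).
Proof.
move=> Ev; split=> [x|x w wP]; rewrite !ffunE; first exact: ii_avg_fixed.
rewrite /rho_perp /= heis_repr_pi//; last exact: ii_avg_fixed.
rewrite -ii_avg_perp// (heisD S_weil)// [w + x]addrC ii_avgZ// scalerA -psiD//.
by rewrite [am_form w x]formC mulrN !add0r subrr psi0// scale1r.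
Qed.

Lemma to_model_heis h v : E v -> to_model (rho h v) = wr_heis model h (to_model v).
Proof.
by case: h => y t Ev; apply/ffunP => x; rewrite !ffunE /= (heisD S_weil)// ii_avgZ ?add0r.
Qed.

Lemma to_model_grp g v : E v -> to_model (sg g v) = wr_grp model g (to_model v).
Proof.
move=> Ev; apply/ffunP => x; rewrite !ffunE /= -ii_avg_grp//.
by rewrite (grp_heis S_weil)// sp_invKV.
Qed.

Lemma ii_avg_model phi x y : wr_space model phi ->
  ii_avg (rho (y, 0) (rho (- x, 0) (phi x))) = if y - x \in perp U then phi y else 0.
Proof.
move=> phiM; have phix := model_at x phiM.
rewrite (heisD S_weil)// ii_avgZ// ii_avg_heis//; case: ifP => yxP; last by rewrite scaler0.
rewrite -[y in RHS](subrKC x) (model_translate _ phiM)// /= heis_repr_pi//; congr (psi _ *: _).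
by rewrite formBr formNr am_alt [am_form y x]formC opprK subr0 !add0r.
Qed.

Lemma to_model_surj phi : wr_space model phi -> exists2 v, E v & to_model v = phi.
Proof.
move=> phiM; have phi_in x : E (phi x) by have /fixed_sub := model_at x phiM.
exists (#|perp U|%:R^-1 *: \sum_x rho (- x, 0) (phi x)); first by apply: (weil_spaceZ S_weil).
apply/ffunP => y; rewrite ffunE (heisZ S_weil)// (heis_sum S_weil)// ii_avgZ//.
rewrite (linear_on_sum (weil_subspace S_weil) ii_avg_linear)//.
under eq_bigr do rewrite ii_avg_model//.
rewrite -big_mkcond /= (reindex_inj (can_inj (subKr y))) /=.
under eq_bigl do rewrite subKr.
by apply: avg_const => [|//]; exists 0; exact: rpred0.
Qed.

Hypothesis nondegV : nondegenerate V.

Lemma sum_conj_ii_avg v : E v ->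
  \sum_(x : V) rho (- x, 0) (ii_avg (rho (x, 0) v)) = (#|ii_set U|%:R^-1 * #|V|%:R) *: v.
Proof.
move=> Ev; rewrite -scalerA -[RHS]/(_ *: _).
have conj_u (u x : V) :
    rho (- x, 0) (rho (u, 0) (rho (x, 0) v)) = psi (am_form x (- u)) *: rho (u, 0) v.
  rewrite [rho (u, 0) _](heis_comm S_weil)// (heisZ S_weil)// (heis_oppK S_weil)//.
  by rewrite formC -formNr.
transitivity (#|ii_set U|%:R^-1 *:
    \sum_(u in ii_set U) (\sum_(x : V) psi (am_form x (- u))) *: rho (u, 0) v).
  under [in RHS]eq_bigr do rewrite scaler_suml.
  rewrite exchange_big /= scaler_sumr; apply: eq_bigr => x _.
  rewrite (heisZ S_weil)// (heis_sum S_weil)//; congr (_ *: _).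
  by apply: eq_bigr => u _; rewrite conj_u.
congr (_ *: _); rewrite (bigD1 0) ?ii0//= [X in _ + X]big1 ?addr0 => [|u /andP[_ u0]].
  by rewrite oppr0 sum_psi_form_full// eqxx (heis1 S_weil).
by rewrite sum_psi_form_full// oppr_eq0 (negPf u0) scale0r.
Qed.

Lemma to_model_inj v : E v -> to_model v = 0 -> v = 0.
Proof.
move=> Ev /ffunP v0; have := sum_conj_ii_avg Ev; rewrite big1 => [/esym/eqP|x _].
  rewrite scaler_eq0 mulf_eq0 invr_eq0 (negPf (cardr_neq0 _ ii_neq0)).
  by rewrite (negPf (cardr_neq0 _ _)) => [/eqP//|]; exists 0.
by have := v0 x; rewrite !ffunE => ->; rewrite (heis_eq0 S_weil).
Qed.

Theorem fixed_model_iso : weil_iso S model.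
Proof.
apply: (weil_bij_iso (S2 := model) (f := to_model) S_weil).
- by move=> a u v Eu Ev; apply/ffunP => x; rewrite !ffunE (heis_linear S_weil)// ii_avg_linear.
- exact: to_model_in.
- exact: to_model_surj.
- exact: to_model_inj.
- exact: to_model_heis.
- exact: to_model_grp.
Qed.

Lemma fixed_irreducible :
  irreducible (heis_repn S) -> irreducible (heis_repn (fixed_rep S)).
Proof.
move=> [_ S_neq0 S_irr]; have ii_avg0 := linear_on0 (weil_subspace S_weil) ii_avg_linear.
split; first exact: weil_heis_repn fixed_weil_action.
  have [v Ev v0] := subspace_neq0P (weil_subspace S_weil) S_neq0.
  move=> Fx0; case/eqP: v0; apply: to_model_inj => //; apply/ffunP => x; rewrite !ffunE.
  by have : [set 0]%classic (ii_avg (rho (x, 0) v)) by rewrite -Fx0; exact: ii_avg_fixed.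
move=> A A_sub AF A_heis.
pose B := [set v | E v /\ forall x, A (ii_avg (rho (x, 0) v))]%classic.
have [|||B0|BE] := S_irr B.
- split=> [|a u v [Eu uA] [Ev vA]]; split=> // x.
    by rewrite (heis_eq0 S_weil) ii_avg0; exact: subspace0.
  by rewrite (heis_linear S_weil)// ii_avg_linear//; exact: A_sub.2.
- by move=> v [].
- move=> [y t] v [Ev vA]; split=> [|x] //=; rewrite (heisD S_weil)// ii_avgZ//.
  exact: subspaceZ.
- left; apply/seteqP; split=> v; last by move=> ->; exact: subspace0.
  move=> Av; have Fv := AF v Av; rewrite -B0; split=> [|x]; first by apply: fixed_sub.
  rewrite ii_avg_heis//; case: ifP => xP; last exact: subspace0.
  by have := A_heis (ubar_pi U x, 0) v Av; rewrite /= heis_repr_pi.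
- right; apply/seteqP; split=> // v Fv; have : B v by rewrite BE; apply: fixed_sub.
  by case=> Ev /(_ 0); rewrite (heis1 S_weil)// ii_avg_id.
Qed.

End Action.

Theorem fixed_is_weil (S : weilRep C V (Sp V)) :
  nondegenerate V -> is_weil psi id S -> is_weil psi (rU U) (fixed_rep S).
Proof.
move=> nondegV S_isweil; have S_weil := is_weil_action S_isweil.
have [[S_irr [f [f_lin f_conj f_pos f_inv]]] _ _ _] := S_isweil.
have [_ center grp cov] := fixed_weil_action S_weil.
split=> //; split; first exact: fixed_irreducible.
by exists f; split=> [a u v w|u v|u|h u v] => [[? _] [? _] [? _]|[? _] [? _]|[? _]|[? _] [? _]];
  [exact: f_lin|exact: f_conj|exact: f_pos|exact: f_inv].
Qed.

Section Uniqueness.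
Variable sigma : weilRep C (ubar U) (Sp V).
Hypothesis sigma_weil : weil_action psi (rU U) sigma.
Local Notation model := (weil_model psi sigma).

Lemma fixed_model_support phi x :
  wr_space (fixed_rep model) phi -> x \notin perp U -> phi x = 0.
Proof.
move=> phiF; apply: contraNeq => phix0; apply/perpP.
have phiM : wr_space model phi by apply: fixed_sub phiF.
have psi1 u : u \in ii_set U -> psi (am_form u x) = 1.
  move=> uU; have NuU : - u \in ii_set U by rewrite -[_ \in _]/(- u \in ii_pred U) rpredN.
  apply: (scalev_inj phix0); rewrite scale1r -[in RHS](fixed_ii phiF NuU).
  by rewrite (model_heis_ii psi_prim two_unit sigma_weil)// formNr -formC.
move=> u uU; rewrite formC.
by rewrite (psi_form_eq1 psi_prim (ii_submod U) psi1)// oppr0.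
Qed.

Lemma extend0_fixed e : wr_space sigma e -> wr_space (fixed_rep model) (extend0 e).
Proof.
move=> Ee; have eM := extend0_in psi_prim sigma_weil Ee; split=> // u uU; apply/ffunP => x.
rewrite (model_heis_ii psi_prim two_unit sigma_weil)// ffunE; case: ifP => [/perpP -> //|_].
  by rewrite psi0// scale1r.
by rewrite scaler0.
Qed.

Theorem model_fixed_iso : weil_iso (fixed_rep model) sigma.
Proof.
have model_weil := weil_model_action psi_prim sigma_weil.
have inM phi : wr_space (fixed_rep model) phi -> wr_space model phi by case.
pose ev0 (phi : {ffun V -> wr_sort sigma}) := phi 0.
have fixed_weil := fixed_weil_action model_weil.
apply: (weil_bij_iso (S1 := fixed_rep model) (S2 := sigma) (f := ev0) fixed_weil).
- by move=> a phi chi _ _; rewrite /ev0 !ffunE.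
- by move=> phi /inM; exact: model_at.
- move=> e Ee; exists (extend0 e); first exact: extend0_fixed.
  exact: (extend0_at0 psi_prim sigma_weil).
- rewrite /ev0 => phi phiF phi0; apply/ffunP => x; rewrite [RHS]ffunE.
  have [xP|/(fixed_model_support phiF)//] := boolP (x \in perp U).
  by rewrite (model_at_perp psi_prim (inM _ phiF))// phi0 (heis_eq0 sigma_weil).
- move=> [c t] phi /inM phiM; rewrite /ev0 ffunE /= add0r.
  rewrite (model_at_perp psi_prim phiM) ?ubar_reprP// ubar_reprK.
  by rewrite form0l mulr0 addr0 [RHS](heisE sigma_weil)//; exact: model_at phiM.
- by move=> g phi _; rewrite /ev0 ffunE sp_0.
Qed.

End Uniqueness.

End FixedVectors.

(** * The summands of S^{U,sigma} *)

Section HalfSum.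
Variables (C : numFieldType) (E : lmodType C).
Implicit Types (e : bool) (v w : E).

Definition half_sum e v w : E := 2%:R^-1 *: (v + (-1) ^+ e *: w).

Lemma two_neq0 : (2%:R : C) != 0. Proof. by rewrite pnatr_eq0. Qed.

Lemma half_sumZ a e v w : half_sum e (a *: v) (a *: w) = a *: half_sum e v w.
Proof. by rewrite /half_sum [_ *: (a *: w)]scaleCA -scalerDr scaleCA. Qed.

Lemma half_sumD e v v' w w' : half_sum e (v + v') (w + w') = half_sum e v w + half_sum e v' w'.
Proof. by rewrite /half_sum [_ *: (w + w')]scalerDr addrACA scalerDr. Qed.

Lemma half_sumC e v w : half_sum e w v = (-1) ^+ e *: half_sum e v w.
Proof. by rewrite -half_sumZ /half_sum scalerA -expr2 sqrr_sign scale1r addrC. Qed.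

Lemma half_sum_sign e e' v : half_sum e' v ((-1) ^+ e *: v) = if e == e' then v else 0.
Proof.
rewrite /half_sum scalerA -signr_addb; case: eqVneq => [->|].
  by rewrite addbb scale1r scaler_halfD// two_neq0.
by case: e e' => -[]//= _; rewrite expr1 scaleN1r subrr scaler0.
Qed.

Lemma half_sum0 e v : half_sum e v 0 = 2%:R^-1 *: v.
Proof. by rewrite /half_sum scaler0 addr0. Qed.

Lemma half_sum_eq0 e v w : half_sum e v w = 0 -> w = - (-1) ^+ e *: v.
Proof.
move/eqP; rewrite scaler_eq0 invr_eq0 (negPf two_neq0) addr_eq0 => /eqP->.
by rewrite scaleNr scalerN opprK scalerA -expr2 sqrr_sign scale1r.
Qed.

End HalfSum.

Lemma half_sum_in (C : numFieldType) (E : lmodType C) (A : set E) e v w :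
  subspace A -> A v -> A w -> A (half_sum e v w).
Proof. by move=> A_sub Av Aw; do ![apply: subspaceZ|apply: subspaceD] => //. Qed.

Lemma half_sum_linear_on (C : numFieldType) (E E' : lmodType C) (A : set E)
    (f : E -> E') e v w :
  subspace A -> linear_on A f -> A v -> A w ->
  f (half_sum e v w) = half_sum e (f v) (f w).
Proof.
move=> A_sub f_lin Av Aw; have Aew : A ((-1) ^+ e *: w) by exact: subspaceZ.
rewrite (linear_onZ A_sub f_lin); last exact: subspaceD.
by rewrite (linear_onD f_lin)// (linear_onZ A_sub f_lin).
Qed.

Section Stabilizers.
Variables (F : finComUnitRingType) (V : altMod F) (U : invIso V).
Implicit Types (x : V) (g h : Sp V).
Local Notation opp := (sp_opp V).

Lemma stabE x h : (h \in stab U x) = (h x - x \in perp U). Proof. by rewrite inE. Qed.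

Lemma group_set_stab x : group_set (stab U x).
Proof.
apply/group_setP; split=> [|g h]; rewrite !stabE; first by rewrite sp_oneE subrr rpred0.
move=> gP hP; rewrite sp_mulE -[h x](subrK x) spD -addrA rpredD//.
by rewrite mem_sp_perp.
Qed.
Canonical stab_group x := Group (group_set_stab x).

Lemma stabV x h : h \in stab U x -> h^-1%g x - x \in perp U.
Proof. by rewrite -stabE groupV. Qed.

Lemma pm_stabE x h : (h \in pm_stab U x) = (h \in stab U x) || ((opp * h)%g \in stab U x).
Proof. by rewrite inE. Qed.

Lemma group_set_pm_stab x : group_set (pm_stab U x).
Proof.
apply/group_setP; split=> [|g h]; rewrite !pm_stabE ?group1//.
move=> /orP[]gx /orP[]hx; apply/orP.
- by left; rewrite groupM.
- by right; rewrite mulgA sp_oppC -mulgA groupM.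
- by right; rewrite mulgA groupM.
- left; have := groupM gx hx.
  by rewrite mulgA -[(opp * g * opp)%g]mulgA -sp_oppC !mulgA sp_oppK mul1g.
Qed.
Canonical pm_stab_group x := Group (group_set_pm_stab x).

Lemma opp_in_pm_stab x : opp \in pm_stab U x.
Proof. by rewrite pm_stabE sp_oppK group1 orbT. Qed.

Lemma opp_notin_stab x : (2%:R : F) \is a GRing.unit -> x \notin perp U -> opp \notin stab U x.
Proof.
move=> two_unit; apply: contra; rewrite stabE sp_oppE => /(perpZ (- 2%:R^-1)).
by rewrite -opprD scaleNr scalerN opprK -mulr2n -scaler_nat scalerA mulVr ?scale1r.
Qed.

End Stabilizers.

Section Summands.
Variables (C : numClosedFieldType) (F : finComUnitRingType) (psi : F -> C).
Hypothesis psi_prim : primitive_char psi.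
Variables (V : altMod F) (U : invIso V).
Hypothesis two_unit : (2%:R : F) \is a GRing.unit.
Variable sigma : weilRep C (ubar U) (Sp V).
Hypothesis sigma_weil : weil_action psi (rU U) sigma.

Local Notation E := (wr_space sigma).
Local Notation rho := (wr_heis sigma).
Local Notation sg := (wr_grp sigma).
Local Notation model := (weil_model psi sigma).
Local Notation M := (wr_space model).
Local Notation G := (wr_grp model).
Local Notation opp := (sp_opp V).
Local Notation sgn e := ((-1) ^+ (e : bool) : C).

Let model_weil : weil_action psi id model := weil_model_action psi_prim sigma_weil.
Let E_sub : subspace E := weil_subspace sigma_weil.
Local Hint Extern 0 (wr_space sigma _) =>
  (apply: (@model_at _ _ psi); first [assumption | trivial]) : core.

Lemma sigma_dot_in x h v : E v -> E (sigma_dot x h v).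
Proof. by move=> Ev; rewrite /sigma_dot /rho_perp. Qed.

Lemma sigma_dot_linear x h : linear_on E (@sigma_dot _ _ _ _ sigma x h).
Proof.
move=> a u v Eu Ev; rewrite /sigma_dot /rho_perp (heis_linear sigma_weil)//.
by rewrite (grp_linear sigma_weil).
Qed.

Lemma sigma_dot1 x v : E v -> sigma_dot x 1%g v = v.
Proof.
move=> Ev; rewrite /sigma_dot /rho_perp invg1 sp_oneE subrr ubar_pi0 am_alt mulr0.
by rewrite (heis1 sigma_weil)// (grp1 sigma_weil).
Qed.

Lemma sigma_dot_sgn_in e x h v : E v -> E (sigma_dot_sgn e x h v).
Proof.
move=> Ev; rewrite /sigma_dot_sgn; case: ifP => _; last apply: (weil_spaceZ sigma_weil).
all: exact: sigma_dot_in.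
Qed.

Lemma sigma_dot_sgn_linear e x h : linear_on E (@sigma_dot_sgn _ _ _ _ sigma e x h).
Proof.
move=> a u v Eu Ev; rewrite /sigma_dot_sgn; case: ifP => _; rewrite sigma_dot_linear//.
by rewrite scalerDr scaleCA.
Qed.

Definition stab_equivariant x (f : {ffun Sp V -> wr_sort sigma}) : Prop :=
  (forall g, E (f g)) /\ forall h g, h \in stab U x -> f (h * g)%g = sigma_dot x h (f g).

Lemma S_dotP e x (f : {ffun Sp V -> wr_sort sigma}) : x \notin perp U ->
  rp_space (S_dot sigma e x) f <->
  stab_equivariant x f /\ forall g, f (opp * g)%g = sgn e *: f g.
Proof.
move=> xP; have opp_stab := opp_notin_stab two_unit xP; split.
  move=> [f_in fH]; have Efg g : E (f g) by exact: f_in.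
  split=> [|g]; last first.
    rewrite fH ?opp_in_pm_stab//= /sigma_dot_sgn (negPf opp_stab) sp_oppK.
    by rewrite sigma_dot1.
  split=> // h g hs; rewrite fH; first by rewrite /= /sigma_dot_sgn hs.
  by rewrite pm_stabE hs.
move=> [[f_in fH] f_opp]; split=> // h g; rewrite pm_stabE /= /sigma_dot_sgn.
case: ifP => [hs _|_ /= oh]; first exact: fH.
by rewrite -fH// -mulgA f_opp scalerA -expr2 sqrr_sign scale1r.
Qed.

Definition sign_proj (e : bool) (v : wr_sort sigma) : wr_sort sigma :=
  if ubar_trivial U then v else half_sum e v (sg opp v).

(* The same representation as [summand sigma i], with the conditional moved to
   the underlying set so that the carrier does not depend on it. *)
Definition summand_model (i : bool + V * bool) : repn C (Sp V) :=
  match i with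
  | inl e => @Repn C (Sp V) (wr_sort sigma)
     (if ubar_trivial U then E else rp_space (sigma_sgn sigma e)) sg
  | inr (x, e) => S_dot sigma e x
  end.

Lemma summandE i : summand sigma i = summand_model i.
Proof. by case: i => [e|[]//]; rewrite /summand /summand_model; case: ifP. Qed.

Definition sym_proj (e : bool) (f : {ffun Sp V -> wr_sort sigma}) :
    {ffun Sp V -> wr_sort sigma} :=
  [ffun g => half_sum e (f g) (f (opp * g)%g)].

Definition orbit_fun (x : V) (phi : {ffun V -> wr_sort sigma}) :
    {ffun Sp V -> wr_sort sigma} :=
  [ffun g => (G g phi : {ffun V -> wr_sort sigma}) x].

(* The function supported on the orbit of x + U^perp whose [orbit_fun] is f. *)
Definition unfold_orbit (x : V) (f : {ffun Sp V -> wr_sort sigma}) :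
    {ffun V -> wr_sort sigma} :=
  [ffun y => #|stab U x|%:R^-1 *: \sum_(g : Sp V | g y - x \in perp U)
     sg g^-1%g (rho (ubar_pi U (g y - x), 2%:R^-1 * am_form x (g y)) (f g))].

Definition to_summand i : {ffun V -> wr_sort sigma} -> rp_sort (summand_model i) :=
  match i with
  | inl e => fun phi => sign_proj e (phi 0)
  | inr (x, e) => fun phi => sym_proj e (orbit_fun x phi)
  end.

Definition of_summand i : rp_sort (summand_model i) -> {ffun V -> wr_sort sigma} :=
  match i with
  | inl e => fun v => @extend0 C F V U sigma v
  | inr (x, e) => unfold_orbit x
  end.

Lemma sign_proj_linear e : linear_on E (sign_proj e).
Proof.
move=> a u v Eu Ev; rewrite /sign_proj; case: ifP => _ //.
by rewrite (grp_linear sigma_weil)// half_sumD half_sumZ.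
Qed.

Lemma sign_proj_grp e g v : E v -> sign_proj e (sg g v) = sg g (sign_proj e v).
Proof.
move=> Ev; rewrite /sign_proj; case: ifP => _ //.
rewrite (half_sum_linear_on _ E_sub (grp_linear sigma_weil g))//.
by rewrite !(grpM sigma_weil)// sp_oppC.
Qed.

Lemma sign_proj_in e v : E v -> rp_space (summand_model (inl e)) (sign_proj e v).
Proof.
move=> Ev; rewrite /sign_proj /=; case: ifP => _ //=; split; first exact: half_sum_in.
rewrite (half_sum_linear_on _ E_sub (grp_linear sigma_weil opp))//.
by rewrite (grpM sigma_weil)// sp_oppK (grp1 sigma_weil)// half_sumC.
Qed.

Lemma summand_inl_sub e v : rp_space (summand_model (inl e)) v -> E v.
Proof. by rewrite /=; case: ifP => // _ []. Qed.

Lemma sign_proj_id e v : rp_space (summand_model (inl e)) v -> sign_proj e v = v.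
Proof. by rewrite /= /sign_proj; case: ifP => // _ [Ev ->]; rewrite half_sum_sign eqxx. Qed.

Lemma sign_proj_eq0 e e' v : ~~ ubar_trivial U -> e != e' ->
  rp_space (summand_model (inl e)) v -> sign_proj e' v = 0.
Proof.
by rewrite /sign_proj /= => /negPf-> /negPf ee' [_ ->]; rewrite half_sum_sign ee'.
Qed.

Lemma sigma_summand_repn e : is_repn (summand_model (inl e)).
Proof.
split.
- rewrite /=; case: ifP => _ //; split=> [|a u v [Eu hu] [Ev hv]]; split=> //.
    by rewrite (grp_eq0 sigma_weil) scaler0.
  by rewrite (grp_linear sigma_weil)// hu hv scalerDr scaleCA.
- move=> g v; rewrite /=; case: ifP => _; first exact: (grp_in sigma_weil).
  move=> [Ev hv]; split=> //.
  by rewrite (grpM sigma_weil)// sp_oppC -(grpM sigma_weil)// hv (grpZ sigma_weil).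
- by move=> g a u v /summand_inl_sub Eu /summand_inl_sub Ev; exact: (grp_linear sigma_weil).
- by move=> v /summand_inl_sub Ev; exact: (grp1 sigma_weil).
- by move=> g h v /summand_inl_sub Ev; rewrite /= (grpM sigma_weil).
Qed.

Lemma extend0_grp g v : E v -> extend0 (sg g v) = G g (extend0 v).
Proof.
move=> Ev; apply/ffunP => x; rewrite !ffunE mem_sp_perp.
case: ifP => xP; last by rewrite (grp_eq0 sigma_weil).
by rewrite (grp_heis sigma_weil)// rU_ubar_pi ?mem_sp_perp// sp_invKV.
Qed.

Lemma orbit_funE x phi g : orbit_fun x phi g = (G g phi : {ffun V -> wr_sort sigma}) x.
Proof. by rewrite [LHS]ffunE. Qed.

Section OrbitFunctions.
Variable x : V.

Lemma orbit_fun_equivariant phi : M phi -> stab_equivariant x (orbit_fun x phi).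
Proof.
move=> phiM; split=> [g|h g hs]; rewrite !orbit_funE//.
have gphiM : M (G g phi) by [].
rewrite -(grpM model_weil)// [LHS]ffunE /sigma_dot /rho_perp; congr (sg h _).
rewrite (heisE sigma_weil)// -[h^-1%g x in LHS](subrKC x) model_translate ?stabV//.
by rewrite formBr am_alt subr0.
Qed.

Lemma orbit_fun_grp k phi :
  M phi -> orbit_fun x (G k phi) = [ffun g => orbit_fun x phi (g * k)%g].
Proof.
by move=> phiM; apply/ffunP => g; rewrite [RHS]ffunE !orbit_funE (grpM model_weil).
Qed.

Lemma unfold_term_in f y g : (forall g, E (f g)) ->
  E (sg g^-1%g (rho (ubar_pi U (g y - x), 2%:R^-1 * am_form x (g y)) (f g))).
Proof. by move=> f_in; have fg := f_in g. Qed.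

Lemma unfold_orbit_in (f : {ffun Sp V -> wr_sort sigma}) :
  (forall g, E (f g)) -> M (unfold_orbit x f).
Proof.
move=> f_in; have term_in y g := unfold_term_in y g f_in.
split=> [y|y w wP]; rewrite !ffunE//.
rewrite /rho_perp (heisZ sigma_weil)// scaleCA; congr (_ *: _).
rewrite (heis_sum sigma_weil)// scaler_sumr.
have mem_gyw (g : Sp V) : (g (y + w) - x \in perp U) = (g y - x \in perp U).
  by rewrite spD addrAC rpredDr// mem_sp_perp.
apply: eq_big => // g; rewrite mem_gyw => gP.
have gwP : g w \in perp U by rewrite mem_sp_perp.
have -> : ubar_pi U w = rU U g^-1%g (ubar_pi U (g w)) by rewrite rU_ubar_pi// sp_invK.
have fg := f_in g; rewrite -(grp_heis sigma_weil)// -(grpZ sigma_weil)//; congr (sg _ _).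
rewrite (heisD sigma_weil)// scalerA -psiD// (heisE sigma_weil)// spD addrAC (ubar_piD gP gwP).
rewrite [X in rho (X, 0)]addrC form_ubar_pi//; congr (psi _ *: _).
rewrite formBr !formDr sp_form [am_form (g w) x]formC [am_form y w]formC; ring.
Qed.

Lemma unfold_orbit_linear a (f f' : {ffun Sp V -> wr_sort sigma}) :
  (forall g, E (f g)) -> (forall g, E (f' g)) ->
  unfold_orbit x (a *: f + f') = a *: unfold_orbit x f + unfold_orbit x f'.
Proof.
move=> f_in f'_in; apply/ffunP => y; rewrite !ffunE scaleCA -scalerDr; congr (_ *: _).
rewrite scaler_sumr -big_split; apply: eq_bigr => g _ /=.
have fg := f_in g; have f'g := f'_in g.
by rewrite !ffunE (heis_linear sigma_weil)// (grp_linear sigma_weil).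
Qed.

Lemma unfold_orbit_grp k (f : {ffun Sp V -> wr_sort sigma}) : (forall g, E (f g)) ->
  unfold_orbit x [ffun g => f (g * k)%g] = G k (unfold_orbit x f).
Proof.
move=> f_in; have term_in y g := unfold_term_in y g f_in.
apply/ffunP => y; rewrite !ffunE (grpZ sigma_weil)//; congr (_ *: _).
rewrite (grp_sum sigma_weil)// (reindex_inj (mulIg k^-1%g)); apply: eq_big => [g|g _].
  by rewrite sp_mulE.
have fg := f_in g; rewrite ffunE mulgKV sp_mulE (grpM sigma_weil)//.
by rewrite invMg invgK.
Qed.

Lemma unfold_orbit_out (f : {ffun Sp V -> wr_sort sigma}) y :
  (forall g : Sp V, g y - x \notin perp U) -> unfold_orbit x f y = 0.
Proof. by move=> yx; rewrite ffunE big1 ?scaler0// => g; rewrite (negPf (yx g)). Qed.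

Lemma unfold_orbit_base (f : {ffun Sp V -> wr_sort sigma}) :
  stab_equivariant x f -> unfold_orbit x f x = f 1%g.
Proof.
move=> [f_in fH]; have E1 := f_in 1%g; rewrite ffunE (eq_bigl (mem (stab U x))) => [|h]; last first.
  by rewrite -stabE.
apply: avg_const => [|h hs]; first by exists 1%g; rewrite group1.
rewrite -[h in f h]mulg1 fH// /sigma_dot /rho_perp.
have hP : h x - x \in perp U by rewrite -stabE.
have vP := stabV hs; have vP' : x - h^-1%g x \in perp U by rewrite -opprB rpredN.
have -> : ubar_pi U (h x - x) = rU U h (ubar_pi U (x - h^-1%g x)).
  by rewrite rU_ubar_pi// spD spN sp_invKV.
rewrite -(grp_heis sigma_weil)// (grpK sigma_weil)//.
rewrite (heisD sigma_weil)// form_ubar_pi// -ubar_piD//.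
rewrite addrA subrK subrr ubar_pi0 (heis1 sigma_weil)//.
rewrite -[RHS]scale1r -(psi0 psi_prim); congr (psi _ *: _).
have -> : am_form x (h x) = am_form (h^-1%g x) x by rewrite -(sp_form h^-1%g) sp_invK.
rewrite !formBl !formBr !am_alt [am_form (h^-1%g x) x]formC; ring.
Qed.

Lemma stab_equivariant_translate (f : {ffun Sp V -> wr_sort sigma}) k :
  stab_equivariant x f -> stab_equivariant x [ffun g => f (g * k)%g].
Proof.
move=> [f_in fH]; split=> [g|h g hs]; rewrite !ffunE; first exact: f_in.
by rewrite -mulgA (fH h).
Qed.

Lemma unfold_orbitK (f : {ffun Sp V -> wr_sort sigma}) :
  stab_equivariant x f -> orbit_fun x (unfold_orbit x f) = f.
Proof.
move=> f_eq; apply/ffunP => g; rewrite orbit_funE -unfold_orbit_grp; last by case: f_eq.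
rewrite unfold_orbit_base; last exact: stab_equivariant_translate.
by rewrite ffunE mul1g.
Qed.

Lemma orbit_fun_extend0 v : x \notin perp U -> orbit_fun x (extend0 v) = 0.
Proof.
move=> xP; apply/ffunP => g.
by rewrite !ffunE mem_sp_perp (negPf xP) (grp_eq0 sigma_weil).
Qed.

Lemma orbit_fun_unfold_out y (f : {ffun Sp V -> wr_sort sigma}) :
  (forall g : Sp V, g y - x \notin perp U) -> orbit_fun y (unfold_orbit x f) = 0.
Proof.
move=> yx; apply/ffunP => g; rewrite orbit_funE [LHS]ffunE unfold_orbit_out => [|k].
  by rewrite (grp_eq0 sigma_weil) ffunE.
by rewrite -sp_mulE.
Qed.

End OrbitFunctions.

Section SymProjection.
Implicit Types (e : bool) (f : {ffun Sp V -> wr_sort sigma}).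

Lemma sym_proj_S_dot e x f : x \notin perp U -> stab_equivariant x f ->
  rp_space (S_dot sigma e x) (sym_proj e f).
Proof.
move=> xP [f_in fH].
apply/S_dotP => //; split=> [|g]; last by rewrite !ffunE mulgA sp_oppK mul1g half_sumC.
split=> [g|h g hs]; rewrite !ffunE; first exact: half_sum_in.
have fg := f_in g; have f_opp := f_in (opp * g)%g.
have -> : (opp * (h * g) = h * (opp * g))%g by rewrite !mulgA sp_oppC.
by rewrite !(fH h)// (half_sum_linear_on _ E_sub (sigma_dot_linear x h)).
Qed.

Lemma sym_proj_sign e e' x f : x \notin perp U -> rp_space (S_dot sigma e x) f ->
  sym_proj e' f = if e == e' then f else 0.
Proof.
move=> xP /S_dotP[]// _ f_opp; apply/ffunP => g.
by rewrite !ffunE f_opp half_sum_sign; case: ifP => // _; rewrite ffunE.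
Qed.

Lemma sym_proj_linear e a f f' : sym_proj e (a *: f + f') = a *: sym_proj e f + sym_proj e f'.
Proof. by apply/ffunP => g; rewrite !ffunE half_sumD half_sumZ. Qed.

Lemma sym_proj_translate e k f :
  sym_proj e [ffun g => f (g * k)%g] = [ffun g => sym_proj e f (g * k)%g].
Proof. by apply/ffunP => g; rewrite !ffunE mulgA. Qed.

Lemma sym_proj_eq0 e : sym_proj e 0 = 0.
Proof. by apply/ffunP => g; rewrite !ffunE half_sum0 scaler0. Qed.

End SymProjection.

Section Decomposition.
Variables (X : {set V}) (X_reps : orbit_reps U X).
Local Notation D := (summand_index U X).

Lemma index_notin_perp x e : inr (x, e) \in D -> x \notin perp U.
Proof. by rewrite inE; case: X_reps => X_perp _ _; exact: X_perp. Qed.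

Lemma summand_model_repn i : is_repn (summand_model i).
Proof.
case: i => [e|[x e]]; first exact: sigma_summand_repn.
by apply: induced_is_repn => [|h]; [exact: E_sub|exact: sigma_dot_sgn_linear].
Qed.

Lemma to_summand_intertwiner :
  {in D, forall i, @intertwiner _ _ (grp_repn model) _ (@to_summand i)}.
Proof.
case=> [e _|[x e] /index_notin_perp xP]; split.
- by move=> a phi chi phiM chiM; rewrite /= !ffunE sign_proj_linear.
- by move=> phi phiM; apply: sign_proj_in.
- by move=> g phi phiM; rewrite /= ffunE (sp_0 g^-1%g) sign_proj_grp.
- move=> a phi chi phiM chiM; rewrite /= -sym_proj_linear; congr sym_proj; apply/ffunP => g.
  by rewrite orbit_funE (grp_linear model_weil)// !ffunE.
- by move=> phi phiM; apply: sym_proj_S_dot => //; exact: orbit_fun_equivariant.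
- move=> g phi phiM; rewrite -[LHS]/(sym_proj e (orbit_fun x (G g phi))).
  by rewrite orbit_fun_grp// sym_proj_translate.
Qed.

Lemma of_summand_intertwiner :
  {in D, forall i, @intertwiner _ _ (summand_model i) (grp_repn model) (@of_summand i)}.
Proof.
case=> [e _|[x e] /index_notin_perp xP]; split.
- move=> a u v /summand_inl_sub Eu /summand_inl_sub Ev; apply/ffunP => y; rewrite !ffunE.
  by case: ifP => _; rewrite ?(heis_linear sigma_weil)// scaler0 addr0.
- by move=> v /summand_inl_sub; exact: extend0_in.
- by move=> g v /summand_inl_sub Ev; exact: extend0_grp.
- by move=> a f f' [f_in _] [f'_in _]; exact: unfold_orbit_linear.
- by move=> f [f_in _]; exact: unfold_orbit_in.
- by move=> k f [f_in _]; exact: unfold_orbit_grp.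
Qed.

Lemma of_summandK :
  {in D, forall i v, rp_space (summand_model i) v -> to_summand i (of_summand v) = v}.
Proof.
case=> [e _|[x e] /index_notin_perp xP] v v_in /=.
  by rewrite (extend0_at0 psi_prim sigma_weil) ?sign_proj_id//; exact: summand_inl_sub v_in.
have /(S_dotP _ _ xP)[v_eq _] := v_in.
by rewrite unfold_orbitK// (sym_proj_sign _ xP v_in) eqxx.
Qed.

Lemma to_summand_eq0 : {in D &, forall i j, i != j ->
  forall v : rp_sort (summand_model i), rp_space (summand_model i) v ->
  to_summand j (of_summand v) = 0}.
Proof.
case=> [e|[x e]] [e'|[y e']] iD jD ij v v_in /=.
- have Ev := summand_inl_sub v_in; rewrite (extend0_at0 psi_prim sigma_weil)//.
  have ee' : e != e' by apply: contra_neq ij => ->.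
  apply: (sign_proj_eq0 (e := e)) => //; apply: contraNN ee' => triv.
  by move: iD jD; rewrite !inE triv !andbT => /negPf-> /negPf->.
- by rewrite orbit_fun_extend0 ?sym_proj_eq0//; exact: index_notin_perp jD.
- rewrite unfold_orbit_out ?(linear_on0 E_sub (sign_proj_linear e'))// => g.
  by rewrite sp_0 add0r rpredN; exact: index_notin_perp iD.
have xP := index_notin_perp iD; have [xy|xy] := eqVneq x y.
  case: _ / xy ij {jD} => ij; have /(S_dotP _ _ xP)[v_eq _] := v_in.
  rewrite unfold_orbitK// (sym_proj_sign _ xP v_in); case: eqP => // ee'.
  by rewrite ee' eqxx in ij.
rewrite orbit_fun_unfold_out ?sym_proj_eq0// => g; apply: contraNN xy => gP.
have [_ _ X_inj] := X_reps; rewrite eq_sym; apply/eqP/X_inj; last by exists g.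
  by move: jD; rewrite inE.
by move: iD; rewrite inE.
Qed.

Hypothesis sigma_irr : irreducible (heis_repn sigma).
Hypothesis nondeg_ubar : nondegenerate (ubar U).

Let E_neq0 : exists2 v, E v & v != 0.
Proof. by have [_ E0 _] := sigma_irr; exact: subspace_neq0P. Qed.

Lemma heis_trivial_ubar_trivial :
  (forall c v, E v -> rho (c, 0) v = v) -> ubar_trivial U.
Proof.
move=> rho1; have [v Ev v0] := E_neq0; apply/forallP => c; apply/eqP/nondeg_ubar => d.
have ubar_sub : submod_closed [set: ubar U]%SET.
  by split=> [|a x y _ _]; exact: finset.in_setT.
apply: (psi_form_eq1 psi_prim ubar_sub _ (finset.in_setT _)) => {}d _.
apply: (scalev_inj v0); rewrite scale1r.
by have := heis_comm sigma_weil psi_prim two_unit d 0 c 0 Ev; rewrite !rho1.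
Qed.

Lemma opp_scalar_ubar_trivial a :
  (forall v, E v -> sg opp v = a *: v) -> ubar_trivial U.
Proof.
move=> opp_scalar; have [w Ew w0] := E_neq0.
have a0 : a != 0.
  apply: contra_neq w0 => a0; rewrite -(grpK sigma_weil opp Ew) opp_scalar// a0 scale0r.
  exact: grp_eq0 sigma_weil _.
have rU_opp c : rU U opp c = - c.
  elim/ubar_ind: c => x xP; rewrite rU_ubar_pi// sp_oppE.
  by apply/eqP; rewrite -addr_eq0 -ubar_piD ?rpredN// addNr ubar_pi0.
have heisN c v : E v -> rho (c, 0) v = rho (- c, 0) v.
  move=> Ev; have := grp_heis sigma_weil opp c 0 Ev; rewrite !opp_scalar// rU_opp.
  by rewrite (heisZ sigma_weil)// => /(can_inj (scalerK a0)).
apply: heis_trivial_ubar_trivial => c v Ev; pose d := 2%:R^-1 *: c : ubar U.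
have -> : c = d + d by rewrite -scalerDl -[2%:R^-1]mulr1 halfD// scale1r.
have := heisD sigma_weil d d 0 0 Ev; rewrite am_alt mulr0 !addr0 psi0// scale1r => <-.
by rewrite [LHS]heisN// (heis_oppK sigma_weil).
Qed.

Lemma sign_proj_neq0 e : ~~ ubar_trivial U -> exists2 v, E v & sign_proj e v != 0.
Proof.
move=> nontriv; apply: not_forall_in => sign0; case/negP: (nontriv).
apply: (@opp_scalar_ubar_trivial (- sgn e)) => v /sign0.
by rewrite /sign_proj (negPf nontriv) => /eqP/half_sum_eq0.
Qed.

Lemma S_dot_neq0 e x : x \notin perp U -> exists2 f, rp_space (S_dot sigma e x) f & f != 0.
Proof.
move=> xP; have [v Ev v0] := E_neq0.
pose phi : {ffun V -> wr_sort sigma} := wr_heis model (- x, 0) (extend0 v).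
have phiM : M phi by apply: (heis_in model_weil); exact: extend0_in.
exists (sym_proj e (orbit_fun x phi)).
  by apply: sym_proj_S_dot => //; exact: orbit_fun_equivariant.
have phix : phi x = v.
  rewrite ffunE /= subrr formNr am_alt oppr0 mulr0 addr0 psi0// scale1r.
  exact: (extend0_at0 psi_prim sigma_weil).
have phiNx : phi (- x) = 0.
  have := opp_notin_stab two_unit xP; rewrite stabE sp_oppE => /negPf NxP.
  by rewrite ffunE /= ffunE NxP scaler0.
have oppVx : (opp^-1%g : Sp V) x = - x.
  by apply: (@sp_inj _ _ opp); rewrite sp_invKV sp_oppE opprK.
have at1 : sym_proj e (orbit_fun x phi) 1%g = 2%:R^-1 *: v.
  rewrite ffunE !orbit_funE (grp1 model_weil)// phix mulg1 [X in half_sum _ _ X]ffunE.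
  by rewrite oppVx phiNx (grp_eq0 sigma_weil) half_sum0.
apply: contra_neq v0 => sym0; move: at1; rewrite sym0 ffunE => /esym/eqP.
by rewrite scaler_eq0 invr_eq0 (negPf (two_neq0 C)) => /eqP.
Qed.

Lemma summand_model_neq0 : {in D, forall i, rp_space (summand_model i) <> [set 0]%classic}.
Proof.
move=> i iD; suff [v v_in v0] : exists2 v, rp_space (summand_model i) v & v != 0.
  exact: set_neq0 v0.
case: i iD => [e _|[x e] /index_notin_perp xP]; last exact: S_dot_neq0.
have [triv|nontriv] := boolP (ubar_trivial U).
  by have [v Ev v0] := E_neq0; exists v => //=; rewrite triv.
have [v Ev v0] := sign_proj_neq0 e nontriv.
by exists (sign_proj e v) => //; exact: sign_proj_in.
Qed.

Theorem model_direct_summands :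
  @direct_summands _ _ (grp_repn model) _ D summand_model (@to_summand) of_summand.
Proof.
split; [by move=> i _; exact: summand_model_repn|exact: summand_model_neq0
  |exact: to_summand_intertwiner|exact: of_summand_intertwiner|exact: of_summandK
  |exact: to_summand_eq0].
Qed.

Hypothesis small_commutant : commutant_dim_le (grp_repn model) #|D|.

Lemma decomposition_irreducible : {in D, forall i, irreducible (summand sigma i)}.
Proof.
move=> i iD; rewrite summandE.
exact: summands_irreducible (weil_grp_repn model_weil) model_direct_summands _ _ iD.
Qed.

Lemma decomposition_not_iso :
  {in D &, forall i j, i != j -> ~ repn_iso (summand sigma i) (summand sigma j)}.
Proof.
move=> i j iD jD; rewrite !summandE.
exact: summands_not_iso (weil_grp_repn model_weil) model_direct_summands _ _ _ iD jD.
Qed.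

Lemma trivial_heis_line : ubar_trivial U -> is_line E.
Proof.
move=> /forallP triv; have [v0 Ev0 v0_neq0] := E_neq0; exists v0; split=> // v Ev.
pose A := [set u | exists a, u = a *: v0]%classic.
have [_ _ E_irr] := sigma_irr; have [|||A0|AE] := E_irr A.
- split; first by exists 0; rewrite scale0r.
  by move=> a _ _ [b ->] [c ->]; exists (a * b + c); rewrite scalerDl scalerA.
- by move=> _ [a ->]; exact: (weil_spaceZ sigma_weil).
- move=> [c t] _ [a ->]; rewrite (eqP (triv c)) /= (heis_center sigma_weil)//.
  by exists (psi t * a); rewrite scalerA.
- have : A v0 by exists 1; rewrite scale1r.
  by rewrite A0 /= => v0_eq0; rewrite v0_eq0 eqxx in v0_neq0.
- by have : A v by rewrite AE.
Qed.

Lemma decomposition_monomial :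
  ubar_trivial U -> {in D, forall i, monomial (summand sigma i)}.
Proof.
move=> triv i iD; have E_line := trivial_heis_line triv.
have := summand_model_neq0 iD; case: i iD => [e|[x e]] iD /= ind_neq0.
  by rewrite triv; exact: line_monomial (weil_grp_repn sigma_weil) E_line.
apply: (@induced_line_monomial _ _ (Repn E (sigma_dot_sgn e x)) _ _ (pm_stab_group U x)) => //=.
- exact: sigma_dot_sgn_linear.
- by move=> h v; exact: sigma_dot_sgn_in.
Qed.

End Decomposition.

End Summands.

(** * Counting orbits and summands *)

Section Counting.
Variables (F : finComUnitRingType) (V : altMod F) (U : invIso V) (n : nat).

(* [lev v] locates v in a filtration of length 2n + 2 whose (n+1)-st term is U and
   whose n-th term is U^perp; the levels are the Sp(V)-orbits. *)
Record level_structure (lev : V -> nat) : Prop := LevelStructure {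
  level_max : forall v, (lev v <= n.*2.+1)%N;
  level_sp : forall (g : Sp V) v, lev (g v) = lev v;
  level_orbit : forall v w, lev v = lev w -> exists g : Sp V, g v = w;
  level_perp : forall v, (v \in perp U) = (n <= lev v)%N;
  level_ii : forall v, (v \in ii_set U) = (n < lev v)%N;
  level_sub : forall j v w, (j <= lev v)%N -> (j <= lev w)%N -> (j <= lev (v - w)%R)%N;
  level_even : forall j, ~~ odd j -> (j <= n.*2)%N -> exists v, lev v = j
}.

Variable lev : V -> nat.

Definition full_levels : Prop := forall j, odd j -> (j <= n.*2)%N -> exists v, lev v = j.
Definition half_levels : Prop := forall v, odd (lev v) -> lev v = n.*2.+1.
Definition attained (j : nat) : bool := `[< exists v, lev v = j >].

Hypothesis lev_struct : level_structure lev.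

Lemma level_opp v : lev (- v) = lev v.
Proof. by rewrite -sp_oppE (level_sp lev_struct). Qed.

Lemma level_cong v w : (lev w < lev (v - w)%R)%N -> lev v = lev w.
Proof.
move=> lt_w; apply/eqP; rewrite eqn_leq leqNgt; apply/andP; split.
  apply/negP => lt_v; suff : (lev w < lev w)%N by rewrite ltnn.
  by rewrite -{2}[w](subKr v); exact: (level_sub lev_struct).
have : (lev w <= lev (v - w - - w)%R)%N.
  by apply: (level_sub lev_struct); rewrite ?level_opp// ltnW.
by rewrite opprK subrK.
Qed.

Lemma attained_full j : full_levels -> (j <= n.*2)%N -> attained j.
Proof.
move=> full jn; apply/asboolP; have [oj|oj] := boolP (odd j); first exact: full.
exact: (level_even lev_struct).
Qed.

Lemma attained_half j : half_levels -> (j <= n.*2)%N -> attained j = ~~ odd j.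
Proof.
move=> half jn; apply/asboolP/idP => [[v vj]|oj]; last exact: (level_even lev_struct).
by apply/negP => oj; have := half v; rewrite vj => /(_ oj); lia.
Qed.

Lemma ubar_trivial_attained : ubar_trivial U = ~~ attained n.
Proof.
apply/forallP/asboolPn => [triv [v vn]|unattained c].
  have vP : v \in perp U by rewrite (level_perp lev_struct) vn.
  by have := triv (ubar_pi U v); rewrite ubar_pi_eq0// (level_ii lev_struct) vn ltnn.
rewrite -(ubar_reprK c) ubar_pi_eq0 ?ubar_reprP// (level_ii lev_struct) ltn_neqAle.
rewrite -(level_perp lev_struct) ubar_reprP andbT.
by apply/eqP => cn; apply: unattained; exists (ubar_repr c).
Qed.

Lemma card_even k : #|[set j : 'I_k | ~~ odd j]%SET| = uphalf k.
Proof.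
rewrite -sum1_card; under eq_bigl do rewrite inE.
rewrite -(big_mkord (fun j => ~~ odd j) (fun=> 1%N)) big_mkcond /=.
elim: k => [|k IH]; first by rewrite big_geq.
rewrite big_nat_recr //= IH uphalf_half /=; case: (odd k) => /=; lia.
Qed.

Variables (X : {set V}) (X_reps : orbit_reps U X).
Local Notation D := (summand_index U X).

Lemma card_orbit_reps : #|X| = #|[set j : 'I_n | attained j]%SET|.
Proof.
have [X_perp X_onto X_inj] := X_reps.
have levX x : x \in X -> (lev x < n)%N.
  by move=> /X_perp; rewrite (level_perp lev_struct) -ltnNge.
have [n0|n_gt0] := posnP n.
  have -> : X = finset.set0 by apply/setP => x; rewrite !inE; apply/negP => /levX; rewrite n0.
  by rewrite cards0 eq_card0// => j; have := ltn_ord j; rewrite {2}n0.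
pose level_ord x : 'I_n := insubd (Ordinal n_gt0) (lev x).
have level_ordE x : (lev x < n)%N -> level_ord x = lev x :> nat.
  by move=> xn; rewrite val_insubd xn.
rewrite -(card_in_imset (f := level_ord)) => [|x y xX yX /(congr1 val)]; last first.
  rewrite /= !level_ordE ?levX// => /(level_orbit lev_struct)[g gxy].
  by apply: X_inj => //; exists g; rewrite gxy subrr rpred0.
apply: eq_card => j; rewrite inE; apply/imsetP/asboolP => [[x xX ->]|[v vj]].
  by exists x; rewrite level_ordE ?levX.
have vP : v \notin perp U by rewrite (level_perp lev_struct) -ltnNge vj.
have [x xX [g gP]] := X_onto _ vP; exists x => //; apply: val_inj; rewrite /= level_ordE ?levX//.
rewrite -vj -[RHS](level_sp lev_struct g); apply/esym/level_cong.
by rewrite vj; apply: leq_trans (ltn_ord j) _; rewrite -(level_perp lev_struct).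
Qed.

Lemma card_summand_index : #|D| = (2 * #|X| + (if ubar_trivial U then 1 else 2))%N.
Proof.
pose A := [set e : bool | ~~ (e && ubar_trivial U)]%SET.
have D_split : D =
    [set inl e | e in A]%SET :|: [set inr p | p in finset.setX X [set: bool]%SET]%SET.
  apply/setP => i; rewrite finset.in_setU; case: i => [e|[x e]].
    rewrite mem_imset; last by move=> ? ? [].
    by rewrite !inE; case: imsetP => [[]//|_]; rewrite orbF.
  rewrite [X in _ || X]mem_imset; last by move=> ? ? [].
  by rewrite !inE andbT; case: imsetP => [[]//|_].
rewrite D_split cardsU disjoint_setI0; last first.
  by apply/pred0P => i; apply/negP => /andP[/imsetP[e _ ->] /imsetP[]].
rewrite cards0 subn0 !card_imset; try by move=> ? ? [].
rewrite cardsX cardsT card_bool mulnC addnC; congr (_ + _)%N.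
by rewrite -sum1_card big_mkcond big_bool /= !inE /=; case: (ubar_trivial U).
Qed.

Lemma card_summand_index_full : full_levels -> #|D| = (2 * n + 2)%N.
Proof.
move=> full; rewrite card_summand_index card_orbit_reps ubar_trivial_attained.
rewrite attained_full//; last by rewrite -addnn leq_addr.
rewrite (_ : [set j : 'I_n | attained j]%SET = [set: 'I_n]%SET) ?cardsT ?card_ord//.
by apply/setP => j; rewrite !inE attained_full//; have := ltn_ord j; lia.
Qed.

Lemma card_summand_index_half : half_levels -> #|D| = (n + 2)%N.
Proof.
move=> half; rewrite card_summand_index card_orbit_reps ubar_trivial_attained.
rewrite attained_half//; last by rewrite -addnn leq_addr.
rewrite (_ : [set j : 'I_n | attained j]%SET = [set j : 'I_n | ~~ odd j]%SET); last first.
  by apply/setP => j; rewrite !inE attained_half//; have := ltn_ord j; lia.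
by rewrite card_even uphalf_half; have := odd_double_half n; case: odd => /=; lia.
Qed.

Lemma ubar_trivial_half : half_levels -> odd n -> ubar_trivial U.
Proof.
by move=> half on; rewrite ubar_trivial_attained attained_half ?on// -addnn leq_addr.
Qed.

Lemma orbits_le_summands : full_levels \/ half_levels ->
  exists (J : finType) (o : V -> J), (#|J| <= #|D|)%N /\
    forall v w, o v = o w -> exists g : Sp V, g v = w.
Proof.
have lev_max := level_max lev_struct; case=> [full|half].
  exists 'I_(n.*2.+2), (fun v => inord (lev v)).
  rewrite card_ord card_summand_index_full//; split=> [|v w /(congr1 val)]; first by lia.
  by rewrite /= !inordK ?ltnS// => /(level_orbit lev_struct).
have lev_half v : lev v = (uphalf (lev v)).*2 \/ lev v = n.*2.+1.
  have [/half|ev] := boolP (odd (lev v)); [by right|left].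
  by rewrite uphalf_half (negPf ev) even_halfK.
have lt_half v : (uphalf (lev v) < n.+2)%N.
  by have := lev_max v; have := lev_half v; rewrite uphalf_half; lia.
exists 'I_(n.+2), (fun v => inord (uphalf (lev v))).
rewrite card_ord card_summand_index_half//; split=> [|v w /(congr1 val)]; first by lia.
rewrite /= !inordK// => vw; apply: (level_orbit lev_struct).
have := lev_half v; have := lev_half w; have := lev_max v; have := lev_max w.
by move: vw; lia.
Qed.

End Counting.

(* The conclusion of the theorem; [full] and [half] are the conditions under which
   there are 2n + 2 and n + 2 summands. *)
Definition weil_decomposes (C : numClosedFieldType) (F : finComUnitRingType)
    (psi : F -> C) (V : altMod F) (U : invIso V) (n : nat) (full half : Prop)
    (S : weilRep C V (Sp V)) : Prop :=
  exists sigma : weilRep C (ubar U) (Sp V),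
  [/\ is_weil psi (rU U) sigma,
      weil_iso S (weil_model psi sigma),
      forall sigma' : weilRep C (ubar U) (Sp V), is_weil psi (rU U) sigma' ->
        weil_iso S (weil_model psi sigma') -> weil_iso sigma sigma'
    & forall X : {set V}, orbit_reps U X ->
      let D := summand_index U X in
      [/\ {in D, forall i, irreducible (summand sigma i)},
          {in D &, forall i j, i != j ->
             ~ repn_iso (summand sigma i) (summand sigma j)},
          full -> #|D| = (2 * n + 2)%N,
          half -> #|D| = (n + 2)%N
        & half -> odd n -> {in D, forall i, monomial (summand sigma i)}]].

Lemma weil_decomposesW (C : numClosedFieldType) (F : finComUnitRingType) (psi : F -> C)
    (V : altMod F) (U : invIso V) (n : nat) (full half full' half' : Prop)
    (S : weilRep C V (Sp V)) :
  (full' -> full) -> (half' -> half) ->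
  weil_decomposes psi U n full half S -> weil_decomposes psi U n full' half' S.
Proof.
move=> fullW halfW [sigma [sigma_weil S_iso sigma_unique decomp]]; exists sigma.
split=> // X /decomp[irr not_iso card_full card_half mono].
by split=> // [/fullW|/halfW|/halfW].
Qed.

Theorem level_weil_decomposes (C : numClosedFieldType) (F : finComUnitRingType)
    (psi : F -> C) (V : altMod F) (U : invIso V) (n : nat) (lev : V -> nat)
    (S : weilRep C V (Sp V)) :
  primitive_char psi -> (2%:R : F) \is a GRing.unit ->
  nondegenerate V -> nondegenerate (ubar U) ->
  level_structure U n lev -> full_levels n lev \/ half_levels n lev ->
  is_weil psi id S ->
  weil_decomposes psi U n (full_levels n lev) (half_levels n lev) S.
Proof.
move=> psi_prim two_unit nondegV nondeg_ubar lev_struct lev_cases S_isweil.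
have S_weil := is_weil_action S_isweil; set sigma := fixed_rep U S.
have sigma_isweil : is_weil psi (rU U) sigma by exact: fixed_is_weil.
have sigma_weil := is_weil_action sigma_isweil.
have S_iso : weil_iso S (weil_model psi sigma) by exact: fixed_model_iso.
have [[sigma_irr _] _ _ _] := sigma_isweil.
have [[S_irr _] _ _ _] := S_isweil.
have model_irr : irreducible (heis_repn (weil_model psi sigma)).
  exact: iso_irreducible (weil_heis_repn S_weil) (weil_iso_heis S_iso) S_irr.
exists sigma; split=> // [sigma' /is_weil_action sigma'_weil S_iso'|X X_reps /=].
  apply: weil_iso_trans (fixed_rep_iso U S_weil S_iso') _.
  exact: (model_fixed_iso psi_prim two_unit sigma'_weil).
have [J [o [leJD o_orbit]]] := orbits_le_summands lev_struct X_reps lev_cases.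
have model_weil := weil_model_action psi_prim sigma_weil.
have small_commutant := commutant_dim_leW leJD
  (commutant_dim_orbits psi_prim two_unit nondegV model_weil model_irr o_orbit).
split.
- by move=> i iD; exact: (decomposition_irreducible psi_prim two_unit sigma_weil X_reps).
- by move=> i j iD jD; exact: (decomposition_not_iso psi_prim two_unit sigma_weil X_reps).
- exact: (card_summand_index_full lev_struct).
- exact: (card_summand_index_half lev_struct).
- move=> half on; apply: (decomposition_monomial psi_prim two_unit sigma_weil X_reps) => //.
  exact: (ubar_trivial_half lev_struct).
Qed.

(** * Double duality of lattices *)

Section Valuation.
Variable k : localField.
Implicit Types x y : k.

Lemma lf_valV x : x != 0 -> lf_val x^-1 = - lf_val x.
Proof.
move=> x0; have := lf_valM x0 (invr_neq0 x0); rewrite divff// val1 => /esym/eqP.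
by rewrite addrC addr_eq0 => /eqP.
Qed.

Lemma ppow_val x : x \in ppow k (lf_val x).
Proof. by rewrite inE lexx orbT. Qed.

Lemma ppowV x i : x != 0 -> x \notin ppow k (i + 1) -> x^-1 \in ppow k (- i).
Proof.
by move=> x0; rewrite !inE (negPf x0) /= -ltNge lf_valV// lerN2 -ltzD1 => ->; rewrite orbT.
Qed.

Lemma ppow0_div x y : y != 0 -> x \in ppow k (lf_val y) -> x / y \in ppow k 0.
Proof.
by move=> y0 xy; have := ppowM xy (ppow_val y^-1); rewrite lf_valV// subrr.
Qed.

End Valuation.

Section Duals.
Variables (k : localField) (W : sympSpace k).
Implicit Types (P Q : osub W) (i lam : int).
Local Notation pi := (lf_unif k).

Lemma oscaleD i j P x : (x \in oscale i (oscale j P)) = (x \in oscale (i + j) P).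
Proof. by rewrite in_oscale [LHS]in_oscale unifXD [RHS]in_oscale opprD addrC. Qed.

Lemma mem_oscale i P x : x \in P -> pi ^ i *: x \in oscale i P.
Proof. by move=> xP; rewrite in_oscale_shift subrr oscale0. Qed.

Lemma scale_oscale (a : k) i j P x :
  a \in ppow k i -> x \in oscale j P -> a *: x \in oscale (i + j) P.
Proof.
move=> ai; rewrite !in_oscale => xP.
have -> : pi ^ (- (i + j)) *: (a *: x) = (pi ^ (- i) * a) *: (pi ^ (- j) *: x).
  by rewrite !scalerA mulrAC -expfzDr ?lf_unif_neq0// opprD mulrC.
by apply: os_Z xP; rewrite ppow_shift sub0r opprK.
Qed.

Lemma dual_oscale lam i P : dual lam (oscale i P) =i oscale (- i) (dual lam P).
Proof.
move=> x; rewrite in_oscale opprK; apply/dualP/dualP => xP b bP.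
  by rewrite wformZl -wformZr; apply: xP; exact: mem_oscale.
by have := xP _ bP; rewrite wformZl -wformZr unifXK.
Qed.

Lemma dualD lam i P : dual (lam + i) P =i oscale i (dual lam P).
Proof.
move=> x; rewrite in_oscale; apply/dualP/dualP => xP b bP; have := xP b bP;
by rewrite wformZl ppow_shift opprK.
Qed.

Lemma eq_dual lam P Q : P =i Q -> dual lam P =i dual lam Q.
Proof. by move=> PQ x; apply/dualP/dualP => xP b bP; apply: xP; rewrite ?PQ// -PQ. Qed.

Lemma eq_oscale i P Q : P =i Q -> oscale i P =i oscale i Q.
Proof. by move=> PQ x; rewrite !in_oscale PQ. Qed.

Lemma form_represents (l : 'Hom(W, k^o)) : exists y, forall w, l w = ss_form w y.
Proof.
have /choice[f fE] y : exists h : 'Hom(W, k^o), h =1 (fun w => ss_form w y).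
  by apply: linear_hom => a u v; exact: ss_linl.
have [|Phi PhiE] := @linear_hom _ W 'Hom(W, k^o) f.
  by move=> a u v; apply/lfunP => w; rewrite !lfun_simp !fE ss_linr.
have Phi_inj : lker Phi == 0%VS.
  apply/lker0P => u v; rewrite !PhiE => /lfunP uv; apply/eqP; rewrite -subr_eq0; apply/eqP.
  apply: ss_nondegenerate => w; have := uv w; rewrite !fE => wuv.
  by rewrite wformC wformDr -[- v]scaleN1r wformZr mulN1r wuv subrr oppr0.
have Phi_onto : limg Phi = fullv.
  apply/eqP; rewrite eqEdim subvf limg_dim_eq; last by rewrite (eqP Phi_inj) capv0.
  by rewrite !dimvf [X in (X <= _)%N]muln1; exact: leqnn.
have : l \in limg Phi by rewrite Phi_onto memvf.
by case/memv_imgP => y _ ->; exists y => w; rewrite PhiE fE.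
Qed.

End Duals.

Section Bidual.
Variables (k : localField) (W : sympSpace k).
Local Notation pi := (lf_unif k).
Local Notation e := (vbasis {:W}%VS).
Local Notation d := (\dim {:W}%VS).

Lemma lattice_bounded (L : lattice W) :
  exists N : int, forall x j, x \in L -> coord e j x \in ppow k N.
Proof.
have := @lat_compact _ _ L; rewrite compact_cover => /(_ nat setT (fun i => @vball k W (- i%:Z))).
case=> [i _|x _|s _ s_cover].
- rewrite vopenE => w w_in; exists (- i%:Z) => w' w'w j.
  have -> : (w' : W) = (w' : W) - (w : W) + (w : W) by rewrite subrK.
  by rewrite linearD /=; apply: ppowD; [exact: w'w|exact: w_in].
- exists (\max_(j < d) `|lf_val (coord e j (x : W))|)%N => //= j.
  rewrite inE; apply/orP; right.
  have absN (z : int) (m : nat) : (`|z| <= m)%N -> - m%:Z <= z by lia.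
  exact/absN/(leq_bigmax (F := fun j => `|lf_val (coord e j (x : W))|%N)).
- exists (- (\max_(i <- finmap.enum_fset s) i)%N%:Z) => x j /s_cover[i /= si /(_ j)].
  apply: ppowW; rewrite lerN2 lez_nat.
  exact: (leq_bigmax_seq (F := id)).
Qed.

Lemma lattice_ball (L : lattice W) :
  exists N : int, forall x, (forall j, coord e j x \in ppow k N) -> x \in L.
Proof.
have [N N_ball] := (@lat_open _ _ L : vopen _) _ (os_0 L); exists N => x x_in.
by apply: N_ball => j; rewrite subr0.
Qed.

Definition flag (i : nat) (x : W) : Prop := forall j : 'I_d, (i <= j)%N -> coord e j x = 0.

Lemma flag_dim x : flag d x.
Proof. by move=> j; rewrite leqNgt ltn_ord. Qed.

Lemma flag0 x : flag 0 x -> x = 0.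
Proof.
move=> x0; rewrite (coord_basis (vbasisP _) (memvf x)).
by apply: big1 => j _; rewrite x0// scale0r.
Qed.

Lemma flag_basis (i : 'I_d) a : flag i.+1 (a *: e`_i) /\ coord e i (a *: e`_i) = a.
Proof.
have e_free : free e by exact: basis_free (vbasisP _).
split=> [j ij|]; rewrite linearZ /= coord_free// ?eqxx ?mulr1//.
by rewrite [i == j](negPf _) ?mulr0//; apply: contraTneq ij => ->; rewrite ltnn.
Qed.

Lemma flag_reduce (i : 'I_d) x b : flag i.+1 x -> flag i.+1 b -> coord e i b != 0 ->
  flag i (x - (coord e i x / coord e i b) *: b).
Proof.
move=> xF bF b0 j; rewrite leq_eqVlt => /orP[/eqP/val_inj <-|ij].
  by rewrite linearB linearZ /= divfK// subrr.
by rewrite linearB linearZ /= (xF j)// (bF j)// mulr0 subrr.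
Qed.

Lemma exists_min_coord (L : lattice W) (i : 'I_d) :
  exists b, [/\ b \in L, flag i.+1 b, coord e i b != 0
    & forall x, x \in L -> flag i.+1 x -> coord e i x / coord e i b \in ppow k 0].
Proof.
have [N L_bounded] := lattice_bounded L; have [N' L_ball] := lattice_ball L.
pose level m := `[< exists b, [/\ b \in L, flag i.+1 b, coord e i b != 0
  & lf_val (coord e i b) = N + m%:Z] >].
have has_level b : b \in L -> flag i.+1 b -> coord e i b != 0 ->
    exists2 m, level m & lf_val (coord e i b) = N + m%:Z.
  move=> bL bF b0; have := L_bounded b i bL; rewrite inE (negPf b0) /= => le_N.
  exists `|lf_val (coord e i b) - N|%N; last by lia.
  by apply/asboolP; exists b; split=> //; lia.
have ex_level : exists m, level m.
  pose b := pi ^ N' *: e`_i; have [bF bi] := flag_basis i (pi ^ N').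
  have bL : b \in L.
    apply: L_ball => j; rewrite linearZ /= coord_free; last exact: basis_free (vbasisP _).
    by case: (_ == _); rewrite ?mulr1 ?mulr0 ?ppow0 ?ppow_unif.
  by have [|m] := has_level b bL bF; [rewrite bi unifX_neq0|exists m].
case: (ex_minnP ex_level) => m /asboolP[b [bL bF b0 b_val]] min_m.
exists b; split=> // x xL xF; apply: ppow0_div => //.
have [->|x0] := eqVneq (coord e i x) 0; first exact: ppow0.
have [m' /min_m le_m x_val] := has_level x xL xF x0.
by rewrite inE x_val b_val lerD2l lez_nat le_m orbT.
Qed.

(* A non-archimedean Hahn-Banach argument along the flag of the basis e: in each
   step the lattice contains a vector whose new coordinate has minimal valuation. *)
Lemma lattice_separation (L : lattice W) (i : nat) : (i <= d)%N ->
  forall x, flag i x -> x \notin L ->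
  exists l : 'Hom(W, k^o), (l x : k) \notin ppow k 0 /\
    forall b, b \in L -> flag i b -> (l b : k) \in ppow k 0.
Proof.
elim: i => [|i IH] id x xF xL; first by case/negP: xL; rewrite (flag0 xF) os_0.
pose i0 := Ordinal id; have [b [bL bF b0 b_min]] := exists_min_coord L i0.
pose q w : k^o := coord e i0 w / coord e i0 b.
have q_lin : linear q by move=> a u v; rewrite /q linearP mulrDl -mulrA.
have [qx|qx] := boolP ((q x : k) \in ppow k 0); last first.
  by have [l lE] := linear_hom q_lin; exists l; split=> [|y yL yF]; rewrite lE//; exact: b_min.
have [||l [lx lL]] := IH (ltnW id) (x - q x *: b).
- exact: (flag_reduce (i := i0)).
- by apply: contra xL => qxL; rewrite -[x](subrK (q x *: b)) os_D// os_Z.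
have [|l' l'E] := @linear_hom _ W k^o (fun w => l (w - q w *: b)).
  by move=> a u v; rewrite q_lin scalerDl -scalerA opprD addrACA -scalerBr linearP.
exists l'; split=> [|y yL yF]; rewrite l'E//; apply: lL; last exact: (flag_reduce (i := i0)).
by rewrite rpredB// os_Z//; exact: b_min.
Qed.

Theorem lattice_bidual (lam : int) (L : lattice W) : dual lam (dual lam L) =i L.
Proof.
move=> x; apply/idP/idP => [/dualP x_bidual|xL]; last first.
  by apply/dualP => y /dualP yL; rewrite wformC ppowN// yL.
apply: contraT => xL.
have [l [lx lL]] := lattice_separation (leqnn d) (@flag_dim x) xL.
have [y l_y] := form_represents l.
have y_dual : pi ^ lam *: y \in dual lam L.
  apply/dualP => b bL; rewrite wformC wformZr ppowN// ppow_shift subrr -l_y.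
  by apply: lL => //; exact: flag_dim.
by have := x_bidual _ y_dual; rewrite wformZr ppow_shift subrr -l_y (negPf lx).
Qed.

End Bidual.

(** * The chain of lattices *)

Section Isometries.
Variables (k : localField) (W : sympSpace k).

Lemma sqm_isometry (n : nat) (d : sqData W n) (f f' : W -> W) :
  linear f -> cancel f f' -> (forall x y, ss_form (f x) (f y) = ss_form x y) ->
  {homo f : x / x \in sqd_P d} -> {homo f : x / x \in sqd_Q d} ->
  {homo f' : x / x \in sqd_Q d} ->
  exists g : Sp (sqm d), forall x, x \in sqd_P d -> g (sqm_pi d x) = sqm_pi d (f x).
Proof.
move=> f_lin fK f_form fP fQ f'Q.
have f_sub x y : f x - f y = f (x - y) by rewrite addrC -scaleN1r -f_lin scaleN1r addrC.
pose fV (w : sqm d) : sqm d := sqm_pi d (f (sqm_repr w)).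
have fV_pi x : x \in sqd_P d -> fV (sqm_pi d x) = sqm_pi d (f x).
  move=> xP; apply: sq_eqP; rewrite ?fP ?sq_reprP// f_sub.
  by apply: fQ; exact: sq_repr_pi.
have fV_inj : injective fV.
  elim/sqm_ind => x xP; elim/sqm_ind => y yP; rewrite !fV_pi// => /eqP.
  rewrite sq_eqE ?fP// f_sub => /f'Q; rewrite fK.
  exact: sq_eqP.
have fV_sp : is_sp (perm fV_inj : {perm sqm d}).
  apply/is_spP; split=> [a|]; elim/sqm_ind => x xP; elim/sqm_ind => y yP; rewrite !permE.
    elim/On_ind: a => a a_int.
    rewrite [_ *: sqm_pi d x]sqm_scale_pi// -sqm_piD ?os_Z// !fV_pi ?os_D ?os_Z//.
    by rewrite [_ *: sqm_pi d (f _)]sqm_scale_pi ?fP// -sqm_piD ?os_Z ?fP// f_lin.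
  by rewrite !fV_pi// [LHS]sqm_form_pi ?fP// [RHS]sqm_form_pi// f_form.
by exists (MkSp fV_sp) => x xP; rewrite permE fV_pi.
Qed.

Definition transvection (s : k) (v z : W) : W := z + (s * ss_form z v) *: v.

Lemma transvection_linear s v : linear (transvection s v).
Proof.
move=> a y z; rewrite /transvection wformDl wformZl scalerDr scalerA addrACA.
by congr (_ + _); rewrite -scalerDl; congr (_ *: _); ring.
Qed.

Lemma transvectionK s v : cancel (transvection s v) (transvection (- s) v).
Proof.
move=> z; rewrite /transvection wformDl wformZl ss_alt mulr0 addr0 mulNr scaleNr.
by rewrite addrK.
Qed.

Lemma transvection_form s v x y :
  ss_form (transvection s v x) (transvection s v y) = ss_form x y.
Proof.
rewrite /transvection !wformDl !wformDr !wformZl !wformZr ss_alt.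
by rewrite [ss_form v y]wformC; ring.
Qed.

End Isometries.

Lemma parity j : (exists i, j = i.*2) \/ (exists i, j = i.*2.+1).
Proof. by rewrite -(odd_double_half j); case: (odd j); [right|left]; exists j./2. Qed.

Section Chain.
Variables (k : localField) (W : sympSpace k) (mu : int) (P : osub W).
Local Notation pi := (lf_unif k).
Local Notation P' := (dual mu P).

(* P > pi P' > pi P > pi^2 P' > ... *)
Definition chain (j : nat) : osub W :=
  if odd j then oscale j./2.+1 P' else oscale j./2 P.

Lemma chain_double i : chain i.*2 = oscale i P.
Proof. by rewrite /chain odd_double doubleK. Qed.
Lemma chain_doubleS i : chain i.*2.+1 = oscale i.+1 P'.
Proof. by rewrite /chain /= odd_double uphalf_double. Qed.

Lemma chain0 : chain 0 =i P.
Proof. by move=> x; rewrite -[0%N]double0 chain_double oscale0. Qed.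

Lemma chain_shift i j x : (pi ^ i%:Z *: x \in chain (i.*2 + j)) = (x \in chain j).
Proof.
have [[m ->]|[m ->]] := parity j.
  rewrite -doubleD !chain_double in_oscale_shift; congr (x \in oscale _ _); lia.
rewrite addnS -doubleD !chain_doubleS in_oscale_shift; congr (x \in oscale _ _); lia.
Qed.

Hypothesis P_bidual : dual mu P' =i P.

Lemma chain_dual m j :
  (j <= m.*2.+1)%N -> dual (mu + m.+1%:Z) (chain j) =i chain (m.*2.+1 - j).
Proof.
move=> jm x; rewrite dualD.
have [[i jE]|[i jE]] := parity j; move: jm; rewrite {j}jE => im.
  rewrite chain_double (eq_oscale _ (dual_oscale _ _ _)) oscaleD.
  have -> : (m.*2.+1 - i.*2 = (m - i).*2.+1)%N by lia.
  by rewrite chain_doubleS; congr (x \in oscale _ _); lia.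
rewrite chain_doubleS (eq_oscale _ (dual_oscale _ _ _)) oscaleD (eq_oscale _ P_bidual).
have -> : (m.*2.+1 - i.*2.+1 = (m - i).*2)%N by lia.
by rewrite chain_double; congr (x \in oscale _ _); lia.
Qed.

Hypothesis sub1 : {subset oscale 1 P' <= P}.
Hypothesis sub2 : {subset P <= P'}.

Lemma chainS j : {subset chain j.+1 <= chain j}.
Proof.
move=> x; have [[i ->]|[i ->]] := parity j.
  rewrite chain_doubleS chain_double !in_oscale => xP'; apply: sub1.
  by rewrite in_oscale unifXD -opprD -PoszD add1n.
by rewrite -doubleS chain_double chain_doubleS !in_oscale; exact: sub2.
Qed.

Lemma chain_mono i j : (i <= j)%N -> {subset chain j <= chain i}.
Proof.
move=> ij x; rewrite -(subnK ij); elim: (j - i)%N => [//|m IH].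
by rewrite addSn => /chainS/IH.
Qed.

Lemma chain_sub j : {subset chain j <= P}.
Proof. by move=> x /(chain_mono (leq0n j)); rewrite chain0. Qed.

Lemma form_chain (t : bool) z v : z \in P -> v \in chain t -> ss_form z v \in ppow k (mu + t).
Proof.
move=> zP vt; rewrite wformC ppowN//; apply/dualP: zP; case: t vt => /=.
  by rewrite dualD.
by rewrite chain0 addr0; exact: sub2.
Qed.

Lemma chain_scale_dual (t : bool) v : v \in chain t -> v \in oscale t P'.
Proof. by case: t => //; rewrite chain0 oscale0; exact: sub2. Qed.

Lemma exists_unit_pairing (t : bool) x : x \in chain t -> x \notin chain t.+1 ->
  exists2 z, z \in chain t & ss_form x z \notin ppow k (mu + t.+1).
Proof.
move=> xt xt1; apply: not_forall_in => xz; case/negP: xt1.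
have -> : t.+1 = (t.*2.+1 - t)%N by case: t {xt xz}.
by rewrite -chain_dual ?leqW ?leq_addl//; [apply/dualP => z /xz|case: t {xt xz}].
Qed.

End Chain.

Section Levels.
Variables (k : localField) (W : sympSpace k) (n : nat) (d : sqData W n) (mu : int).
Local Notation pi := (lf_unif k).
Local Notation P := (sqd_P d).
Local Notation Q := (sqd_Q d).
Local Notation P' := (dual mu P).
Local Notation V := (sqm d).
Local Notation chain := (chain mu P).

(* P is a good lattice for the duality defined by mu, and sqm d is the corresponding
   module "b_n". *)
Record good_data : Prop := GoodData {
  good_scale : sqd_c d = pi ^ (- mu);
  good_denom : Q =i oscale n.+1 P';
  good_bidual : dual mu P' =i P;
  good_sub1 : {subset oscale 1 P' <= P};
  good_sub2 : {subset P <= P'}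
}.

Hypothesis d_good : good_data.
Let P_bidual := good_bidual d_good.
Let sub1 := good_sub1 d_good.
Let sub2 := good_sub2 d_good.

Lemma chain_last : chain n.*2.+1 =i Q.
Proof. by move=> x; rewrite chain_doubleS (good_denom d_good). Qed.

Lemma ppow_scale_form m (x y : W) :
  (sqd_c d * ss_form x y \in ppow k m) = (ss_form x y \in ppow k (mu + m)).
Proof. by rewrite (good_scale d_good) ppow_shift opprK addrC. Qed.

Definition chain_level (v : V) : nat :=
  \max_(j < n.*2.+2 | sqm_repr v \in chain j) j.

Lemma chain_level_max v : (chain_level v <= n.*2.+1)%N.
Proof. by apply/bigmax_leqP => j _; rewrite -ltnS. Qed.

Lemma leq_level_repr j v : (j <= n.*2.+1)%N ->
  (j <= chain_level v)%N = (sqm_repr v \in chain j).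
Proof.
move=> jn; apply/idP/idP => [le_j|vj]; last first.
  by have := @leq_bigmax_cond _ (fun j : 'I__ => sqm_repr v \in chain j) (fun j => val j)
    (Ordinal (jn : (j < n.*2.+2)%N)) vj.
have [|i vi levE] :=
    @eq_bigmax_cond _ (fun j : 'I_n.*2.+2 => sqm_repr v \in chain j) (fun j => val j).
  by apply/card_gt0P; exists ord0; rewrite unfold_in /= (chain0 mu P) sq_reprP.
by apply: (chain_mono sub1 sub2) vi; move: le_j; rewrite /chain_level levE.
Qed.

Lemma leq_level_pi j x : (j <= n.*2.+1)%N -> x \in P ->
  (j <= chain_level (sqm_pi d x))%N = (x \in chain j).
Proof.
move=> jn xP; rewrite leq_level_repr//.
have repr_x : sqm_repr (sqm_pi d x) - x \in chain j.
  by apply: (chain_mono sub1 sub2 jn); rewrite chain_last; exact: sq_repr_pi.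
by rewrite -[sqm_repr _](subrK x) rpredDl.
Qed.

Lemma level_pi_eq j x : (j < n.*2.+1)%N -> x \in chain j -> x \notin chain j.+1 ->
  chain_level (sqm_pi d x) = j.
Proof.
move=> jn xj xj1; have xP := chain_sub sub1 sub2 xj.
by apply/eqP; rewrite eqn_leq leqNgt !leq_level_pi ?xj1// ltnW.
Qed.

Lemma mem_img_chain j v : (j <= n.*2.+1)%N ->
  (v \in sqm_img d (chain j)) = (j <= chain_level v)%N.
Proof.
move=> jn; apply/sqm_imgP/idP => [[x xj ->]|].
  by rewrite leq_level_pi//; exact: chain_sub xj.
by rewrite leq_level_repr// => vj; exists (sqm_repr v) => //; rewrite [RHS]sq_reprK.
Qed.

Lemma img_chain_inv j (g : Sp V) : (j <= n.*2.+1)%N ->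
  {in sqm_img d (chain j), forall v, g v \in sqm_img d (chain j)}.
Proof.
have [[i ->]|[i ->]] := parity j => jn.
  by apply: (@sqm_img_inv_im _ _ _ _ _ i) => x; rewrite chain_double.
apply: (@sqm_img_inv_ker _ _ _ _ _ _ (n - i)) => [|x xP]; first exact: chain_sub.
by rewrite chain_doubleS (good_denom d_good) in_oscale_shift; congr (x \in oscale _ _); lia.
Qed.

Lemma chain_level_sp (g : Sp V) v : chain_level (g v) = chain_level v.
Proof.
have le_level (h : Sp V) w : (chain_level w <= chain_level (h w))%N.
  have jn := chain_level_max w.
  by rewrite -mem_img_chain//; apply: img_chain_inv => //; rewrite mem_img_chain.
apply/eqP; rewrite eqn_leq le_level andbT.
by have := le_level g^-1%g (g v); rewrite sp_invK.
Qed.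

Lemma chain_level_sub j v w :
  (j <= chain_level v)%N -> (j <= chain_level w)%N -> (j <= chain_level (v - w)%R)%N.
Proof.
move=> jv jw; have jn := leq_trans jv (chain_level_max v).
have img_sub : {subset chain j <= P} by exact: chain_sub.
have [_ img_lin] := sqm_img_submod (d := d) img_sub.
by move: jv jw; rewrite -!mem_img_chain// => jv jw; rewrite addrC -scaleN1r; exact: img_lin.
Qed.

Lemma form_pi_eq0 x y : x \in P -> y \in P ->
  (am_form (sqm_pi d x : V) (sqm_pi d y) == 0) = (ss_form x y \in ppow k (mu + n.+1)).
Proof.
move=> xP yP; rewrite [am_form _ _]sqm_form_pi// -(redn0 k n).
by rewrite redn_eqE ?ppow0 ?sqd_int ?subr0 ?ppow_scale_form.
Qed.

Lemma orthogonal_level j v : (j <= n.*2.+1)%N ->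
  (forall w : V, (j <= chain_level w)%N -> am_form v w = 0) <->
  (n.*2.+1 - j <= chain_level v)%N.
Proof.
move=> jn; elim/sqm_ind: v => x xP; rewrite leq_level_pi ?leq_subr//.
rewrite -(chain_dual P_bidual jn); split=> [x_orth|/dualP x_orth].
  apply/dualP => y yj; have yP := chain_sub sub1 sub2 yj.
  by rewrite -form_pi_eq0//; apply/eqP/x_orth; rewrite leq_level_pi.
by elim/sqm_ind => y yP; rewrite leq_level_pi// => /x_orth; rewrite -form_pi_eq0// => /eqP.
Qed.

Lemma sqm_nondegenerate : nondegenerate V.
Proof.
move=> x x_orth; have : (n.*2.+1 - 0 <= chain_level x)%N.
  by apply/orthogonal_level => // w _; rewrite formC x_orth oppr0.
rewrite subn0; elim/sqm_ind: x {x_orth} => x xP; rewrite leq_level_pi// chain_last => xQ.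
by rewrite -(sq_pi0 (os_pred P) (os_pred Q)); apply: sq_eqP; rewrite ?rpred0 ?subr0.
Qed.

(* The transvection in the direction y - x that maps x to y. *)
Lemma unit_pairing_orbit (t : bool) x y : x \in chain t -> y \in chain t ->
  ss_form x y \notin ppow k (mu + t + 1) ->
  exists g : Sp V, g (sqm_pi d x) = sqm_pi d y.
Proof.
move=> xt yt; set e := ss_form x y => e_unit.
have e0 : e != 0 by apply: contraNneq e_unit => ->; exact: ppow0.
have eV := ppowV e0 e_unit.
pose v := y - x; have vt : v \in chain t by rewrite rpredB.
have vP := chain_sub sub1 sub2 vt.
have form_xv : ss_form x v = e.
  by rewrite /v -scaleN1r wformDr wformZr ss_alt mulr0 addr0.
have tauP s : s \in ppow k (- (mu + t)) -> {homo transvection s v : z / z \in P}.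
  move=> s_in z zP; rewrite os_D// os_Z//.
  by have := ppowM s_in (form_chain sub2 zP vt); rewrite addNr.
have tauQ s : s \in ppow k (- (mu + t)) -> {homo transvection s v : z / z \in Q}.
  move=> s_in z zQ; apply: os_D => //; rewrite (good_denom d_good).
  have := sqd_rad vP zQ; rewrite ppow_scale_form wformC => /ppowN; rewrite opprK.
  move/(ppowM s_in)/scale_oscale/(_ (chain_scale_dual sub2 vt)).
  by congr (_ \in oscale _ _); ring.
have [g gE] := sqm_isometry (@transvection_linear _ W e^-1 v) (transvectionK _ _)
  (transvection_form _ _) (tauP _ eV) (tauQ _ eV) (tauQ _ (ppowN eV)).
exists g; rewrite gE; last exact: chain_sub xt.
by rewrite /transvection form_xv mulVf// scale1r addrC subrK.
Qed.

Lemma stratum_orbit (t : bool) x y : x \in chain t -> x \notin chain t.+1 ->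
  y \in chain t -> y \notin chain t.+1 ->
  exists g : Sp V, g (sqm_pi d x) = sqm_pi d y.
Proof.
move=> xt xt1 yt yt1; set m := mu + t.+1%:Z.
have mE : mu + t + 1 = m by rewrite /m; lia.
suff [z zt [xz yz]] : exists2 z, z \in chain t &
    ss_form x z \notin ppow k m /\ ss_form y z \notin ppow k m.
  have [|g gx] := unit_pairing_orbit xt zt; first by rewrite mE.
  have [|h hz] := unit_pairing_orbit zt yt.
    by rewrite mE wformC; apply: contra yz => /ppowN; rewrite opprK.
  by exists (h * g)%g; rewrite sp_mulE gx.
have [z1 z1t xz1] := exists_unit_pairing P_bidual xt xt1.
have [z2 z2t yz2] := exists_unit_pairing P_bidual yt yt1.
have [yz1|yz1] := boolP (ss_form y z1 \in ppow k m); last by exists z1.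
have [xz2|xz2] := boolP (ss_form x z2 \in ppow k m); last by exists z2.
exists (z1 + z2); first by rewrite rpredD.
rewrite !wformDr; split.
  by apply: contra xz1 => xz; have := ppowB xz xz2; rewrite addrK.
by apply: contra yz2 => yz; have := ppowB yz yz1; rewrite addrC addKr.
Qed.

Lemma chain_level_orbit v w : chain_level v = chain_level w -> exists g : Sp V, g v = w.
Proof.
move=> vw; have jn := chain_level_max v; set j := chain_level v in vw jn.
elim/sqm_ind: v @j vw jn => x xP j; elim/sqm_ind: w => y yP vw jn.
have xj : x \in chain j by rewrite -leq_level_pi// leqnn.
have yj : y \in chain j by rewrite -leq_level_pi// vw leqnn.
have [j_lt|j_ge] := ltnP j n.*2.+1; last first.
  exists 1%g; rewrite sp_oneE; apply: sq_eqP => //.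
  have j_last : j = n.*2.+1 by apply/eqP; rewrite eqn_leq jn.
  by rewrite -chain_last -j_last rpredB.
have xj1 : x \notin chain j.+1 by rewrite -leq_level_pi// -ltnNge.
have yj1 : y \notin chain j.+1 by rewrite -leq_level_pi// -ltnNge vw.
pose i := j./2; pose t := odd j; have jE : j = (i.*2 + t)%N by rewrite addnC odd_double_half.
pose x0 := pi ^ (- i%:Z) *: x; pose y0 := pi ^ (- i%:Z) *: y.
have xE : x = pi ^ i%:Z *: x0 by rewrite unifXK.
have yE : y = pi ^ i%:Z *: y0 by rewrite unifXK.
move: xj yj xj1 yj1; rewrite xE yE jE -addnS !chain_shift => x0t y0t x0t1 y0t1.
have [x0P y0P] := (chain_sub sub1 sub2 x0t, chain_sub sub1 sub2 y0t).
have [g gx0] := stratum_orbit x0t x0t1 y0t y0t1; exists g.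
by rewrite !sqm_pi_unif// sp_scale gx0.
Qed.

Variable U : invIso V.
Hypothesis U_chain : ii_set U =i sqm_img d (chain n.+1).

Let le_n1 : (n.+1 <= n.*2.+1)%N. Proof. by rewrite ltnS -addnn leq_addr. Qed.

Lemma mem_ii_level v : (v \in ii_set U) = (n < chain_level v)%N.
Proof. by rewrite U_chain mem_img_chain. Qed.

Lemma mem_perp_level v : (v \in perp U) = (n <= chain_level v)%N.
Proof.
have -> : (n <= chain_level v)%N = (n.*2.+1 - n.+1 <= chain_level v)%N by congr leq; lia.
apply/perpP/idP => [v_perp|/(orthogonal_level v le_n1) v_orth w].
  by apply/orthogonal_level => // w; rewrite -mem_ii_level; exact: v_perp.
by rewrite mem_ii_level; exact: v_orth.
Qed.

Lemma ubar_nondegenerate : nondegenerate (ubar U).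
Proof.
elim/ubar_ind => x xP x_orth; apply/eqP; rewrite ubar_pi_eq0// mem_ii_level.
have -> : n.+1 = (n.*2.+1 - n)%N by lia.
apply/orthogonal_level => [|w]; first exact: ltnW.
by rewrite -mem_perp_level => wP; rewrite formC -(form_ubar_pi wP xP) x_orth oppr0.
Qed.

Lemma chain_level_structure : ~ {subset P <= oscale 1 P'} -> level_structure U n chain_level.
Proof.
move=> /not_forall_in[b bP bP'].
split; [exact: chain_level_max|exact: chain_level_sp|exact: chain_level_orbit
  |exact: mem_perp_level|exact: mem_ii_level|exact: chain_level_sub|].
move=> j; have [[i ->] _ jn|[i ->]] := parity j; last by rewrite /= odd_double.
exists (sqm_pi d (pi ^ i%:Z *: b)); apply: level_pi_eq => //.
  by rewrite -[i.*2]addn0 chain_shift chain0.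
by rewrite -addn1 chain_shift.
Qed.

Lemma chain_full_levels : ~ {subset P' <= P} -> full_levels n chain_level.
Proof.
move=> /not_forall_in[b bP' bP] j; have [[i ->]|[i ->] _ jn] := parity j.
  by rewrite odd_double.
exists (sqm_pi d (pi ^ i.+1%:Z *: b)); apply: level_pi_eq; first by rewrite ltnS.
  by rewrite chain_doubleS mem_oscale.
by rewrite -doubleS chain_double in_oscale_shift subrr oscale0.
Qed.

Lemma chain_half_levels : {subset P' <= P} -> half_levels n chain_level.
Proof.
move=> P'P v odd_v; apply/eqP; rewrite eqn_leq chain_level_max leqNgt; apply/negP => lt_v.
have := ltnn (chain_level v); rewrite leq_level_repr// => /negP; apply.
have : sqm_repr v \in chain (chain_level v) by rewrite -leq_level_repr// ltnW.
have [[i vE]|[i ->]] := parity (chain_level v); first by rewrite vE odd_double in odd_v.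
by rewrite chain_doubleS -doubleS chain_double !in_oscale; exact: P'P.
Qed.

End Levels.

Theorem lattice_weil_decomposes (C : numClosedFieldType) (k : localField) (W : sympSpace k)
    (n : nat) (d : sqData W n) (mu : int) (U : invIso (sqm d)) (psi : On k n -> C)
    (S : weilRep C (sqm d) (Sp (sqm d))) :
  primitive_char psi -> (2%:R : On k n) \is a GRing.unit -> good_data d mu ->
  ii_set U =i sqm_img d (chain mu (sqd_P d) n.+1) ->
  ~ {subset sqd_P d <= oscale 1 (dual mu (sqd_P d))} -> is_weil psi id S ->
  weil_decomposes psi U n (~ {subset dual mu (sqd_P d) <= sqd_P d})
    {subset dual mu (sqd_P d) <= sqd_P d} S.
Proof.
move=> psi_prim two_unit d_good U_chain proper S_weil.
have full := chain_full_levels d_good; have half := chain_half_levels d_good.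
apply: (weil_decomposesW full half); apply: level_weil_decomposes => //.
- exact: (sqm_nondegenerate d_good).
- exact: (ubar_nondegenerate d_good U_chain).
- exact: (chain_level_structure d_good U_chain proper).
- by have [/half|/full] := pselect {subset dual mu (sqd_P d) <= sqd_P d}; [right|left].
Qed.

(** * The modules b_n and b*_n *)

Lemma two_unit_On (k : localField) (n : nat) :
  2%N \notin [pchar (On k 0)] -> (2%:R : On k n) \is a GRing.unit.
Proof.
have twoE m : (2%:R : On k m) = redn m (2%:R : k).
  by rewrite [RHS](rednD _ (ppow1 k) (ppow1 k)) redn1.
have two_int : (2%:R : k) \in ppow k 0 by apply: ppowD; exact: ppow1.
move=> pchar2; have two_notin : (2%:R : k) \notin ppow k 1.
  apply: contra pchar2 => two_in; apply/andP; split=> //=; apply/eqP.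
  by rewrite twoE; exact: redn_eq0.
have two0 : (2%:R : k) != 0 by apply: contraNneq two_notin => ->; exact: ppow0.
have twoV_int : (2%:R : k)^-1 \in ppow k 0.
  by have := @ppowV k 2%:R 0 two0; rewrite add0r oppr0; apply.
rewrite twoE; apply/unitrPr; exists (redn n (2%:R : k)^-1).
by rewrite -rednM// divff// redn1.
Qed.

Section GoodLattices.
Variables (C : numClosedFieldType) (k : localField) (W : sympSpace k) (lam : int).
Variables (B : goodLattice W lam) (n : nat).
Local Notation Bd := (dual lam B).

Lemma bn_good : good_data (bn_data B n) lam.
Proof. by split=> //; [exact: lattice_bidual|exact: gl_sub1|exact: gl_sub2]. Qed.

Lemma u_n_chain : ii_set (u_n B n) =i sqm_img (bn_data B n) (chain lam B n.+1).
Proof.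
by move=> v; congr (v \in sqm_img _ _); rewrite /u_osub /chain /= uphalf_half; case: odd.
Qed.

Lemma dual_dual_pred : dual (lam - 1) Bd =i oscale (-1) B.
Proof. by move=> x; rewrite dualD (eq_oscale _ (lattice_bidual _ _)). Qed.

Lemma oscale_dual_dual_pred i : oscale (i + 1) (dual (lam - 1) Bd) =i oscale i B.
Proof. by move=> x; rewrite (eq_oscale _ dual_dual_pred) oscaleD addrK. Qed.

(* The second case is the first one for the lattice B^* and the integer lam - 1. *)
Lemma bs_good : good_data (bs_data B n) (lam - 1).
Proof.
split=> /=.
- by rewrite opprB.
- by move=> x; rewrite -addn1 PoszD oscale_dual_dual_pred.
- move=> x; rewrite (eq_dual _ dual_dual_pred) dual_oscale (eq_oscale _ (dualD _ _ _)) oscaleD.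
  by rewrite opprK subrr oscale0.
- by move=> x; rewrite -[1]add0r oscale_dual_dual_pred oscale0; exact: gl_sub2.
- move=> x xBd; rewrite dual_dual_pred; apply: gl_scale1.
  by rewrite addNr oscale0.
Qed.

Lemma us_n_chain : ii_set (us_n B n) =i sqm_img (bs_data B n) (chain (lam - 1) Bd n.+1).
Proof.
have us_chain x : (x \in us_osub B n) = (x \in chain (lam - 1) Bd n.+1).
  rewrite /us_osub /chain /= uphalf_half; case: odd => //=.
  by rewrite -addn1 PoszD oscale_dual_dual_pred add0n.
by move=> v; apply/sqm_imgP/sqm_imgP => -[x xT ->]; exists x; rewrite // ?us_chain// -us_chain.
Qed.

Variable psi : On k n -> C.
Hypotheses (psi_prim : primitive_char psi) (two_unit : (2%:R : On k n) \is a GRing.unit).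

Theorem bn_weil_decomposes (S : weilRep C (bn B n) (Sp (bn B n))) :
  osub_proper (oscale 1 Bd) B -> is_weil psi id S ->
  weil_decomposes psi (u_n B n) n (osub_proper B Bd) (B =i Bd) S.
Proof.
move=> [_ proper] S_weil; apply: weil_decomposesW
  (lattice_weil_decomposes psi_prim two_unit bn_good u_n_chain proper S_weil) => [[]//|BE x].
by rewrite BE.
Qed.

Theorem bs_weil_decomposes (S : weilRep C (bs B n) (Sp (bs B n))) :
  osub_proper B Bd -> is_weil psi id S ->
  weil_decomposes psi (us_n B n) n (osub_proper (oscale 1 Bd) B) (oscale 1 Bd =i B) S.
Proof.
move=> [_ proper] S_weil.
have dual_in x : (x \in dual (lam - 1) Bd) = (lf_unif k ^ 1 *: x \in B).
  by rewrite dual_dual_pred in_oscale opprK.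
have mem_Bd x : (x \in Bd) = (lf_unif k ^ 1 *: x \in oscale 1 Bd).
  by rewrite in_oscale_shift subrr oscale0.
have proper' : ~ {subset Bd <= oscale 1 (dual (lam - 1) Bd)}.
  by move=> sub; apply: proper => x /sub; rewrite -[1]add0r oscale_dual_dual_pred oscale0.
apply: weil_decomposesW
  (lattice_weil_decomposes psi_prim two_unit bs_good us_n_chain proper' S_weil).
  move=> [_ not_sub] sub; apply: not_sub => x xB; rewrite in_oscale; apply: sub.
  by rewrite dual_in unifXK.
by move=> BE x; rewrite dual_in -BE -mem_Bd.
Qed.

End GoodLattices.

Theorem mainTheorem1 (R : realType) (k : localField)
    (residue_char : 2%N \notin [pchar (On k 0)])
    (lam : int) (r : nat) (W : sympSpace k) (dimW : \dim {:W}%VS = (2 * r)%N)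
    (B : goodLattice W lam) (n : nat)
    (psi : On k n -> R[i]) (psi_primitive : primitive_char psi) :
  (osub_proper (oscale 1 (dual lam B)) B ->
   forall S : weilRep R[i] (bn B n) (Sp (bn B n)),
   is_weil psi id S ->
   exists sigma : weilRep R[i] (ubar (u_n B n)) (Sp (bn B n)),
   [/\ is_weil psi (rU (u_n B n)) sigma,
       weil_iso S (weil_model psi sigma),
       forall sigma' : weilRep R[i] (ubar (u_n B n)) (Sp (bn B n)),
         is_weil psi (rU (u_n B n)) sigma' ->
         weil_iso S (weil_model psi sigma') -> weil_iso sigma sigma'
     & forall X : {set bn B n}, orbit_reps (u_n B n) X ->
       let D := summand_index (u_n B n) X in
       [/\ {in D, forall i, irreducible (summand sigma i)},
           {in D &, forall i j, i != j ->
              ~ repn_iso (summand sigma i) (summand sigma j)},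
           osub_proper B (dual lam B) -> #|D| = (2 * n + 2)%N,
           B =i dual lam B -> #|D| = (n + 2)%N
         & B =i dual lam B -> odd n ->
             {in D, forall i, monomial (summand sigma i)}]]) /\
  (osub_proper B (dual lam B) ->
   forall S : weilRep R[i] (bs B n) (Sp (bs B n)),
   is_weil psi id S ->
   exists sigma : weilRep R[i] (ubar (us_n B n)) (Sp (bs B n)),
   [/\ is_weil psi (rU (us_n B n)) sigma,
       weil_iso S (weil_model psi sigma),
       forall sigma' : weilRep R[i] (ubar (us_n B n)) (Sp (bs B n)),
         is_weil psi (rU (us_n B n)) sigma' ->
         weil_iso S (weil_model psi sigma') -> weil_iso sigma sigma'
     & forall X : {set bs B n}, orbit_reps (us_n B n) X ->
       let D := summand_index (us_n B n) X in
       [/\ {in D, forall i, irreducible (summand sigma i)},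
           {in D &, forall i j, i != j ->
              ~ repn_iso (summand sigma i) (summand sigma j)},
           osub_proper (oscale 1 (dual lam B)) B -> #|D| = (2 * n + 2)%N,
           oscale 1 (dual lam B) =i B -> #|D| = (n + 2)%N
         & oscale 1 (dual lam B) =i B -> odd n ->
             {in D, forall i, monomial (summand sigma i)}]]).
Proof.
have two_unit := two_unit_On n residue_char.
by split=> *; [exact: bn_weil_decomposes|exact: bs_weil_decomposes].
Qed.
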